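(* Let $1\le k<n$ and $m\ge 1$ be integers, and let $F_\alpha^A=F_\alpha^A(x,p,p')$, for $A=1,\dots,m$ and $\alpha=k+1,\dots,n$, be real-valued, real-analytic functions defined in an open subset $U$ of $\mathbb{R}^n\times\mathbb{R}^m\times\mathbb{R}^{mk}$. The following are equivalent. (i) The Cauchy problem $$\frac{\partial u^A}{\partial x^\alpha}=F_\alpha^A\Big(x,u,\frac{\partial u}{\partial x^1},\dots,\frac{\partial u}{\partial x^k}\Big),\qquad u^A(x^1,\dots,x^k,x_0^{k+1},\dots,x_0^n)=a^A(x^1,\dots,x^k),$$ ($A=1,\dots,m$, $\alpha=k+1,\dots,n$) is solvable for every initial data at every $(x_0,p_0,p_0')\in U$. (ii) This Cauchy problem is approximately solvable for every initial data at every $(x_0,p_0,p_0')\in U$. (iii) The functions $F_\alpha^A$ satisfy $$\Phi^A_{\alpha\beta}(x,p,p')=\Phi^A_{\beta\alpha}(x,p,p'),\qquad \Psi^{A\Gamma\Lambda}_{\alpha\beta C}(x,p,p')=\Psi^{A\Gamma\Lambda}_{\beta\alpha C}(x,p,p')$$ for all $A,C=1,\dots,m$, $\Lambda,\Gamma=1,\dots,k$, $\alpha,\beta=k+1,\dots,n$ and all $(x,p,p')\in U$, where $$\Phi^A_{\alpha\beta}:=\frac{\partial F^A_\alpha}{\partial x^\beta}+\sum_{B=1}^m\frac{\partial F^A_\alpha}{\partial p^B}F^B_\beta+\sum_{\Gamma=1}^k\sum_{B=1}^m\frac{\partial F^A_\alpha}{\partial p^B_\Gamma}\Big(\frac{\partial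 F^B_\beta}{\partial x^\Gamma}+\sum_{C=1}^m\frac{\partial F^B_\beta}{\partial p^C}p^C_\Gamma\Big),$$ $$\Psi^{A\Gamma\Lambda}_{\alpha\beta C}:=\sum_{B=1}^m\Big(\frac{\partial F^A_\alpha}{\partial p^B_\Gamma}\frac{\partial F^B_\beta}{\partial p^C_\Lambda}+\frac{\partial F^A_\alpha}{\partial p^B_\Lambda}\frac{\partial F^B_\beta}{\partial p^C_\Gamma}\Big).$$
   Context: Coordinates: $x=(x^1,\dots,x^n)\in\mathbb{R}^n$, and on $\mathbb{R}^n\times\mathbb{R}^m\times\mathbb{R}^{mk}$ the coordinates are $(x,p,p')$ with $p=(p^A)_{A=1,\dots,m}$, $p'=(p^A_\Gamma)_{A=1,\dots,m,\ \Gamma=1,\dots,k}$. A point $(x_0,p_0,p_0')\in U$ is fixed; an admissible initial datum at this point is a real-analytic $\mathbb{R}^m$-valued function $a=(a^1,\dots,a^m)$ defined near $(x_0^1,\dots,x_0^k)\in\mathbb{R}^k$ with $a(x_0^1,\dots,x_0^k)=p_0$ and $\big(\frac{\partial a}{\partial x^1},\dots,\frac{\partial a}{\partial x^k}\big)(x_0^1,\dots,x_0^k)=p_0'$. The Cauchy problem is solvable for every initial data at $(x_0,p_0,p_0')$ if for every admissible initial datum $a$ there is a unique real-analytic solution $u=(u^1,\dots,u^m)$ of the Cauchy problem in an open neighborhood of $x_0$. A real-analytic $\mathbb{R}^m$-valued function $u$ defined near $x_0$ is an approximate solution at $x_0$ (for the datum $a$) if $\frac{\partial u^A}{\partial x^\alpha}=F^A_\alpha(x,u,\frac{\partial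 u}{\partial x^1},\dots,\frac{\partial u}{\partial x^k})+O(\sum_{i=1}^n|x^i-x_0^i|^2)$ and $u^A(x^1,\dots,x^k,x_0^{k+1},\dots,x_0^n)=a^A(x^1,\dots,x^k)+O(\sum_{j=1}^k|x^j-x_0^j|^3)$ for all $A,\alpha$. The Cauchy problem is approximately solvable for every initial data at $(x_0,p_0,p_0')$ if for every admissible initial datum $a$ there exists an approximate solution at $x_0$. *)

(* Defs.v *)
From HB Require Import structures.
From mathcomp Require Import all_boot all_order all_algebra.
From mathcomp Require Import all_classical all_reals all_analysis.
Set Implicit Arguments. Unset Strict Implicit. Unset Printing Implicit Defensive.
Import Order.TTheory GRing.Theory Num.Theory.
Import numFieldNormedType.Exports.
Local Open Scope classical_set_scope.
Local Open Scope ring_scope.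

Section Defs.
Variable R : realType.

Section Coords.
Variable I : finType.

Definition open_set (U : set (I -> R)) : Prop :=
  forall a, U a -> exists r : R, 0 < r /\
    forall z, (forall i, `|z i - a i| < r) -> U z.

(* f is real-analytic at a: near a it is the sum of an absolutely convergent
   power series  sum_al c_al (z - a)^al  over multi-indices al : I -> nat
   (partial sums over the boxes {al | al_i < D}). *)
Definition analytic_at (f : (I -> R) -> R) (a : I -> R) : Prop :=
  exists (c : {ffun I -> nat} -> R) (r : R), 0 < r /\
    forall z, (forall i, `|z i - a i| < r) ->
      (exists M : R, forall D : nat,
         \sum_(al : {ffun I -> 'I_D})
            `|c [ffun i => nat_of_ord (al i)] * \prod_i (z i - a i) ^+ al i| <= M)
      /\ (fun D : nat => \sum_(al : {ffun I -> 'I_D})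
            c [ffun i => nat_of_ord (al i)] * \prod_i (z i - a i) ^+ al i)
           @ \oo --> f z.

Definition analytic_on (U : set (I -> R)) (f : (I -> R) -> R) : Prop :=
  open_set U /\ forall a, U a -> analytic_at f a.

Definition partial (f : (I -> R) -> R) (j : I) (z : I -> R) : R :=
  derive1 (fun t : R => f (fun i => if i == j then t else z i)) (z j).
End Coords.

(* ---- the jet space R^n x R^m x R^{mk}, with n = k + l ---- *)
Variables k l m : nat.

Definition jcoord := ('I_(k + l) + ('I_m + 'I_m * 'I_k))%type.

Definition jet (x : 'I_(k + l) -> R) (p : 'I_m -> R) (p' : 'I_m -> 'I_k -> R)
  : jcoord -> R :=
  fun c => match c with
           | inl i => x i
           | inr (inl A) => p A
           | inr (inr (A, G)) => p' A G
           end.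

Definition cX (i : 'I_(k + l)) : jcoord := inl i.
Definition cP (A : 'I_m) : jcoord := inr (inl A).
Definition cP' (A : 'I_m) (G : 'I_k) : jcoord := inr (inr (A, G)).

Definition xfree (G : 'I_k) : 'I_(k + l) := lshift l G.
Definition xdep (b : 'I_l) : 'I_(k + l) := rshift k b.

Definition proj_free (x : 'I_(k + l) -> R) : 'I_k -> R := fun G => x (xfree G).

Definition jet_of (u : 'I_m -> ('I_(k + l) -> R) -> R) (x : 'I_(k + l) -> R)
  : jcoord -> R :=
  jet x (fun A => u A x) (fun A G => partial (u A) (xfree G) x).

Variable U : set (jcoord -> R).
(* F A b = F^A_alpha with alpha = k + 1 + b *)
Variable F : 'I_m -> 'I_l -> (jcoord -> R) -> R.

Definition admissible (x0 : 'I_(k + l) -> R) (p0 : 'I_m -> R)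
    (p0' : 'I_m -> 'I_k -> R) (a : 'I_m -> ('I_k -> R) -> R)
    (W : set ('I_k -> R)) : Prop :=
  [/\ open_set W, W (proj_free x0), (forall A, analytic_on W (a A)),
      (forall A, a A (proj_free x0) = p0 A) &
      (forall A G, partial (a A) G (proj_free x0) = p0' A G)].

Definition cauchy_solution (x0 : 'I_(k + l) -> R)
    (a : 'I_m -> ('I_k -> R) -> R) (W : set ('I_k -> R))
    (V : set ('I_(k + l) -> R)) (u : 'I_m -> ('I_(k + l) -> R) -> R) : Prop :=
  [/\ open_set V, V x0, (forall A, analytic_on V (u A)),
      (forall x, V x -> U (jet_of u x)) /\
      (forall x A b, V x -> partial (u A) (xdep b) x = F A b (jet_of u x)) &
      (forall x A, V x -> (forall b, x (xdep b) = x0 (xdep b)) ->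
         W (proj_free x) -> u A x = a A (proj_free x))].

Definition solvable_at (x0 : 'I_(k + l) -> R) (p0 : 'I_m -> R)
    (p0' : 'I_m -> 'I_k -> R) : Prop :=
  forall a W, admissible x0 p0 p0' a W ->
    (exists V u, cauchy_solution x0 a W V u) /\
    (forall V1 u1 V2 u2, cauchy_solution x0 a W V1 u1 ->
       cauchy_solution x0 a W V2 u2 ->
       exists V, [/\ open_set V, V x0 & forall x A, V x -> u1 A x = u2 A x]).

(* approximate solution at x0 (O(.) taken as x -> x0) *)
Definition approx_solution (x0 : 'I_(k + l) -> R)
    (a : 'I_m -> ('I_k -> R) -> R) (W : set ('I_k -> R))
    (u : 'I_m -> ('I_(k + l) -> R) -> R) : Prop :=
  exists (V : set ('I_(k + l) -> R)) (C : R),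
    [/\ open_set V, V x0, (forall A, analytic_on V (u A)),
      (forall x, V x -> U (jet_of u x)) /\
      (forall x A b, V x ->
         `|partial (u A) (xdep b) x - F A b (jet_of u x)|
           <= C * \sum_i `|x i - x0 i| ^+ 2) &
      (forall x A, V x -> (forall b, x (xdep b) = x0 (xdep b)) ->
         W (proj_free x) ->
         `|u A x - a A (proj_free x)|
           <= C * \sum_G `|x (xfree G) - x0 (xfree G)| ^+ 3)].

Definition approx_solvable_at (x0 : 'I_(k + l) -> R) (p0 : 'I_m -> R)
    (p0' : 'I_m -> 'I_k -> R) : Prop :=
  forall a W, admissible x0 p0 p0' a W -> exists u, approx_solution x0 a W u.

Definition solvable_everywhere : Prop :=
  forall x0 p0 p0', U (jet x0 p0 p0') -> solvable_at x0 p0 p0'.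

Definition approx_solvable_everywhere : Prop :=
  forall x0 p0 p0', U (jet x0 p0 p0') -> approx_solvable_at x0 p0 p0'.

Definition Phi (A : 'I_m) (al be : 'I_l) (z : jcoord -> R) : R :=
  partial (F A al) (cX (xdep be)) z
  + \sum_(B < m) partial (F A al) (cP B) z * F B be z
  + \sum_(G < k) \sum_(B < m) partial (F A al) (cP' B G) z *
      (partial (F B be) (cX (xfree G)) z
       + \sum_(C < m) partial (F B be) (cP C) z * z (cP' C G)).

Definition Psi (A : 'I_m) (G L : 'I_k) (al be : 'I_l) (C : 'I_m)
    (z : jcoord -> R) : R :=
  \sum_(B < m) (partial (F A al) (cP' B G) z * partial (F B be) (cP' C L) z
              + partial (F A al) (cP' B L) z * partial (F B be) (cP' C G) z).

Definition compatibility : Prop :=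
  forall z, U z ->
    (forall A al be, Phi A al be z = Phi A be al z) /\
    (forall A C G L al be, Psi A G L al be C z = Psi A G L be al C z).

End Defs.

(* Main.v *)
Require Import Defs.
From HB Require Import structures.
From mathcomp Require Import all_boot all_order all_algebra.
From mathcomp Require Import all_classical all_reals all_analysis.
From mathcomp Require Import ring lra.
Set Implicit Arguments. Unset Strict Implicit. Unset Printing Implicit Defensive.
Import Order.TTheory GRing.Theory Num.Theory.
Import numFieldNormedType.Exports.
Local Open Scope classical_set_scope.
Local Open Scope ring_scope.

(** Necessity.  Let [W_b = d_b u - F_b(x, u, d_free u)] be the residual of an
    approximate solution.  It vanishes to first order at [x0], so expanding
    [d_c d_b u = d_b d_c u] there gives the symmetry of [Phi] plus a quadratic
    form in the second derivatives of the datum; these can be prescribed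
    arbitrarily, which separates [Phi] from [Psi].

    Sufficiency.  Write [E] for the Euler operator in the dependent variables
    [y_b = x_b - x0_b].  A solution satisfies [E u = sum_b y_b F_b(ju)], and with
    the unknowns [g_b = F_b(ju)] this reads [u = a + sum_b L_b g_b], where
    [L_b = E^-1 y_b].  In the l^1 norm on power series with weights
    [rho^|c| eps^(ydeg c) / 'C(|c|, ydeg c)], which are submultiplicative, [L_b]
    and [d_G L_b] have norms at most [rho eps] and [eps], so the map
    [g |-> F(ju)] preserves a ball; its iterates from [0] stabilise degree by
    degree in [y].  The residual of the resulting [u] satisfies
    [sum_b y_b W_b = 0], and by compatibility [d_c W_b - d_b W_c] is linear in
    [W] and [d_free W].  Hence [(E + 1) W_c] is a combination of the [y_b] times
    such linear terms, and induction on the degree in [y] gives [W = 0].  The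
    same induction gives uniqueness. *)

(** * Unconditional summation *)

(** Solving in one dependent variable after another would force the remaining equations to be
    re-checked at each stage. The Euler operator treats all the [y_b] together: it gives one radial
    equation, solved for any [F], and compatibility enters only when the residual is shown to
    vanish. The obstacle is the loss of a derivative. [d_G L_b] preserves the total degree and
    multiplies a coefficient by a quotient of a free exponent by a y-degree, which is unbounded; no
    weight [rho^|c| eps^(ydeg c)] controls it. Dividing by the binomial coefficient does: for
    neighbouring y-degrees [p] and [p + 1] in total degree [n], the ratio [(p + 1) / (n - p)] of
    binomials replaces the y-degree in the denominator by the free degree [n - p], which dominates
    every free exponent. The price is a factor 2 in the radius, since binomials are at most [2^n].
    The invariant ball only bounds the iterates; their convergence is formal, and the bound passes
    to the limit because a finite partial sum sees finitely many y-degrees. In the necessity part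
    the datum is matched only up to a cubic error on the initial plane, so its second derivatives
    are recovered along lines and then polarised. *)

Section Sums.
Variable R : realType.

(** Convergence along the net of finite subsets. One notion then serves multi-indices, pairs of
    multi-indices and reindexed families, and the boxes of [analytic_at] are a cofinal sequence in
    this net. *)
Definition hsum (T : eqType) (f : T -> R) (s : R) : Prop :=
  forall e : R, 0 < e -> exists A : seq T, forall B, uniq B -> {subset A <= B} ->
    `|\sum_(i <- B) f i - s| <= e.

Definition sbounded (T : eqType) (f : T -> R) (M : R) : Prop :=
  forall s, uniq s -> \sum_(i <- s) `|f i| <= M.

Lemma ler_sum_subset (T : eqType) (f : T -> R) (s t : seq T) :
  (forall i, 0 <= f i) -> uniq s -> {subset s <= t} ->
  \sum_(i <- s) f i <= \sum_(i <- t) f i.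
Proof.
move=> f0; elim: s t => [|x s IH] t /=; first by move=> _ _; rewrite big_nil sumr_ge0.
move=> /andP[xs us] st.
have xt : x \in t by apply: st; rewrite mem_head.
rewrite big_cons (perm_big _ (perm_to_rem xt)) big_cons lerD2l; apply: IH => // y ys.
have yx : y != x by apply: contraNneq xs => <-.
have : y \in t by apply: st; rewrite inE ys orbT.
by rewrite (perm_mem (perm_to_rem xt)) inE (negPf yx).
Qed.

Section OneIndex.
Variable T : eqType.
Implicit Types (f g : T -> R).

Lemma sbounded_ge0 f M : sbounded f M -> 0 <= M.
Proof. by move=> /(_ [::] isT); rewrite big_nil. Qed.

Lemma sbounded_le f g M : (forall i, `|g i| <= `|f i|) -> sbounded f M -> sbounded g M.
Proof. by move=> gf fM s us; apply: le_trans (fM s us); apply: ler_sum => i _. Qed.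

Lemma sboundedW f M M' : M <= M' -> sbounded f M -> sbounded f M'.
Proof. by move=> MM fM s us; apply: le_trans (fM s us) MM. Qed.

Lemma sboundedD f g M M' : sbounded f M -> sbounded g M' ->
  sbounded (fun i => f i + g i) (M + M').
Proof.
move=> fM gM s us; apply: le_trans (lerD (fM s us) (gM s us)).
by rewrite -big_split; apply: ler_sum => i _; apply: ler_normD.
Qed.

Lemma sboundedZ c f M : sbounded f M -> sbounded (fun i => c * f i) (`|c| * M).
Proof.
move=> fM s us; under eq_bigr do rewrite normrM.
by rewrite -mulr_sumr ler_wpM2l// fM.
Qed.

Lemma sbounded_single x f : (forall i, i != x -> f i = 0) -> sbounded f `|f x|.
Proof.
move=> f0 s us; case: (boolP (x \in s)) => xs.
  rewrite (bigD1_seq x)//= big1 ?addr0// => i ix.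
  by rewrite f0// normr0.
rewrite big_seq big1// => i si.
by rewrite f0 ?normr0//; apply: contraNneq xs => <-.
Qed.

Lemma hsum_ext f g s : f =1 g -> hsum f s -> hsum g s.
Proof. by move=> /funext ->. Qed.

Lemma hsum_le f s M : hsum f s -> (forall B, uniq B -> \sum_(i <- B) f i <= M) -> s <= M.
Proof.
move=> fs fM; apply/ler_addgt0Pl => e e0.
have [A HA] := fs e e0.
have := HA (undup A) (undup_uniq A) _.
have sA : {subset A <= undup A} by move=> x; rewrite mem_undup.
move=> /(_ sA); have := fM _ (undup_uniq A).
rewrite ler_norml; lra.
Qed.

Lemma hsumZ c f s : hsum f s -> hsum (fun i => c * f i) (c * s).
Proof.
move=> fs e e0; have [A HA] := fs (e / (`|c| + 1)) (divr_gt0 e0 (ltr_wpDl (normr_ge0 c) ltr01)).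
exists A => B uB AB; rewrite -mulr_sumr -mulrBr normrM.
have := HA B uB AB; rewrite ler_pdivlMr ?ltr_wpDl// => H.
apply: le_trans H; rewrite mulrC ler_wpM2l// lerDl; exact: ler01.
Qed.

Lemma hsumD f g s t : hsum f s -> hsum g t -> hsum (fun i => f i + g i) (s + t).
Proof.
move=> fs gt e e0.
have [A HA] := fs (e / 2) (divr_gt0 e0 (ltr0Sn _ _)).
have [A' HA'] := gt (e / 2) (divr_gt0 e0 (ltr0Sn _ _)).
exists (A ++ A') => B uB AB.
have /(HA _ uB) H1 : {subset A <= B} by move=> x xA; apply: AB; rewrite mem_cat xA.
have /(HA' _ uB) H2 : {subset A' <= B} by move=> x xA; apply: AB; rewrite mem_cat xA orbT.
rewrite big_split/= opprD addrACA (le_trans (ler_normD _ _))//; lra.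
Qed.

Lemma hsumN f s : hsum f s -> hsum (fun i => - f i) (- s).
Proof. by move=> /(hsumZ (-1)); rewrite mulN1r; apply: hsum_ext => i; rewrite mulN1r. Qed.

Lemma hsumB f g s t : hsum f s -> hsum g t -> hsum (fun i => f i - g i) (s - t).
Proof. by move=> fs /hsumN; apply: hsumD. Qed.

Lemma hsum_fin f (s : seq T) : uniq s -> (forall i, i \notin s -> f i = 0) ->
  hsum f (\sum_(i <- s) f i).
Proof.
move=> us f0 e e0; exists s => B uB sB.
suff -> : \sum_(i <- B) f i = \sum_(i <- s) f i by rewrite subrr normr0 ltW.
rewrite (bigID (mem s))/= [X in _ + X]big1 ?addr0; last by move=> i /f0.
rewrite -big_filter; apply: perm_big; apply: uniq_perm; rewrite ?filter_uniq//.
by move=> x; rewrite mem_filter; case: (boolP (x \in s)) => //= /sB ->.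
Qed.

Lemma hsum0 : hsum (fun _ : T => 0) 0.
Proof. by have := @hsum_fin (fun _ : T => 0) [::] isT (fun _ _ => erefl); rewrite big_nil. Qed.

Lemma hsum_single x f : (forall i, i != x -> f i = 0) -> hsum f (f x).
Proof.
move=> f0; have -> : f x = \sum_(i <- [:: x]) f i by rewrite big_seq1.
apply: hsum_fin => // i.
by rewrite inE => /f0.
Qed.

Lemma hsum_bigsum (K : Type) (r : seq K) (f : K -> T -> R) (s : K -> R) :
  (forall j, hsum (f j) (s j)) ->
  hsum (fun i => \sum_(j <- r) f j i) (\sum_(j <- r) s j).
Proof.
move=> fs; elim: r => [|j r IH].
  by rewrite big_nil; apply: hsum_ext hsum0 => i; rewrite big_nil.
rewrite big_cons; apply: hsum_ext (hsumD (fs j) IH) => i.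
by rewrite big_cons.
Qed.

Lemma hsum_unique f s t : hsum f s -> hsum f t -> s = t.
Proof.
move=> fs ft; have := hsumB fs ft.
have /funext -> : (fun i => f i - f i) =1 (fun=> 0) by move=> i; rewrite subrr.
move=> H0; apply/eqP; rewrite eq_le -subr_le0; apply/andP; split.
  by apply: hsum_le H0 _ => B _; rewrite big1.
rewrite -subr_le0; have := hsumN H0; rewrite opprB => H1.
by apply: hsum_le H1 _ => B _; rewrite big1// => i _; rewrite oppr0.
Qed.

Lemma hsum_exists_nneg f M : (forall i, 0 <= f i) -> sbounded f M -> exists s, hsum f s.
Proof.
move=> f0 fM; pose E := [set x : R | exists2 s, uniq s & x = \sum_(i <- s) f i].
have EM : ubound E M.
  by move=> _ [s us ->]; apply: le_trans (fM s us); apply: ler_sum => i _; apply: ler_norm.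
have hE : has_sup E.
  by split; [exists 0, [::] => //; rewrite big_nil | exists M].
exists (sup E) => e e0.
have [_ [A uA ->] HA] := sup_adherent e0 hE.
exists A => B uB AB.
have h1 := ler_sum_subset f0 uA AB.
have h2 : \sum_(i <- B) f i <= sup E by apply: ub_le_sup; [exists M|exists B].
rewrite ler_norml; lra.
Qed.

(** Both [|f| + f] and [|f|] are nonnegative with bounded partial sums, and [f] is their
    difference. *)
Lemma hsum_exists f M : sbounded f M -> exists s, hsum f s.
Proof.
move=> fM.
have fM' : sbounded (fun i => `|f i|) M.
  by apply: sbounded_le fM => i; rewrite normr_id.
have [s Hs] := hsum_exists_nneg (fun i => normr_ge0 (f i)) fM'.
have [t Ht] : exists t, hsum (fun i => `|f i| + f i) t.
  apply: (@hsum_exists_nneg _ (M + M)); last exact: sboundedD.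
  by move=> i; rewrite -lerBlDr sub0r lerNl; case: (ler0P (f i)); lra.
by exists (t - s); apply: hsum_ext (hsumB Ht Hs) => i; rewrite addrC addKr.
Qed.

Lemma hsum_norm_le f s M : sbounded f M -> hsum f s -> `|s| <= M.
Proof.
move=> fM fs; have fin (B : seq T) : uniq B -> `|\sum_(i <- B) f i| <= M.
  by move=> uB; apply: le_trans (fM B uB); apply: ler_norm_sum.
rewrite ler_norml lerNl; apply/andP; split; last first.
  by apply: hsum_le fs _ => B /fin; apply: le_trans; apply: ler_norm.
apply: (hsum_le (hsumN fs)) => B /fin; apply: le_trans; rewrite sumrN.
by rewrite -normrN; apply: ler_norm.
Qed.

End OneIndex.

Lemma sum_allpairs (T1 T2 : eqType) (f : T1 * T2 -> R) s1 s2 :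
  \sum_(p <- [seq (i, j) | i <- s1, j <- s2]) f p =
  \sum_(i <- s1) \sum_(j <- s2) f (i, j).
Proof. exact: big_allpairs_dep. Qed.

Lemma sbounded_pair (T1 T2 : eqType) (f : T1 * T2 -> R) (M : R) :
  (forall s1 s2, uniq s1 -> uniq s2 ->
     \sum_(i <- s1) \sum_(j <- s2) `|f (i, j)| <= M) -> sbounded f M.
Proof.
move=> fM s us.
have u1 := undup_uniq (map fst s); have u2 := undup_uniq (map snd s).
apply: le_trans (fM _ _ u1 u2).
rewrite -(sum_allpairs (fun p => `|f p|)).
apply: ler_sum_subset => // -[i j] ij.
by apply/allpairsP; exists (i, j); rewrite !mem_undup; split=> //; apply: map_f ij.
Qed.

(** [phi] embeds [T'] as the part [P] of [T], with inverse [psi] there. Extension by zero turns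
    shifts of multi-indices, which are invertible only on their image, into plain reindexing. *)
Lemma hsum_sub (T T' : eqType) (P : pred T) (phi : T' -> T) (psi : T -> T')
    (f : T' -> R) s :
  (forall y, P (phi y)) -> cancel phi psi -> (forall x, P x -> phi (psi x) = x) ->
  hsum f s -> hsum (fun x => if P x then f (psi x) else 0) s.
Proof.
move=> Pphi phiK psiK fs e e0; have [A HA] := fs e e0.
exists (map phi A) => B uB AB.
rewrite -big_mkcond -big_filter -(big_map psi xpredT f).
apply: HA.
  rewrite map_inj_in_uniq ?filter_uniq// => x y.
  rewrite !mem_filter => /andP[Px _] /andP[Py _] xy.
  by rewrite -(psiK x)// xy psiK.
move=> y yA; apply/mapP; exists (phi y); last by rewrite phiK.
by rewrite mem_filter Pphi AB// map_f.
Qed.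

Lemma sbounded_sub (T T' : eqType) (P : pred T) (phi : T' -> T) (psi : T -> T')
    (f : T' -> R) M :
  (forall x, P x -> phi (psi x) = x) ->
  sbounded f M -> sbounded (fun x => if P x then f (psi x) else 0) M.
Proof.
move=> psiK fM B uB.
have -> : \sum_(i <- B) `|if P i then f (psi i) else 0| =
    \sum_(i <- B) (if P i then `|f (psi i)| else 0).
  by apply: eq_bigr => i _; case: ifP; rewrite ?normr0.
rewrite -big_mkcond -big_filter -(big_map psi xpredT (fun x => `|f x|)).
apply: fM; rewrite map_inj_in_uniq ?filter_uniq// => x y.
rewrite !mem_filter => /andP[Px _] /andP[Py _] xy.
by rewrite -(psiK x)// xy psiK.
Qed.

Lemma hsum_fubini (T1 T2 : eqType) (f : T1 * T2 -> R) (g : T1 -> R) s :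
  hsum f s -> (forall i, hsum (fun j => f (i, j)) (g i)) -> hsum g s.
Proof.
move=> fs fg e e0; have [A HA] := fs (e / 2) (divr_gt0 e0 (ltr0Sn _ _)).
exists (map fst A) => B uB AB.
have n0 : 0 < ((size B).+1%:R : R) by rewrite ltr0Sn.
(* Half of the error is shared equally by the rows in [B]; the other half pays for replacing the
   double sum over a large rectangle by [s]. *)
pose e' := e / 2 / (size B).+1%:R.
have e'0 : 0 < e' by rewrite !divr_gt0.
have /boolp.choice [A_ HA_] := fun i => fg i e' e'0.
pose B2 := undup (map snd A ++ flatten (map A_ B)).
have u2 : uniq B2 := undup_uniq _.
have := HA [seq (i, j) | i <- B, j <- B2]; rewrite sum_allpairs => H1.
have uP : uniq [seq (i, j) | i <- B, j <- B2] by apply: allpairs_uniq => // -[? ?] [? ?].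
move: H1 => /(_ uP) H1.
have {H1} : `|\sum_(i <- B) \sum_(j <- B2) f (i, j) - s| <= e / 2.
  apply: H1 => -[i j] ij; apply/allpairsP; exists (i, j); split=> //=.
    by apply: AB; apply: map_f ij.
  by rewrite mem_undup mem_cat (map_f snd ij).
have H2 : `|\sum_(i <- B) (\sum_(j <- B2) f (i, j) - g i)| <= e / 2.
  apply: le_trans (ler_norm_sum _ _ _) _.
  apply: (@le_trans _ _ (\sum_(i <- B) e')).
    rewrite big_seq [leRHS]big_seq; apply: ler_sum => i iB.
    apply: HA_ => // j jA; rewrite mem_undup mem_cat; apply/orP; right.
    by apply/flattenP; exists (A_ i) => //; apply: map_f.
  rewrite big_const_seq count_predT iter_addr_0 -[e' *+ _]mulr_natr /e' -[leLHS]mulrA -[leRHS]mulr1.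
  by rewrite ler_pM2l ?divr_gt0// ler_pdivrMl// mulr1 ler_nat.
move: H2; rewrite sumrB => H2 H1.
have -> : \sum_(i <- B) g i - s = (\sum_(i <- B) \sum_(j <- B2) f (i, j) - s) -
  (\sum_(i <- B) \sum_(j <- B2) f (i, j) - \sum_(i <- B) g i) by ring.
by apply: le_trans (ler_normB _ _) _; rewrite (splitr e) lerD.
Qed.

Lemma hsum_swap (T1 T2 : eqType) (f : T1 * T2 -> R) s :
  hsum f s -> hsum (fun p => f (p.2, p.1)) s.
Proof.
move=> fs.
have := @hsum_sub _ _ xpredT (fun p : T1 * T2 => (p.2, p.1)) (fun p : T2 * T1 => (p.2, p.1)) f s.
by apply=> // -[].
Qed.

Lemma hsum_exchange (T1 T2 : eqType) (f : T1 * T2 -> R) M g h s :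
  sbounded f M -> (forall i, hsum (fun j => f (i, j)) (g i)) ->
  (forall j, hsum (fun i => f (i, j)) (h j)) -> hsum g s -> hsum h s.
Proof.
move=> fM fg fh gs; have [t ft] := hsum_exists fM.
by rewrite (hsum_unique gs (hsum_fubini ft fg)); apply: hsum_fubini (hsum_swap ft) fh.
Qed.

End Sums.

(** * Power series in several variables *)

Notation multi I := {ffun I -> nat}.

Section MultiIndex.
Variable I : finType.
Implicit Types a b c : multi I.

Definition m0 : multi I := [ffun=> 0%N].
Definition madd a b : multi I := [ffun i => (a i + b i)%N].
Definition msub a b : multi I := [ffun i => (a i - b i)%N].
Definition me (j : I) : multi I := [ffun i => nat_of_bool (i == j)].
Definition mle a b := [forall i, a i <= b i]%N.
Definition mdeg a : nat := (\sum_i a i)%N.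

Lemma maddC a b : madd a b = madd b a.
Proof. by apply/ffunP => i; rewrite !ffunE addnC. Qed.

Lemma maddK a b : msub (madd a b) a = b.
Proof. by apply/ffunP => i; rewrite !ffunE addKn. Qed.

Lemma maddKr a b : msub (madd b a) a = b.
Proof. by rewrite maddC maddK. Qed.

Lemma msubK a b : mle a b -> madd a (msub b a) = b.
Proof. by move=> /forallP ab; apply/ffunP => i; rewrite !ffunE subnKC. Qed.

Lemma mle_add a b : mle a (madd a b).
Proof. by apply/forallP => i; rewrite !ffunE leq_addr. Qed.

Lemma mle_sub a b : mle (msub a b) a.
Proof. by apply/forallP => i; rewrite !ffunE leq_subr. Qed.

Lemma mle_me j a : mle (me j) a = (0 < a j)%N.
Proof.
apply/forallP/idP => [/(_ j)|aj i]; rewrite ffunE; first by rewrite eqxx.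
by case: eqP => // ->.
Qed.

Lemma mdegD a b : mdeg (madd a b) = (mdeg a + mdeg b)%N.
Proof. by rewrite /mdeg -big_split; apply: eq_bigr => i _; rewrite ffunE. Qed.

Lemma mdeg0 : mdeg m0 = 0%N.
Proof. by rewrite /mdeg big1// => i _; rewrite ffunE. Qed.

Lemma mdeg_me j : mdeg (me j) = 1%N.
Proof.
rewrite /mdeg (bigD1 j)//= ffunE eqxx big1// => i ij.
by rewrite ffunE (negPf ij).
Qed.

Lemma mdeg_eq0 a : (mdeg a == 0%N) = (a == m0).
Proof.
rewrite sum_nat_eq0; apply/forallP/eqP => [H|-> i]; last by rewrite ffunE.
by apply/ffunP => i; rewrite ffunE; apply/eqP; apply: H.
Qed.

Lemma leq_mdeg a i : (a i <= mdeg a)%N.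
Proof. by rewrite /mdeg (bigD1 i)//= leq_addr. Qed.

Lemma multi_ind (P : multi I -> Prop) :
  P m0 -> (forall j a, P a -> P (madd a (me j))) -> forall a, P a.
Proof.
move=> P0 PS a; move: {2}(mdeg a) (erefl (mdeg a)) => n; elim: n a => [|n IH] a an.
  by move/eqP: an; rewrite mdeg_eq0 => /eqP ->.
have [j aj] : exists j, (0 < a j)%N.
  apply/existsP; apply: contraT; rewrite negb_exists => /forallP H.
  by move: an; rewrite /mdeg big1// => i _; apply/eqP; rewrite eqn0Ngt.
have ma : mle (me j) a by rewrite mle_me.
rewrite -(msubK ma) maddC; apply: PS; apply: IH.
by have := congr1 mdeg (msubK ma); rewrite mdegD mdeg_me an => -[].
Qed.

Definition boxseq (D : nat) : seq (multi I) :=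
  [seq [ffun i => nat_of_ord (b i)] | b : {ffun I -> 'I_D}].

Lemma uniq_boxseq D : uniq (boxseq D).
Proof.
rewrite map_inj_uniq ?enum_uniq// => x y /ffunP xy; apply/ffunP => i.
by apply/val_inj; have := xy i; rewrite !ffunE.
Qed.

Lemma mem_boxseq D a : (a \in boxseq D) = [forall i, a i < D]%N.
Proof.
apply/mapP/forallP => [[b _ -> i]|aD]; first by rewrite ffunE.
exists [ffun i => Ordinal (aD i)]; first by rewrite mem_enum.
by apply/ffunP => i; rewrite !ffunE.
Qed.

Definition below a : seq (multi I) := [seq b <- boxseq (mdeg a).+1 | mle b a].

Lemma uniq_below a : uniq (below a).
Proof. by rewrite filter_uniq// uniq_boxseq. Qed.

Lemma mem_below a b : (b \in below a) = mle b a.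
Proof.
rewrite mem_filter mem_boxseq andb_idr// => /forallP ba; apply/forallP => i.
by rewrite ltnS (leq_trans (ba i))// leq_mdeg.
Qed.

Lemma boxseq_subset (s : seq (multi I)) : exists D0, forall D, (D0 <= D)%N ->
  {subset s <= boxseq D}.
Proof.
exists (\max_(a <- s) mdeg a).+1 => D HD a sa; rewrite mem_boxseq; apply/forallP => i.
apply: leq_trans HD; rewrite ltnS (leq_trans (leq_mdeg a i))//.
exact: (@leq_bigmax_seq _ _ xpredT mdeg).
Qed.

Variable R : realType.
Implicit Types (f g h : multi I -> R) (z : I -> R) (r M N : R).

Definition mon z a : R := \prod_i z i ^+ a i.

Lemma monD z a b : mon z (madd a b) = mon z a * mon z b.
Proof. by rewrite /mon -big_split; apply: eq_bigr => i _; rewrite ffunE exprD. Qed.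

Lemma mon0 z : mon z m0 = 1.
Proof. by rewrite /mon big1// => i _; rewrite ffunE expr0. Qed.

Lemma mon_me z j : mon z (me j) = z j.
Proof.
rewrite /mon (bigD1 j)//= ffunE eqxx expr1 big1 ?mulr1// => i ij.
by rewrite ffunE (negPf ij) expr0.
Qed.

Lemma mon_le z r a : (forall i, `|z i| <= r) -> `|mon z a| <= r ^+ mdeg a.
Proof.
move=> zr; rewrite /mon /mdeg -prodrXr normr_prod.
apply: ler_prod => i _; rewrite normr_ge0/= normrX.
by rewrite lerXn2r// nnegrE (le_trans _ (zr i)).
Qed.

Lemma boxsumE D f : \sum_(b : {ffun I -> 'I_D}) f [ffun i => nat_of_ord (b i)] =
  \sum_(a <- boxseq D) f a.
Proof. by rewrite /boxseq big_image. Qed.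

Lemma hsum_boxsum f s : hsum f s ->
  (fun D => \sum_(b : {ffun I -> 'I_D}) f [ffun i => nat_of_ord (b i)]) @ \oo --> s.
Proof.
move=> fs; apply/cvgrPdist_le => e e0.
have [A HA] := fs e e0; have [D0 HD] := boxseq_subset A.
near=> D; rewrite distrC boxsumE; apply: HA; first exact: uniq_boxseq.
by apply: HD; near: D; exists D0.
Unshelve. all: by end_near. Qed.

Lemma sbounded_boxsum f M :
  (forall D, \sum_(b : {ffun I -> 'I_D}) `|f [ffun i => nat_of_ord (b i)]| <= M) <->
  sbounded f M.
Proof.
split=> H; last first.
  by move=> D; rewrite (boxsumE D (fun a => `|f a|)); apply: H; apply: uniq_boxseq.
move=> s us; have [D HD] := boxseq_subset s; apply: le_trans (H D).
rewrite (boxsumE D (fun a => `|f a|)); apply: ler_sum_subset => //; exact: HD.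
Qed.

Definition fmul f g : multi I -> R :=
  fun a => \sum_(b <- below a) f b * g (msub a b).

(** The double family behind the Cauchy product: summed over the larger index [p.2] it gives
    multiples of the sum of [g], summed over [p.1] it gives the coefficients of [fmul f g]. *)
Lemma fmul_sbounded_pair f g M N : sbounded f M -> sbounded g N ->
  sbounded (fun p : multi I * multi I =>
    if mle p.1 p.2 then f p.1 * g (msub p.2 p.1) else 0) (M * N).
Proof.
move=> fM gN; apply: sbounded_pair => s1 s2 u1 u2 /=.
have N0 := sbounded_ge0 gN.
apply: le_trans (ler_wpM2r N0 (fM _ u1)).
rewrite mulr_suml; apply: ler_sum => b _.
have H : sbounded (fun a => if mle b a then g (msub a b) else 0) N.
  by apply: (sbounded_sub (phi := madd b)) gN => x /msubK.
apply: le_trans (ler_wpM2l (normr_ge0 (f b)) (H s2 u2)).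
rewrite mulr_sumr; apply: ler_sum => a _.
by case: ifP; rewrite -normrM ?mulr0.
Qed.

Lemma below_hsum a (f : multi I -> R) :
  hsum (fun b => if mle b a then f b else 0) (\sum_(b <- below a) f b).
Proof.
have -> : \sum_(b <- below a) f b = \sum_(b <- below a) (if mle b a then f b else 0).
  by rewrite big_seq [RHS]big_seq; apply: eq_bigr => b; rewrite mem_below => ->.
by apply: hsum_fin (uniq_below a) _ => b; rewrite mem_below => /negPf ->.
Qed.

Lemma hsum_fmul f g M N s t : sbounded f M -> sbounded g N ->
  hsum f s -> hsum g t -> hsum (fmul f g) (s * t).
Proof.
move=> fM gN fs gt.
apply: (hsum_exchange (fmul_sbounded_pair fM gN) (g := fun b => f b * t)) => /=.
- move=> b.
  have H : hsum (fun a => if mle b a then f b * g (msub a b) else 0) (f b * t).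
    apply: (hsum_sub (phi := madd b) (f := fun c => f b * g c)) => //.
    + exact: mle_add.
    + exact: maddK.
    + exact: msubK.
    + exact: hsumZ.
  exact: H.
- by move=> a; apply: below_hsum.
- by rewrite mulrC; apply: hsum_ext (hsumZ t fs) => b; rewrite mulrC.
Qed.

Lemma sbounded_fmul f g M N : sbounded f M -> sbounded g N -> sbounded (fmul f g) (M * N).
Proof.
move=> fM gN s us.
have f1 : sbounded (fun a => `|f a|) M by apply: sbounded_le fM => i; rewrite normr_id.
have g1 : sbounded (fun a => `|g a|) N by apply: sbounded_le gN => i; rewrite normr_id.
have H := fmul_sbounded_pair f1 g1.
pose S := undup (flatten [seq below a | a <- s]).
have uP : uniq [seq (i, j) | i <- S, j <- s].
  by apply: allpairs_uniq => //; [exact: undup_uniq|move=> [? ?] [? ?]].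
apply: le_trans (H _ uP).
rewrite (sum_allpairs (fun p => `|if mle p.1 p.2 then `|f p.1| * `|g (msub p.2 p.1)| else 0|))/=.
rewrite exchange_big/= big_seq [leRHS]big_seq; apply: ler_sum => a sa.
apply: le_trans (ler_norm_sum _ _ _) _.
apply: (@le_trans _ _ (\sum_(b <- below a) `|if mle b a then `|f b| * `|g (msub a b)| else 0|)).
  rewrite big_seq [leRHS]big_seq; apply: ler_sum => b; rewrite mem_below => ->.
  by rewrite !normrM !normr_id.
apply: ler_sum_subset => //; first exact: uniq_below.
move=> b ba; rewrite mem_undup; apply/flattenP; exists (below a) => //.
exact: map_f.
Qed.

Lemma fmul_mon f g z : fmul (fun a => f a * mon z a) (fun a => g a * mon z a) =
  fun a => fmul f g a * mon z a.
Proof.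
apply/funext => a; rewrite /fmul mulr_suml big_seq [RHS]big_seq.
apply: eq_bigr => b; rewrite mem_below => /msubK ba.
by rewrite -[in RHS]ba monD ba; ring.
Qed.

Definition fcst (x : R) : multi I -> R := fun a => if a == m0 then x else 0.
Definition fX (j : I) : multi I -> R := fun a => if a == me j then 1 else 0.
Definition fpow f n := iter n (fmul f) (fcst 1).

Section Local.
Variable P : pred (multi I).
Hypothesis Pdown : forall a b, P a -> mle b a -> P b.

(** A coefficient of a product involves only coefficients at divisors of its index, so one may
    compute modulo the monomials outside a divisor-closed set [P]. Such a [P] will be a bound on the
    degree in the dependent variables. *)
Lemma fmul_local f f' g g' : {in P, f =1 f'} -> {in P, g =1 g'} ->
  {in P, fmul f g =1 fmul f' g'}.
Proof.
move=> ff gg a Pa; rewrite /fmul big_seq [RHS]big_seq.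
apply: eq_bigr => b; rewrite mem_below => ba.
by rewrite ff ?gg//; apply: Pdown Pa _ => //; apply: mle_sub.
Qed.

Lemma fpow_local f f' n : {in P, f =1 f'} -> {in P, fpow f n =1 fpow f' n}.
Proof. by move=> ff; elim: n => //= n IH; apply: fmul_local. Qed.
End Local.

(** Submultiplicativity makes the weighted l^1 norm an algebra norm; [nbd w f M] says that this norm
    of [f] is at most [M]. *)
Record weight (w : multi I -> R) : Prop := Weight {
  weight_gt0 : forall a, 0 < w a;
  weight1 : w m0 = 1;
  weightD : forall a b, w (madd a b) <= w a * w b }.

Definition nbd (w : multi I -> R) f M := sbounded (fun a => f a * w a) M.

Section Weighted.
Variable w : multi I -> R.
Hypothesis wP : weight w.

Lemma nbd_fmul f g M N : nbd w f M -> nbd w g N -> nbd w (fmul f g) (M * N).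
Proof.
move=> fM gN.
have f1 : sbounded (fun a => `|f a| * w a) M.
  by apply: sbounded_le fM => i; rewrite !normrM normr_id.
have g1 : sbounded (fun a => `|g a| * w a) N.
  by apply: sbounded_le gN => i; rewrite !normrM normr_id.
apply: sbounded_le (sbounded_fmul f1 g1) => a.
apply: le_trans (ler_norm _).
rewrite normrM (gtr0_norm (weight_gt0 wP a)) /fmul.
apply: le_trans (ler_wpM2r (ltW (weight_gt0 wP a)) (ler_norm_sum _ _ _)) _.
rewrite mulr_suml big_seq [leRHS]big_seq; apply: ler_sum => b; rewrite mem_below => ba.
rewrite normrM mulrACA ler_wpM2l ?mulr_ge0// -{1}(msubK ba).
exact: weightD.
Qed.

Lemma nbd_fcst x : nbd w (fcst x) `|x|.
Proof.
have := @sbounded_single _ _ m0 (fun a => fcst x a * w a).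
rewrite /fcst eqxx (weight1 wP) mulr1; apply=> i /negPf ->.
by rewrite mul0r.
Qed.

Lemma nbd_fX j : nbd w (fX j) (w (me j)).
Proof.
have := @sbounded_single _ _ (me j) (fun a => fX j a * w a).
rewrite /fX eqxx mul1r (gtr0_norm (weight_gt0 wP _)); apply=> i /negPf ->.
by rewrite mul0r.
Qed.

Lemma nbd_fpow f M n : nbd w f M -> nbd w (fpow f n) (M ^+ n).
Proof.
move=> fM; elim: n => [|n IH]; last by rewrite exprS; apply: nbd_fmul.
by have := nbd_fcst 1; rewrite normr1.
Qed.

Lemma nbd_coef f M a : nbd w f M -> `|f a| <= M / w a.
Proof.
move=> /(_ [:: a] isT); rewrite big_seq1 normrM (gtr0_norm (weight_gt0 wP a)).
by rewrite ler_pdivlMr ?(weight_gt0 wP a).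
Qed.

Lemma nbdD f g M N : nbd w f M -> nbd w g N -> nbd w (fun a => f a + g a) (M + N).
Proof. by move=> fM gN; apply: sbounded_le (sboundedD fM gN) => a; rewrite mulrDl. Qed.

Lemma nbdW f M N : M <= N -> nbd w f M -> nbd w f N.
Proof. exact: sboundedW. Qed.

Lemma nbd_sum (K : finType) (f : K -> multi I -> R) M :
  (forall j, nbd w (f j) M) -> nbd w (fun a => \sum_j f j a) (#|K|%:R * M).
Proof.
move=> fM s us; apply: (@le_trans _ _ (\sum_(a <- s) \sum_j `|f j a * w a|)).
  by apply: ler_sum => a _; rewrite mulr_suml; apply: ler_norm_sum.
rewrite exchange_big/=; apply: (@le_trans _ _ (\sum_(j : K) M)).
  by apply: ler_sum => j _; apply: fM.
by rewrite sumr_const mulr_natl.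
Qed.

End Weighted.

Definition pw (r : R) : multi I -> R := fun a => r ^+ mdeg a.

Lemma weight_pw r : 0 < r -> weight (pw r).
Proof.
move=> r0; split=> [a||a b]; rewrite /pw ?exprn_gt0// ?mdeg0 ?expr0//.
by rewrite mdegD exprD.
Qed.

Lemma nbd_mon f r M z : nbd (pw r) f M -> (forall i, `|z i| <= r) ->
  sbounded (fun a => f a * mon z a) M.
Proof.
move=> fM zr; apply: sbounded_le fM => a; rewrite !normrM ler_wpM2l//.
by apply: le_trans (ler_norm _); apply: mon_le.
Qed.

End MultiIndex.

(** * Composition of power series: coefficients and norms *)

Section Composition.
Variables (R : realType) (I J : finType).
Implicit Types (C : multi J -> R) (h : J -> multi I -> R) (r q M N : R).

Definition mpow h (c : multi J) : multi I -> R :=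
  \big[@fmul I R/fcst 1]_j fpow (h j) (c j).

Definition hsum_val (T : eqType) (f : T -> R) : R := xget 0 [set s | hsum f s].

Lemma hsum_valP (T : eqType) (f : T -> R) M : sbounded f M -> hsum f (hsum_val f).
Proof. by move=> /hsum_exists[s fs]; rewrite /hsum_val; case: xgetP => [_ -> //|/(_ s)]. Qed.

(** A coefficient is an infinite sum over the outer multi-indices, because the inner series may have
    constant terms, as happens in recentring. [hsum_val] returns 0 on a family without a sum. *)
Definition fcomp C h : multi I -> R :=
  fun a => hsum_val (fun c => C c * mpow h c a).

Lemma mpow_local (P : pred (multi I)) h h' c :
  (forall a b, P a -> mle b a -> P b) ->
  (forall j, {in P, h j =1 h' j}) -> {in P, mpow h c =1 mpow h' c}.
Proof.
move=> Pd hh; rewrite /mpow; elim/big_rec2: _ => // j x y _ xy.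
by apply: fmul_local => //; apply: fpow_local.
Qed.

Lemma fcomp_local (P : pred (multi I)) C h h' :
  (forall a b, P a -> mle b a -> P b) ->
  (forall j, {in P, h j =1 h' j}) -> {in P, fcomp C h =1 fcomp C h'}.
Proof.
move=> Pd hh a Pa; rewrite /fcomp; congr hsum_val; apply/funext => c.
by rewrite (mpow_local c Pd hh).
Qed.

Variable w : multi I -> R.
Hypothesis wP : weight w.

Lemma nbd_mpow h r c : (forall j, nbd w (h j) r) -> nbd w (mpow h c) (r ^+ mdeg c).
Proof.
move=> hr; rewrite /mpow /mdeg -prodrXr.
elim/big_rec2: _; first by have := nbd_fcst wP 1; rewrite normr1.
by move=> j y x _ xy; apply: nbd_fmul => //; apply: nbd_fpow.
Qed.

(** [x] ranges over the dual ball of the weighted l^1 space. A test sequence supported at one index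
    yields summability of a single coefficient; [w] times the signs of the coefficients yields the
    norm of the composition. *)
Lemma sbounded_fcomp C h r M x (s : seq (multi I)) : nbd (pw r) C M ->
  (forall j, nbd w (h j) r) -> uniq s -> (forall a, `|x a| <= w a) ->
  sbounded (fun c => \sum_(a <- s) C c * mpow h c a * x a) M.
Proof.
move=> CM hr us xw; apply: sbounded_le CM => c.
under eq_bigr do rewrite -mulrA.
rewrite -mulr_sumr !normrM ler_wpM2l//.
apply: le_trans (ler_norm_sum _ _ _) _; apply: le_trans (ler_norm _).
apply: le_trans (nbd_mpow c hr us).
by apply: ler_sum => a _; rewrite !normrM ler_wpM2l// (le_trans (xw a))// ler_norm.
Qed.

Lemma hsum_fcomp C h r M a : nbd (pw r) C M -> (forall j, nbd w (h j) r) ->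
  hsum (fun c => C c * mpow h c a) (fcomp C h a).
Proof.
move=> CM hr.
have xw b : `|(if b == a then w a else 0)| <= w b.
  by case: eqP => [->|_]; rewrite ?normr0 ?ger0_norm// ltW// (weight_gt0 wP).
have := @sbounded_fcomp C h r M _ [:: a] CM hr isT xw.
move=> /(sboundedZ (w a)^-1) H; apply: hsum_valP.
apply: sbounded_le H => c; rewrite big_seq1 eqxx [X in _ <= `|X|]mulrC mulfK//.
by rewrite gt_eqF// (weight_gt0 wP).
Qed.

Lemma nbd_fcomp C h r M : nbd (pw r) C M -> (forall j, nbd w (h j) r) ->
  nbd w (fcomp C h) M.
Proof.
move=> CM hr s us.
pose x a := Num.sg (fcomp C h a) * w a.
have xw a : `|x a| <= w a.
  rewrite /x normrM (gtr0_norm (weight_gt0 wP a)) -[leRHS]mul1r.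
  apply: ler_wpM2r; first exact/ltW/(weight_gt0 wP).
  by rewrite normr_sg lern1 leq_b1.
have bd := sbounded_fcomp CM hr us xw.
have hs : hsum (fun c => \sum_(a <- s) C c * mpow h c a * x a)
               (\sum_(a <- s) fcomp C h a * x a).
  apply: hsum_bigsum => a; rewrite mulrC.
  by apply: hsum_ext (hsumZ (x a) (hsum_fcomp a CM hr)) => c; rewrite mulrC.
apply: le_trans (le_trans (ler_norm _) (hsum_norm_le bd hs)).
apply: ler_sum => a _.
by rewrite normrM (gtr0_norm (weight_gt0 wP a)) normrEsg /x [leRHS]mulrCA mulrA.
Qed.

End Composition.

(** * Composition of power series: values *)

Section CompositionValue.
Variables (R : realType) (I J : finType).
Implicit Types (C : multi J -> R) (h : J -> multi I -> R) (r q M N : R).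

Lemma hsum_fcst (x : R) z : hsum (fun a => @fcst I R x a * mon z a) x.
Proof.
have := @hsum_single _ _ (m0 I) (fun a => @fcst I R x a * mon z a).
rewrite /fcst eqxx mon0 mulr1; apply=> i /negPf ->.
by rewrite mul0r.
Qed.

Lemma hsum_fX j (z : I -> R) : hsum (fun a => @fX I R j a * mon z a) (z j).
Proof.
have := @hsum_single _ _ (me j) (fun a => @fX I R j a * mon z a).
rewrite /fX eqxx mon_me mul1r; apply=> i /negPf ->.
by rewrite mul0r.
Qed.

Lemma hsum_fmul_mon (f g : multi I -> R) r M N z s t : (forall i, `|z i| <= r) ->
  nbd (pw r) f M -> nbd (pw r) g N ->
  hsum (fun a => f a * mon z a) s -> hsum (fun a => g a * mon z a) t ->
  hsum (fun a => fmul f g a * mon z a) (s * t).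
Proof.
move=> zr fM gN fs gt; rewrite -fmul_mon.
exact: hsum_fmul (nbd_mon fM zr) (nbd_mon gN zr) fs gt.
Qed.

Lemma hsum_mpow h r q z (v : J -> R) c : 0 < r -> (forall i, `|z i| <= r) ->
  (forall j, nbd (pw r) (h j) q) ->
  (forall j, hsum (fun a => h j a * mon z a) (v j)) ->
  hsum (fun a => mpow h c a * mon z a) (mon v c).
Proof.
move=> r0 zr hq hv; have wr := weight_pw I r0; rewrite /mpow /mon.
pose K (f : multi I -> R) x := hsum (fun a => f a * mon z a) x /\ exists N, nbd (pw r) f N.
suff [] : K (\big[@fmul I R/fcst 1]_j fpow (h j) (c j)) (\prod_j v j ^+ c j) by [].
have K1 : K (@fcst I R 1) 1.
  by split; [exact: hsum_fcst|exists `|1|; apply: nbd_fcst].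
have KM f g x y : K f x -> K g y -> K (fmul f g) (x * y).
  move=> [fx [N fN]] [gy [N' gN]]; split; last by exists (N * N'); apply: nbd_fmul.
  exact: hsum_fmul_mon zr fN gN _ _.
elim/big_rec2: _ => // j x y _ xy; apply: (KM) => //.
elim: (c j) => [|n IH]; first by rewrite expr0.
by rewrite exprS; apply: (KM) => //; split; [exact: hv|exists q].
Qed.

(** Substitution is an exchange of summations in the family [C_c (h^c)_a z^a], absolutely summable
    because [h^c] has norm at most [q^|c|] at radius [r]. *)
Lemma hsum_fcomp_mon C h r q M z v s : 0 < r -> (forall i, `|z i| <= r) ->
  nbd (pw q) C M -> (forall j, nbd (pw r) (h j) q) ->
  (forall j, hsum (fun a => h j a * mon z a) (v j)) ->
  hsum (fun c => C c * mon v c) s ->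
  hsum (fun a => fcomp C h a * mon z a) s.
Proof.
move=> r0 zr CM hq hv Cs; have wr := weight_pw I r0.
pose f p := C p.1 * (mpow h p.1 p.2 * mon z p.2).
have fM : sbounded f M.
  apply: sbounded_pair => s1 s2 u1 u2; apply: le_trans (CM _ u1).
  apply: ler_sum => c _ /=; rewrite /f/=; under eq_bigr do rewrite normrM.
  rewrite -mulr_sumr normrM ler_wpM2l//; apply: le_trans (ler_norm _).
  exact: nbd_mon (nbd_mpow wr c hq) zr _ u2.
apply: (hsum_exchange fM) Cs => [c|a].
  by have := hsumZ (C c) (hsum_mpow c r0 zr hq hv).
rewrite mulrC; apply: hsum_ext (hsumZ _ (hsum_fcomp wr a CM hq)) => c.
by rewrite /f/=; ring.
Qed.

End CompositionValue.

(** * First-order expansions *)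

Section FirstOrder.
Variables (R : realType) (I : finType).
Implicit Types (f g : (I -> R) -> R) (a z : I -> R) (d : I -> R).

Definition dist1 (z a : I -> R) : R := \sum_i `|z i - a i|.

(* First-order expansion with quadratic remainder; the constant K bounds both
   the remainder and the inverse of the radius of validity. *)
Definition quad f a d : Prop := exists2 K : R, 0 < K &
  forall z, K * dist1 z a <= 1 ->
    `|f z - f a - \sum_j d j * (z j - a j)| <= K * dist1 z a ^+ 2.

Definition upd a (j : I) (t : R) : I -> R := fun i => if i == j then t else a i.

Lemma dist1_ge0 z a : 0 <= dist1 z a.
Proof. exact: sumr_ge0. Qed.

Lemma le_dist1 z a i : `|z i - a i| <= dist1 z a.
Proof. by rewrite /dist1 (bigD1 i)//= lerDl sumr_ge0. Qed.

Lemma dist1_upd a j t : dist1 (upd a j (a j + t)) a = `|t|.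
Proof.
rewrite /dist1 (bigD1 j)//= big1 ?addr0; last first.
  by move=> i /negPf ij; rewrite /upd ij subrr normr0.
by rewrite /upd eqxx addrC addKr.
Qed.

Lemma partial_eq f j a (d : R) :
  (exists2 K : R, 0 < K & forall t, K * `|t| <= 1 ->
     `|f (upd a j (a j + t)) - f a - d * t| <= K * `|t| ^+ 2) ->
  partial f j a = d.
Proof.
move=> [K K0 HK]; rewrite /partial /derive1; apply/cvg_lim => //.
apply/cvgrPdist_le => e e0; near=> h.
have h0 : h != 0 by near: h; exact: nbhs_dnbhs_neq.
have hK : K * `|h| <= 1.
  rewrite -ler_pdivlMl// mulr1 ltW//; near: h; apply: dnbhs0_lt.
  by rewrite invr_gt0.
have he : K * `|h| <= e.
  rewrite -ler_pdivlMl// ltW//; near: h; apply: dnbhs0_lt.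
  by rewrite mulr_gt0 ?invr_gt0.
have -> : (fun i => if i == j then a j else a i) = a.
  by apply/funext => i; case: eqP => [->|].
have := HK h hK; rewrite /upd (addrC (a j)) => H.
set X := f _ - f a in H *.
have -> : d - h^-1 *: X = - ((X - d * h) / h) by rewrite /GRing.scale/=; field.
rewrite normrN normrM normfV ler_pdivrMr ?normr_gt0//.
by apply: le_trans H _; rewrite expr2 mulrA ler_wpM2r.
Unshelve. all: by end_near. Qed.

Lemma quad_partial f a d j : quad f a d -> partial f j a = d j.
Proof.
move=> [K K0 HK]; apply: partial_eq; exists K => // t Kt.
have := HK (upd a j (a j + t)); rewrite dist1_upd => /(_ Kt).
rewrite (bigD1 j)//= big1 ?addr0; last first.
  by move=> i /negPf ij; rewrite /upd ij subrr mulr0.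
by rewrite /upd eqxx (addrC (a j) t) addrK.
Qed.

Lemma quad_lip f a d : quad f a d -> exists2 K : R, 0 < K &
  forall z, K * dist1 z a <= 1 -> `|f z - f a| <= K * dist1 z a.
Proof.
move=> [K K0 HK]; pose D := \sum_j `|d j|.
have D0 : 0 <= D by apply: sumr_ge0.
exists (K + D + 1); first lra.
move=> z; have s0 := dist1_ge0 z a => Ks.
have Ks1 : K * dist1 z a <= 1 by nra.
have := HK z Ks1.
have : `|\sum_j d j * (z j - a j)| <= D * dist1 z a.
  apply: le_trans (ler_norm_sum _ _ _) _; rewrite mulr_suml; apply: ler_sum => j _.
  by rewrite normrM ler_wpM2l// le_dist1.
set S := \sum_j _ => H1 H2.
have -> : f z - f a = f z - f a - S + S by ring.
apply: le_trans (ler_normD _ _) _; nra.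
Qed.

Lemma quad_cont f a d (e : R) : quad f a d -> 0 < e -> exists2 r : R, 0 < r &
  forall z, (forall i, `|z i - a i| <= r) -> `|f z - f a| < e.
Proof.
move=> /quad_lip[K K0 HK] e0.
pose N : R := #|I|%:R + 1.
have N0 : 0 < N by rewrite ltr_wpDl.
pose m := Num.min 1 (e / 2); have m0 : 0 < m by rewrite lt_min ltr01 divr_gt0.
exists (m / (K * N)); first by rewrite divr_gt0// mulr_gt0.
move=> z zr.
have h : K * dist1 z a <= m.
  have : dist1 z a <= m / (K * N) * N.
    apply: (@le_trans _ _ (\sum_(i : I) m / (K * N))); first by apply: ler_sum.
    rewrite sumr_const -[leLHS]mulr_natr ler_wpM2l ?lerDl//.
    by rewrite divr_ge0 ?mulr_ge0 ?ltW.
  move=> /(ler_wpM2l (ltW K0)) /le_trans; apply.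
  rewrite le_eqVlt; apply/orP; left; apply/eqP; field.
  by rewrite !gt_eqF.
have m1 : m <= 1 by rewrite ge_min lexx.
have me : m <= e / 2 by rewrite ge_min lexx orbT.
apply: le_lt_trans (HK z (le_trans h m1)) _; lra.
Qed.

Lemma quad_ext f g a d : f a = g a -> (exists2 r : R, 0 < r & forall z,
    (forall i, `|z i - a i| <= r) -> f z = g z) -> quad f a d -> quad g a d.
Proof.
move=> fga [r r0 fg] [K K0 HK]; exists (K + r^-1); first by rewrite addr_gt0 ?invr_gt0.
move=> z; have s0 := dist1_ge0 z a; have ri : 0 < r^-1 by rewrite invr_gt0.
rewrite mulrDl => H.
have H1 : K * dist1 z a <= 1 by apply: le_trans H; rewrite lerDl mulr_ge0// ltW.
have H2 : dist1 z a <= r.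
  have : r^-1 * dist1 z a <= 1 by apply: le_trans H; rewrite lerDr mulr_ge0// ltW.
  by rewrite ler_pdivrMl// mulr1.
rewrite -fga -fg; last by move=> i; apply: le_trans H2; apply: le_dist1.
apply: le_trans (HK z H1) _; rewrite ler_wpM2r ?exprn_ge0// lerDl; exact: ltW.
Qed.

Lemma quad_addO f g a d : quad f a d -> (exists2 K : R, 0 < K & forall z,
    K * dist1 z a <= 1 -> `|g z - f z| <= K * dist1 z a ^+ 2) -> quad g a d.
Proof.
move=> [K K0 HK] [L L0 HL]; exists (K + L); first exact: addr_gt0.
have a0 : dist1 a a = 0 by rewrite /dist1 big1// => i _; rewrite subrr normr0.
have := HL a; rewrite a0 mulr0 expr2 !mulr0 => /(_ ler01).
rewrite normr_le0 subr_eq0 => /eqP ga z; have s0 := dist1_ge0 z a => KL.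
have /HK h1 : K * dist1 z a <= 1 by nra.
have /HL h2 : L * dist1 z a <= 1 by nra.
rewrite ga; set S := \sum_j _ in h1 *.
have -> : g z - f a - S = (f z - f a - S) + (g z - f z) by ring.
by apply: le_trans (ler_normD _ _) _; rewrite mulrDl lerD.
Qed.

Lemma quadB f g a d d' : quad f a d -> quad g a d' ->
  quad (fun z => f z - g z) a (fun j => d j - d' j).
Proof.
move=> [K K0 HK] [L L0 HL]; exists (K + L); first exact: addr_gt0.
move=> z; have s0 := dist1_ge0 z a => KL.
have /HK h1 : K * dist1 z a <= 1 by nra.
have /HL h2 : L * dist1 z a <= 1 by nra.
under eq_bigr do rewrite mulrBl; rewrite sumrB.
set S := \sum_j d j * _ in h1 *; set S' := \sum_j d' j * _ in h2 *.
have -> : f z - g z - (f a - g a) - (S - S') = (f z - f a - S) - (g z - g a - S') by ring.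
by apply: le_trans (ler_normB _ _) _; rewrite mulrDl lerD.
Qed.

End FirstOrder.

(** * Chain rule for first-order expansions *)

Section Chain.
Variables (R : realType) (I J : finType).

Lemma quad_comp (F : (J -> R) -> R) (h : J -> (I -> R) -> R) (a : I -> R)
    (D : J -> R) (d : J -> I -> R) :
  quad F (fun j => h j a) D -> (forall j, quad (h j) a (d j)) ->
  quad (fun x => F (fun j => h j x)) a (fun i => \sum_j D j * d j i).
Proof.
move=> [K0 K00 HF] hq.
have /boolp.choice[K1 HK1] : forall j, exists K, 0 < K /\ forall z,
    K * dist1 z a <= 1 -> `|h j z - h j a - \sum_i d j i * (z i - a i)| <= K * dist1 z a ^+ 2.
  by move=> j; have [K ? ?] := hq j; exists K.
have /boolp.choice[L1 HL1] : forall j, exists K, 0 < K /\ forall z,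
    K * dist1 z a <= 1 -> `|h j z - h j a| <= K * dist1 z a.
  by move=> j; have [K ? ?] := quad_lip (hq j); exists K.
pose L := \sum_j L1 j; pose K := \sum_j K1 j; pose Q := \sum_j `|D j| * K1 j.
have L0 : 0 <= L by apply: sumr_ge0 => j _; apply: ltW; case: (HL1 j).
have K_0 : 0 <= K by apply: sumr_ge0 => j _; apply: ltW; case: (HK1 j).
have Q0 : 0 <= Q by apply: sumr_ge0 => j _; rewrite mulr_ge0// ltW//; case: (HK1 j).
have KL2 : 0 <= K0 * L ^+ 2 by rewrite mulr_ge0 ?exprn_ge0// ltW.
have KL : 0 <= K0 * L by rewrite mulr_ge0// ltW.
(* [L], [K] and [K0 * L] keep [z] where the estimates for the [h j] hold and its image where that
   for [F] holds; [K0 * L ^+ 2] and [Q] bound the remainders coming from [F] and from the [h j]. *)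
exists (L + K + K0 * L + K0 * L ^+ 2 + Q + 1); first lra.
move=> z; have s0 := dist1_ge0 z a => hs.
set s := dist1 z a in s0 hs *.
have Ls : L * s <= 1 by nra.
have Ks : K * s <= 1 by nra.
have KLs : K0 * (L * s) <= 1 by nra.
have h1 j : `|h j z - h j a| <= L1 j * s.
  apply: (HL1 j).2; apply: le_trans Ls; rewrite ler_wpM2r//.
  by rewrite /L (bigD1 j)//= lerDl sumr_ge0// => i _; apply: ltW; case: (HL1 i).
have h2 j : `|h j z - h j a - \sum_i d j i * (z i - a i)| <= K1 j * s ^+ 2.
  apply: (HK1 j).2; apply: le_trans Ks; rewrite ler_wpM2r//.
  by rewrite /K (bigD1 j)//= lerDl sumr_ge0// => i _; apply: ltW; case: (HK1 i).
have hd : dist1 (fun j => h j z) (fun j => h j a) <= L * s.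
  by rewrite /dist1 /L mulr_suml; apply: ler_sum.
have hd0 := dist1_ge0 (fun j => h j z) (fun j => h j a).
have := HF (fun j => h j z) (le_trans (ler_wpM2l (ltW K00) hd) KLs).
set Fz := F _; set Fa := F _ => h3.
have h4 : K0 * dist1 (fun j => h j z) (fun j => h j a) ^+ 2 <= K0 * (L * s) ^+ 2.
  by apply: ler_wpM2l; [exact: ltW|rewrite lerXn2r ?nnegrE ?mulr_ge0].
have h5 : `|\sum_j D j * (h j z - h j a - \sum_i d j i * (z i - a i))| <= Q * s ^+ 2.
  apply: le_trans (ler_norm_sum _ _ _) _; rewrite /Q mulr_suml; apply: ler_sum => j _.
  by rewrite normrM -mulrA ler_wpM2l.
have -> : \sum_j (\sum_j0 D j0 * d j0 j) * (z j - a j) =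
    \sum_j D j * \sum_i d j i * (z i - a i).
  under eq_bigr do rewrite mulr_suml.
  rewrite exchange_big; apply: eq_bigr => j _; rewrite mulr_sumr.
  by apply: eq_bigr => i _; rewrite mulrA.
move: h5; under eq_bigr do rewrite mulrBr; rewrite sumrB => h5.
set S := \sum_j D j * (h j z - h j a) in h3 h5.
set S' := \sum_j D j * \sum_i _ in h5 *.
have -> : Fz - Fa - S' = (Fz - Fa - S) + (S - S') by ring.
apply: le_trans (ler_normD _ _) _.
have s2 : 0 <= s ^+ 2 by apply: exprn_ge0.
move: (le_trans h3 h4); rewrite exprMn => h6.
nra.
Qed.

End Chain.

(** * Sums of convergent power series *)

Section Series.
Variables (R : realType) (I : finType).
Implicit Types (f g : (I -> R) -> R) (a z : I -> R) (c : multi I -> R) (r M : R).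

Definition box a r : set (I -> R) := [set z | forall i, `|z i - a i| <= r].

(** The norm bound at radius [r] gives absolute summability uniformly on the closed box, so that
    values and norms refer to the same radius. *)
Definition has_series f a c r : Prop := [/\ 0 < r, exists M, nbd (pw r) c M &
  forall z, box a r z -> hsum (fun b => c b * mon (fun i => z i - a i) b) (f z)].

Lemma box_center a r : 0 <= r -> box a r a.
Proof. by move=> r0 i; rewrite subrr normr0. Qed.

Lemma box_le a r r' : r' <= r -> box a r' `<=` box a r.
Proof. by move=> rr z zr i; apply: le_trans (zr i) rr. Qed.

Lemma nbd_pw_le c r r' M : 0 <= r' -> r' <= r -> nbd (pw r) c M -> nbd (pw r') c M.
Proof.
move=> r'0 rr; apply: sbounded_le => b; rewrite !normrM ler_wpM2l//.
rewrite !ger0_norm ?exprn_ge0 ?(le_trans r'0)//.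
by rewrite lerXn2r// nnegrE (le_trans r'0).
Qed.

(** Every remaining monomial has positive degree, so shrinking the radius gains at least one factor
    [r' / r]. All later smallness comes from here. *)
Lemma nbd_pw_shrink c r r' M : 0 < r' -> r' <= r -> c (m0 I) = 0 ->
  nbd (pw r) c M -> nbd (pw r') c (r' / r * M).
Proof.
move=> r'0 rr c0 cM; have r0 := lt_le_trans r'0 rr.
have q0 : 0 <= r' / r by rewrite divr_ge0 ?ltW.
have := sboundedZ (r' / r) cM; rewrite ger0_norm//; apply: sbounded_le => b.
have [->|] := eqVneq b (m0 I); first by rewrite c0 !mul0r mulr0.
rewrite -mdeg_eq0 -lt0n => bp.
rewrite [leRHS]normrM (ger0_norm q0) !(normrM (c b)) mulrCA ler_wpM2l// /pw.
rewrite !ger0_norm ?exprn_ge0 ?(ltW r0) ?(ltW r'0)//.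
case: (mdeg b) bp => // n _; rewrite !exprS mulrA mulfVK ?gt_eqF// ler_pM2l//.
by rewrite lerXn2r// nnegrE ltW.
Qed.

Lemma has_series_le f a c r r' : 0 < r' -> r' <= r ->
  has_series f a c r -> has_series f a c r'.
Proof.
move=> r'0 rr [r0 [M cM] H]; split=> //; first by exists M; apply: nbd_pw_le cM => //; exact: ltW.
by move=> z /(box_le rr)/H.
Qed.

Lemma has_series_ext f g a c r : (forall z, box a r z -> f z = g z) ->
  has_series f a c r -> has_series g a c r.
Proof. by move=> fg [r0 cM H]; split=> // z zr; rewrite -fg//; apply: H. Qed.

Lemma ffun_mon D (b : {ffun I -> 'I_D}) c (z : I -> R) :
  c [ffun i => nat_of_ord (b i)] * \prod_i z i ^+ b i =
  (fun b => c b * mon z b) [ffun i => nat_of_ord (b i)].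
Proof. by rewrite /mon; congr (_ * _); apply: eq_bigr => i _; rewrite ffunE. Qed.

Lemma boxsum_mon c a z :
  (fun D : nat => \sum_(al : {ffun I -> 'I_D})
     c [ffun i => nat_of_ord (al i)] * \prod_i (z i - a i) ^+ al i) =
  (fun D : nat => \sum_(b : {ffun I -> 'I_D})
     (fun b => c b * mon (fun i => z i - a i) b) [ffun i => nat_of_ord (b i)]).
Proof.
apply/funext => D; apply: eq_bigr => b _.
by rewrite (ffun_mon b c (fun i => z i - a i)).
Qed.

Lemma has_series_analytic f a c r : has_series f a c r -> analytic_at f a.
Proof.
move=> [r0 [M cM] H]; exists c, r; split=> // z zr.
have zr' : box a r z by move=> i; apply: ltW.
split.
  exists M => D; under eq_bigr do rewrite (ffun_mon _ c (fun i => z i - a i)).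
  exact: (sbounded_boxsum _ _).2 (nbd_mon cM zr') D.
by rewrite boxsum_mon; apply: hsum_boxsum (H z zr').
Qed.

Lemma analytic_has_series f a : analytic_at f a -> exists c r, has_series f a c r.
Proof.
move=> [c [r [r0 H]]]; exists c, (r / 2).
have r2 : 0 < r / 2 by rewrite divr_gt0.
have cM : exists M, nbd (pw (r / 2)) c M.
  (* At this corner the absolute box sums of [analytic_at] are exactly those of the norm at radius
     [r / 2]. *)
  have [|[M HM] _] := H (fun i => a i + r / 2).
    by move=> i; rewrite addrC addKr gtr0_norm//; lra.
  exists M; apply/sbounded_boxsum => D; have := HM D; congr (_ <= _).
  apply: eq_bigr => b _; rewrite (ffun_mon b c (fun i => a i + r / 2 - a i)).
  rewrite /pw /mdeg -prodrXr; congr (`|_ * _|).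
  by apply: eq_bigr => i _; rewrite addrC addKr.
split=> // z zr; have [M HM] := cM.
have [s Hs] := hsum_exists (nbd_mon HM zr).
have [|_] := H z; first by move=> i; apply: le_lt_trans (zr i) _; lra.
have := hsum_boxsum Hs.
rewrite boxsum_mon => h1 h2.
by rewrite -(cvg_unique _ h1 h2).
Qed.

Lemma mon_zero b : mon (fun _ : I => 0 : R) b = (b == m0 I)%:R.
Proof.
have [->|] := eqVneq b (m0 I); first by rewrite mon0.
rewrite -mdeg_eq0 => bp; have [j bj] : exists j, b j != 0%N.
  apply/existsP; apply: contraT; rewrite negb_exists => /forallP H.
  by move: bp; rewrite /mdeg big1// => i _; apply/eqP; have := H i; rewrite negbK.
by rewrite /mon (bigD1 j)//= expr0n (negPf bj) mul0r.
Qed.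

Lemma has_series_center f a c r : has_series f a c r -> f a = c (m0 I).
Proof.
move=> [r0 _ /(_ a (box_center _ (ltW r0))) H]; apply: (hsum_unique H).
have -> : (fun i => a i - a i) = (fun=> 0) by apply/funext => i; rewrite subrr.
have := @hsum_single _ _ (m0 I) (fun b => c b * mon (fun=> 0) b).
rewrite mon0 mulr1; apply=> b /negPf b0.
by rewrite mon_zero b0 mulr0.
Qed.

Lemma mdeg_eq1 (b : multi I) : mdeg b = 1%N -> exists j, b = me j.
Proof.
elim/multi_ind: b => [|j b _]; first by rewrite mdeg0.
rewrite mdegD mdeg_me addn1 => -[] /eqP; rewrite mdeg_eq0 => /eqP ->.
by exists j; apply/ffunP => i; rewrite !ffunE.
Qed.

Lemma me_inj : injective (@me I).
Proof.
by move=> i j /ffunP /(_ i); rewrite !ffunE eqxx; case: eqP.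
Qed.

Lemma me_neq0 j : (m0 I == me j) = false.
Proof. by apply/negP => /eqP /(congr1 (@mdeg I)); rewrite mdeg0 mdeg_me. Qed.

(** With [d = dist1 z a <= r], a monomial of degree [e >= n] is at most [d^e <= d^n r^(e - n)], so
    what is left outside [s0] is at most [d^n r^-n] times the norm of [c]. *)
Lemma has_series_tail f a c r (s0 : seq (multi I)) n : has_series f a c r -> uniq s0 ->
  (forall b, b \notin s0 -> (n <= mdeg b)%N) ->
  exists2 K : R, 0 < K & forall z, K * dist1 z a <= 1 ->
    `|f z - \sum_(b <- s0) c b * mon (fun i => z i - a i) b| <= K * dist1 z a ^+ n.
Proof.
move=> fs us s0n; have [r0 [M cM] H] := fs.
have M0 := sbounded_ge0 cM; have ri : 0 < r^-1 by rewrite invr_gt0.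
exists (r^-1 + r^-1 ^+ n * M); first by rewrite ltr_wpDr// mulr_ge0 ?exprn_ge0// ltW.
move=> z; have d0 := dist1_ge0 z a => hK.
have dr : dist1 z a <= r.
  have : r^-1 * dist1 z a <= 1.
    by apply: le_trans hK; rewrite ler_wpM2r// lerDl mulr_ge0// exprn_ge0// ltW.
  by rewrite ler_pdivrMl// mulr1.
have zr : box a r z by move=> i; apply: le_trans dr; apply: le_dist1.
set t := fun i => z i - a i.
have monn b : b \notin s0 -> `|mon t b| <= dist1 z a ^+ n * (r^-1 ^+ n * r ^+ mdeg b).
  move=> /s0n bn; apply: le_trans (mon_le b (fun i => le_dist1 z a i)) _.
  rewrite -(subnKC bn) !exprD ler_wpM2l ?exprn_ge0// mulrA exprVn mulVf ?mul1r.
    by rewrite lerXn2r// nnegrE ltW.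
  by rewrite expf_neq0// gt_eqF.
pose g b := if b \in s0 then c b * mon t b else 0.
have Hg : hsum g (\sum_(b <- s0) c b * mon t b).
  have -> : \sum_(b <- s0) c b * mon t b = \sum_(b <- s0) g b.
    by rewrite big_seq [RHS]big_seq; apply: eq_bigr => b; rewrite /g => ->.
  by apply: hsum_fin us _ => b; rewrite /g => /negPf ->.
have := hsumB (H z zr) Hg.
apply: hsum_norm_le.
have := sboundedZ (dist1 z a ^+ n * r^-1 ^+ n) cM.
rewrite ger0_norm; last by rewrite mulr_ge0// exprn_ge0// ltW.
move=> /sboundedW; have hM : dist1 z a ^+ n * r^-1 ^+ n * M <=
    (r^-1 + r^-1 ^+ n * M) * dist1 z a ^+ n.
  rewrite -mulrA mulrC ler_wpM2r ?exprn_ge0// lerDr; exact: ltW.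
move=> /(_ _ hM); apply: sbounded_le => b; rewrite /g; case: ifPn => bs.
  by rewrite subrr normr0.
rewrite subr0 [leRHS]normrM [X in _ <= X * _]ger0_norm; last first.
  by rewrite mulr_ge0// exprn_ge0// ltW.
rewrite normrM [X in _ <= _ * X]normrM mulrCA ler_wpM2l//.
apply: le_trans (monn b bs) _; rewrite mulrA; apply: ler_wpM2l; last exact: ler_norm.
by rewrite mulr_ge0// exprn_ge0// ltW.
Qed.

Lemma has_series_quad f a c r : has_series f a c r -> quad f a (fun j => c (me j)).
Proof.
move=> fs; pose s0 := m0 I :: map (@me I) (enum I).
have us : uniq s0.
  rewrite /= map_inj_uniq ?enum_uniq//; last exact: me_inj.
  by rewrite andbT; apply/mapP => -[j _ /eqP]; rewrite me_neq0.
have [|K K0 HK] := has_series_tail (n := 2) fs us.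
  move=> b; rewrite inE negb_or -mdeg_eq0; case E: (mdeg b) => [|[|n]]//= .
  by have [j ->] := mdeg_eq1 E; rewrite map_f// mem_enum.
exists K => // z /HK; rewrite /s0 big_cons big_map big_enum /= mon0 mulr1.
rewrite (has_series_center fs) opprD addrA.
by under eq_bigr do rewrite mon_me.
Qed.

Lemma has_series_partial_center f a c r j : has_series f a c r ->
  partial f j a = c (me j).
Proof. by move=> /has_series_quad; apply: quad_partial. Qed.

Lemma has_seriesD f g a c c' r : has_series f a c r -> has_series g a c' r ->
  has_series (fun z => f z + g z) a (fun b => c b + c' b) r.
Proof.
move=> [r0 [M cM] H] [_ [N cN] H']; split=> //; first by exists (M + N); apply: nbdD.
move=> z zr; apply: hsum_ext (hsumD (H z zr) (H' z zr)) => b.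
by rewrite mulrDl.
Qed.

Lemma has_seriesZ x f a c r : has_series f a c r ->
  has_series (fun z => x * f z) a (fun b => x * c b) r.
Proof.
move=> [r0 [M cM] H]; split=> //.
  by exists (`|x| * M); apply: sbounded_le (sboundedZ x cM) => b; rewrite mulrA.
by move=> z zr; apply: hsum_ext (hsumZ x (H z zr)) => b; rewrite mulrA.
Qed.

Lemma has_seriesB f g a c c' r : has_series f a c r -> has_series g a c' r ->
  has_series (fun z => f z - g z) a (fun b => c b - c' b) r.
Proof.
move=> fs /(has_seriesZ (-1)) gs; have := has_seriesD fs gs.
by congr has_series; apply/funext => b; rewrite mulN1r.
Qed.

Lemma has_series_cst x a r : 0 < r -> has_series (fun=> x) a (@fcst I R x) r.
Proof.
move=> r0; split=> //; first by exists `|x|; apply: nbd_fcst (weight_pw I r0) x.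
by move=> z _; apply: hsum_fcst.
Qed.

Lemma has_series_sum (K : finType) (f : K -> (I -> R) -> R) a (c : K -> multi I -> R) r :
  0 < r -> (forall j, has_series (f j) a (c j) r) ->
  has_series (fun z => \sum_j f j z) a (fun b => \sum_j c j b) r.
Proof.
move=> r0 H.
have -> : (fun z => \sum_j f j z) = (fun z => \sum_(j <- enum K) f j z).
  by apply/funext => z; rewrite big_enum.
have -> : (fun b => \sum_j c j b) = (fun b => \sum_(j <- enum K) c j b).
  by apply/funext => z; rewrite big_enum.
elim: (enum K) => [|k s IH].
  have := has_series_cst 0 a r0; congr has_series; apply/funext => b; rewrite big_nil//.
  by rewrite /fcst if_same.
have := has_seriesD (H k) IH.
by congr has_series; apply/funext => b; rewrite big_cons.
Qed.

Lemma has_series_coord j (x : R) a r : 0 < r ->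
  has_series (fun z => z j - x) a (fun b => fcst (a j - x) b + fX R j b) r.
Proof.
move=> r0; have w := weight_pw I r0.
split=> //; first by eexists; apply: nbdD; [exact: nbd_fcst|exact: nbd_fX].
move=> z _; pose t i := z i - a i.
have := hsumD (hsum_fcst (a j - x) t) (hsum_fX j t); rewrite /t.
have -> : a j - x + (z j - a j) = z j - x by ring.
by apply: hsum_ext => b; rewrite mulrDl.
Qed.

Lemma has_seriesM f g a c c' r : has_series f a c r -> has_series g a c' r ->
  has_series (fun z => f z * g z) a (fmul c c') r.
Proof.
move=> [r0 [M cM] H] [_ [N cN] H']; split=> //.
  by exists (M * N); apply: nbd_fmul => //; apply: weight_pw.
by move=> z zr; apply: hsum_fmul_mon zr cM cN (H z zr) (H' z zr).
Qed.

Definition fD (j : I) c : multi I -> R := fun b => (b j).+1%:R * c (madd b (me j)).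

Lemma sbounded_inj (T T' : eqType) (phi : T -> T') (h : T' -> R) M :
  injective phi -> sbounded h M -> sbounded (fun x => h (phi x)) M.
Proof.
move=> phii hM s us; rewrite -(big_map phi xpredT (fun x => `|h x|)).
by apply: hM; rewrite map_inj_uniq.
Qed.

Lemma madd_inj (b : multi I) : injective (fun x => madd x b).
Proof. by move=> x y /(congr1 (fun u => msub u b)); rewrite !maddKr. Qed.

(** Each of the terms [1, q, ..., q^n] is at least [q^n], and their sum is at most [1 / (1 - q)]. *)
Lemma geom_bound (q : R) n : 0 <= q -> q < 1 -> n.+1%:R * q ^+ n <= (1 - q)^-1.
Proof.
move=> q0 q1; have p : 0 < 1 - q by lra.
have qle1 i : q ^+ i <= 1 by rewrite exprn_ile1// ltW.
suff : (n.+1%:R * q ^+ n) * (1 - q) <= 1 - q ^+ n.+1.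
  move=> H; rewrite -[leRHS]mul1r ler_pdivlMr//; apply: le_trans H _.
  by rewrite gerBl exprn_ge0.
elim: n => [|n IH]; first by rewrite expr0 expr1 mulr1 mul1r.
have h : 0 <= q ^+ n.+1 by apply: exprn_ge0.
rewrite -natr1 exprS [q ^+ n.+2]exprS; move: IH h (qle1 n.+1).
rewrite exprS; set x := q ^+ n; set N := n.+1%:R => IH h h1.
have : q * (N * x * (1 - q)) <= q * (1 - q * x) by rewrite ler_wpM2l.
nra.
Qed.

Lemma nbd_fD j c r r' M : 0 < r' -> r' < r -> nbd (pw r) c M ->
  exists N, nbd (pw r') (fD j c) N.
Proof.
move=> r'0 rr cM; have r0 := lt_trans r'0 rr.
pose q := r' / r; have q0 : 0 <= q by rewrite divr_ge0 ?ltW.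
have q1 : q < 1 by rewrite ltr_pdivrMr// mul1r.
exists (`|(1 - q)^-1 / r| * M).
have := sboundedZ ((1 - q)^-1 / r) (sbounded_inj (@madd_inj (me j)) cM).
apply: sbounded_le => b; rewrite /fD /pw mdegD mdeg_me addn1.
have -> : r' = q * r by rewrite mulfVK// gt_eqF.
rewrite exprMn exprSr.
have -> : (1 - q)^-1 / r * (c (madd b (me j)) * (r ^+ mdeg b * r)) =
  (1 - q)^-1 * (c (madd b (me j)) * r ^+ mdeg b).
  by field; rewrite !gt_eqF//; lra.
have -> : (b j).+1%:R * c (madd b (me j)) * (q ^+ mdeg b * r ^+ mdeg b) =
  ((b j).+1%:R * q ^+ mdeg b) * (c (madd b (me j)) * r ^+ mdeg b) by ring.
rewrite !normrM ler_wpM2r//; apply: le_trans (ler_norm _).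
apply: le_trans (geom_bound (mdeg b) q0 q1).
by rewrite -normrM ger0_norm ?mulr_ge0 ?exprn_ge0// ler_wpM2r ?exprn_ge0// ler_nat ltnS leq_mdeg.
Qed.

(** The remainder is a polynomial in [t] divisible by [t^2], with nonnegative coefficients once [x]
    is replaced by [|x|]; and [|t|^i <= (|t| / h)^2 h^i] for [i >= 2]. *)
Lemma binom_remainder (x t h : R) n : 0 < h -> `|t| <= h ->
  `|(x + t) ^+ n - x ^+ n - n%:R * x ^+ n.-1 * t| <=
  (`|t| / h) ^+ 2 * ((`|x| + h) ^+ n - `|x| ^+ n - n%:R * `|x| ^+ n.-1 * h).
Proof.
move=> h0 th; elim: n => [|n IH].
  by rewrite !expr0 !mul0r !subr0 !subrr normr0 mulr0.
pose E := (x + t) ^+ n - x ^+ n - n%:R * x ^+ n.-1 * t.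
pose G := (`|x| + h) ^+ n - `|x| ^+ n - n%:R * `|x| ^+ n.-1 * h.
have xE (y : R) : n%:R * y ^+ n = y * (n%:R * y ^+ n.-1).
  by case: n {IH E G} => [|n]; rewrite ?mul0r ?mulr0// exprS; ring.
have -> : (x + t) ^+ n.+1 - x ^+ n.+1 - n.+1%:R * x ^+ n.+1.-1 * t =
  (x + t) * E + n%:R * x ^+ n.-1 * t ^+ 2.
  rewrite /E [(x + t) ^+ n.+1]exprS [x ^+ n.+1]exprS /= -natr1 (mulrDl n%:R) xE; ring.
have -> : (`|x| + h) ^+ n.+1 - `|x| ^+ n.+1 - n.+1%:R * `|x| ^+ n.+1.-1 * h =
  (`|x| + h) * G + n%:R * `|x| ^+ n.-1 * h ^+ 2.
  rewrite /G [(`|x| + h) ^+ n.+1]exprS [`|x| ^+ n.+1]exprS /= -natr1 (mulrDl n%:R) xE; ring.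
apply: le_trans (ler_normD _ _) _; rewrite [leRHS]mulrDr; apply: lerD.
  rewrite normrM mulrCA; apply: ler_pM => //.
  by apply: le_trans (ler_normD _ _) _; rewrite lerD2l.
have -> : (`|t| / h) ^+ 2 * (n%:R * `|x| ^+ n.-1 * h ^+ 2) = n%:R * `|x| ^+ n.-1 * `|t| ^+ 2.
  by field; rewrite gt_eqF.
by rewrite !normrM !normrX normr_nat.
Qed.

Lemma mon_upd z j t b : mon (upd z j t) b = t ^+ b j * \prod_(i | i != j) z i ^+ b i.
Proof.
rewrite /mon (bigD1 j)//= /upd eqxx; congr (_ * _).
by apply: eq_bigr => i /negPf ->.
Qed.

(** Termwise differentiation at every point of the smaller box: with [h = r - r'] one has
    [|x_j| + h <= r], so the second-order remainders of the monomials add up to at most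
    [(|t| / h)^2 M]. *)
Lemma has_series_partial f a c r r' j : has_series f a c r -> 0 < r' -> r' < r ->
  has_series (partial f j) a (fD j c) r'.
Proof.
move=> [r0 [M cM] H] r'0 rr; have [N cN] := nbd_fD j r'0 rr cM.
split=> //; first by exists N.
move=> z zr; pose x i := z i - a i.
have [s Hs] := hsum_exists (nbd_mon cN zr).
suff -> : partial f j z = s by [].
pose h := r - r'; have h0 : 0 < h by rewrite /h; lra.
have M0 := sbounded_ge0 cM.
apply: partial_eq; exists (h^-1 + M / h ^+ 2).
  by rewrite ltr_wpDr ?invr_gt0// divr_ge0// exprn_ge0// ltW.
move=> t ht.
have th : `|t| <= h.
  have : h^-1 * `|t| <= 1.
    by apply: le_trans ht; rewrite ler_wpM2r// lerDl divr_ge0// exprn_ge0// ltW.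
  by rewrite ler_pdivrMl// mulr1.
have zb : box a r z by apply: box_le zr; apply: ltW.
have zt : box a r (upd z j (z j + t)).
  move=> i; rewrite /upd; case: eqP => [->|_]; last exact: zb.
  rewrite addrAC; apply: le_trans (ler_normD _ _) _.
  by have := zr j; move: th; rewrite /h; lra.
(* The derived series is shifted by [me j] so that its terms line up with those of the series of
   [f]. *)
have Hs' : hsum (fun b : multi I => if (0 < b j)%N
    then fD j c (msub b (me j)) * mon x (msub b (me j)) else 0) s.
  apply: (@hsum_sub _ _ _ (fun b : multi I => (0 < b j)%N) (fun b => madd b (me j))
    (fun b => msub b (me j)) (fun b => fD j c b * mon x b)) => //.
  - by move=> b; rewrite !ffunE eqxx addn1.
  - by move=> b; rewrite maddKr.
  - by move=> b; rewrite -mle_me maddC => /msubK.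
have := hsumB (hsumB (H _ zt) (H z zb)) (hsumZ t Hs'); rewrite (mulrC s).
have K2 : M / h ^+ 2 * `|t| ^+ 2 <= (h^-1 + M / h ^+ 2) * `|t| ^+ 2.
  by rewrite ler_wpM2r ?exprn_ge0// lerDr invr_ge0 ltW.
move=> Hd; apply: le_trans K2; apply: hsum_norm_le Hd.
have q2 : 0 <= (`|t| / h) ^+ 2 by rewrite exprn_ge0// divr_ge0// ltW.
have := sboundedZ ((`|t| / h) ^+ 2) cM; rewrite (ger0_norm q2).
have -> : (`|t| / h) ^+ 2 * M = M / h ^+ 2 * `|t| ^+ 2 by rewrite expr_div_n; ring.
apply: sbounded_le => b.
have -> : (fun i => upd z j (z j + t) i - a i) = upd x j (x j + t).
  by apply/funext => i; rewrite /upd /x; case: eqP => [->|_] //; ring.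
rewrite -/x mon_upd.
pose Q := \prod_(i | i != j) x i ^+ b i.
have -> : mon x b = x j ^+ b j * Q by rewrite /mon (bigD1 j).
have -> : (if (0 < b j)%N then fD j c (msub b (me j)) * mon x (msub b (me j)) else 0) =
   c b * ((b j)%:R * x j ^+ (b j).-1 * Q).
  case: ifPn => [bj|]; last by rewrite -eqn0Ngt => /eqP ->; rewrite !mul0r mulr0.
  have mb : madd (msub b (me j)) (me j) = b by rewrite maddC msubK// mle_me.
  rewrite /fD mb !ffunE eqxx subn1 prednK//.
  have -> : mon x (msub b (me j)) = x j ^+ (b j).-1 * Q.
    rewrite /mon (bigD1 j)//= !ffunE eqxx subn1; congr (_ * _).
    by apply: eq_bigr => i /negPf ij; rewrite !ffunE ij subn0.
  ring.
rewrite -/Q.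
have -> : c b * ((x j + t) ^+ b j * Q) - c b * (x j ^+ b j * Q) -
   t * (c b * ((b j)%:R * x j ^+ (b j).-1 * Q)) =
   c b * (((x j + t) ^+ b j - x j ^+ b j - (b j)%:R * x j ^+ (b j).-1 * t) * Q) by ring.
rewrite normrM [leRHS]normrM (ger0_norm q2) (normrM (c b)) mulrCA ler_wpM2l//.
rewrite normrM /pw [X in _ <= _ * X]ger0_norm; last by rewrite exprn_ge0// ltW.
have -> : mdeg b = (b j + \sum_(i | i != j) b i)%N by rewrite /mdeg (bigD1 j).
rewrite exprD -prodrXr mulrA; apply: ler_pM => //.
  apply: le_trans (binom_remainder _ _ h0 th) _.
  rewrite ler_wpM2l//.
  apply: (@le_trans _ _ ((`|x j| + h) ^+ b j)).
    by rewrite -addrA gerDl -opprD oppr_le0 addr_ge0 ?mulr_ge0 ?exprn_ge0// ltW.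
  apply: lerXn2r; rewrite ?nnegrE; [|exact: ltW|].
    by apply: addr_ge0 => //; apply: ltW.
  by have := zr j; rewrite -/(x j) /h; lra.
rewrite normr_prod; apply: ler_prod => i _; rewrite normr_ge0/= normrX.
by apply: lerXn2r; rewrite ?nnegrE//; [exact: ltW|exact: zb].
Qed.

(** Differentiating in a direction outside [Y] preserves vanishing on the slice, so induction on the
    multi-index reduces to the value at the centre. With [Y] empty this is the identity theorem;
    with [Y] the dependent variables it reads the coefficients of y-degree 0 off the initial
    plane. *)
Lemma has_series_eq0_on (Y : pred I) f a c r r0 : has_series f a c r -> 0 < r0 ->
  (forall z, box a r0 z -> (forall i, Y i -> z i = a i) -> f z = 0) ->
  forall b : multi I, (forall i, Y i -> b i = 0%N) -> c b = 0.
Proof.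
move=> + + + b; elim/multi_ind: b f c r r0 => [|j b IH] f c r r0 fs r00 f0 b0.
  by rewrite -(has_series_center fs) f0//; apply: box_center; apply: ltW.
have Yj : Y j -> False by move=> /b0; rewrite !ffunE eqxx addn1.
have {}b0 i : Y i -> b i = 0%N.
  by move=> /b0; rewrite !ffunE => /eqP; rewrite addn_eq0 => /andP[/eqP].
have [rp _ _] := fs.
have r2 : 0 < r / 2 by rewrite divr_gt0.
have r02 : 0 < r0 / 2 by rewrite divr_gt0.
have ps : has_series (partial f j) a (fD j c) (r / 2).
  by apply: has_series_partial fs _ _ => //; lra.
have /eqP : (b j).+1%:R * c (madd b (me j)) = 0.
  apply: (IH _ _ _ (r0 / 2) ps r02) => // z zr zY.
  apply: partial_eq; exists (r0 / 2)^-1; first by rewrite invr_gt0.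
  move=> t; rewrite ler_pdivrMl// mulr1 => ht.
  have zb : box a r0 z by apply: box_le zr; lra.
  have zt : box a r0 (upd z j (z j + t)).
    move=> i; rewrite /upd; case: eqP => [->|_]; last exact: zb.
    rewrite addrAC; apply: le_trans (ler_normD _ _) _.
    by have := zr j; lra.
  have ztY i : Y i -> upd z j (z j + t) i = a i.
    by move=> Yi; rewrite /upd; case: eqP => [ij|_]; [case: Yj; rewrite -ij|exact: zY].
  rewrite (f0 _ zt ztY) (f0 _ zb zY) mul0r !subrr normr0; apply: mulr_ge0; last exact: exprn_ge0.
  by rewrite invr_ge0 ltW.
by rewrite mulf_eq0 pnatr_eq0/= => /eqP.
Qed.

Lemma has_series_eq0 f a c r r0 : has_series f a c r -> 0 < r0 ->
  (forall z, box a r0 z -> f z = 0) -> c =1 (fun=> 0).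
Proof.
by move=> fs r00 f0 b; apply: (has_series_eq0_on (Y := pred0) fs r00) => // z zr _; exact: f0.
Qed.

Lemma has_series_unique f g a c c' r r' r0 : has_series f a c r -> has_series g a c' r' ->
  0 < r0 -> (forall z, box a r0 z -> f z = g z) -> c = c'.
Proof.
move=> fs gs r00 fg; have [rp _ _] := fs; have [r'p _ _] := gs.
pose r1 := Num.min r r'; have r1p : 0 < r1 by rewrite lt_min rp.
have fs1 : has_series f a c r1 by apply: has_series_le fs => //; rewrite ge_min lexx.
have gs1 : has_series g a c' r1 by apply: has_series_le gs => //; rewrite ge_min lexx orbT.
have H : forall z, box a r0 z -> f z - g z = 0 by move=> z /fg ->; rewrite subrr.
have := has_series_eq0 (has_seriesB fs1 gs1) r00 H.
by move=> cc; apply/funext => b; apply/eqP; rewrite -subr_eq0; apply/eqP/cc.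
Qed.

End Series.

(** * Composition, recentring and commuting derivatives of analytic functions *)

Section SeriesComp.
Variable R : realType.

Lemma has_series_comp (I J : finType) (F : (J -> R) -> R) (b : J -> R) C (q : R)
    (h : J -> (I -> R) -> R) a (d : J -> multi I -> R) (r : R) :
  has_series F b C q -> 0 < r ->
  (forall j, has_series (fun z => h j z - b j) a (d j) r) ->
  (forall j, nbd (pw r) (d j) q) ->
  has_series (fun z => F (fun j => h j z)) a (fcomp C d) r.
Proof.
move=> [q0 [M CM] HF] r0 hs dq; split=> //.
  by exists M; apply: (nbd_fcomp (weight_pw I r0) CM dq).
move=> z zr.
have hv j : hsum (fun c => d j c * mon (fun i => z i - a i) c) (h j z - b j).
  by have [_ _ H] := hs j; apply: H.
apply: (hsum_fcomp_mon r0 zr CM dq hv); apply: HF => j.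
exact: hsum_norm_le (nbd_mon (dq j) zr) (hv j).
Qed.

(** Recentring is composition with the coordinate functions: at [a], the series of [z_j - b_j] is
    the constant [a_j - b_j] plus a variable, of norm [|a_j - b_j| + r]. *)
Lemma has_series_recenter (I : finType) (F : (I -> R) -> R) b C (q : R) a (r : R) :
  has_series F b C q -> 0 < r ->
  (forall i, `|a i - b i| + r <= q) -> exists c, has_series F a c r.
Proof.
move=> Fs r0 ab; eexists.
apply: (@has_series_comp I I F b C q (fun j z => z j) a _ r Fs r0
  (fun j => has_series_coord j (b j) a r0)).
move=> j; have w := weight_pw I r0.
apply: nbdW (ab j) _; apply: nbdD; first exact: nbd_fcst.
by have := nbd_fX w j; rewrite /pw mdeg_me expr1.
Qed.

Lemma has_series_analytic_near (I : finType) (f : (I -> R) -> R) a c (r : R) z :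
  has_series f a c r -> (forall i, `|z i - a i| < r) -> analytic_at f z.
Proof.
move=> fs zr; have [r0 _ _] := fs.
pose s := \big[Num.max/0]_i `|z i - a i|.
have sr : s < r by apply/bigmax_ltP.
have [] := @has_series_recenter I f a c r z (r - s) fs.
- by rewrite subr_gt0.
- by move=> i; have := le_bigmax 0 (fun i => `|z i - a i|) i; rewrite -/s; lra.
- by move=> c' /has_series_analytic.
Qed.

(** Each property persists at smaller radii, so the minimum of finitely many radii serves them all;
    starting the minimum at 1 covers an empty [J]. *)
Lemma fin_small (J : finType) (P : J -> R -> Prop) :
  (forall j, exists2 r, 0 < r & forall r', 0 < r' -> r' <= r -> P j r') ->
  exists2 r, 0 < r & forall r', 0 < r' -> r' <= r -> forall j, P j r'.
Proof.
move=> H; have /boolp.choice[rr Hr] : forall j, exists r : R, 0 < r /\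
    forall r', 0 < r' -> r' <= r -> P j r' by move=> j; have [r ? ?] := H j; exists r.
exists (\big[Num.min/1]_j rr j).
  by apply/bigmin_gtP; split=> // j _; case: (Hr j).
move=> r' r'0 r'le j; apply: (Hr j).2 => //; apply: le_trans r'le _.
exact: bigmin_le.
Qed.

Definition fsub (I : finType) (c : multi I -> R) (x : R) : multi I -> R :=
  fun b => c b - fcst x b.

Lemma has_series_small (I : finType) (f : (I -> R) -> R) a c (r e : R) :
  has_series f a c r -> 0 < e ->
  exists2 r0, 0 < r0 & forall r', 0 < r' -> r' <= r0 ->
    [/\ has_series f a c r', has_series (fun z => f z - f a) a (fsub c (f a)) r' &
      nbd (pw r') (fsub c (f a)) e].
Proof.
move=> fs e0; have [r0 _ _] := fs.
have fs1 := has_seriesB fs (has_series_cst (f a) a r0).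
have [_ [M cM] _] := fs1; have M0 := sbounded_ge0 cM.
have e' : 0 < e * r / (M + 1) by rewrite divr_gt0 ?mulr_gt0//; lra.
exists (Num.min r (e * r / (M + 1))); first by rewrite lt_min r0.
move=> r' r'0; rewrite le_min => /andP[rr re]; split.
- exact: has_series_le fs.
- exact: has_series_le fs1.
- apply: nbdW (nbd_pw_shrink r'0 rr _ cM); last first.
    by rewrite /fcst eqxx (has_series_center fs) subrr.
  move: re; rewrite ler_pdivlMr; last lra.
  move=> re; rewrite mulrAC ler_pdivrMr//; nra.
Qed.

Lemma has_series_comp0 (I J : finType) (F : (J -> R) -> R) (h : J -> (I -> R) -> R) a
    C (q : R) (c : J -> multi I -> R) (r : R) :
  has_series F (fun j => h j a) C q -> (forall j, has_series (h j) a (c j) r) ->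
  exists2 r0, 0 < r0 & forall r', 0 < r' -> r' <= r0 ->
    has_series (fun z => F (fun j => h j z)) a (fcomp C (fun j => fsub (c j) (h j a))) r'.
Proof.
move=> Fs hs; have [q0 _ _] := Fs.
have [r0 r00 H] := fin_small (fun j => has_series_small (hs j) q0).
exists r0 => // r' r'0 r'le.
by apply: (has_series_comp Fs r'0) => j; case: (H r' r'0 r'le j).
Qed.

Lemma analytic_series_family (I J : finType) (h : J -> (I -> R) -> R) a :
  (forall j, analytic_at (h j) a) ->
  exists c, exists2 r : R, 0 < r & forall j, has_series (h j) a (c j) r.
Proof.
move=> ha; have /boolp.choice[c Hc] : forall j, exists c, exists r, has_series (h j) a c r.
  by move=> j; exact: analytic_has_series.
exists c; have [|r r0 H] := @fin_small J (fun j r => has_series (h j) a (c j) r).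
  move=> j; have [r hr] := Hc j; have [r0 _ _] := hr.
  by exists r => // r' r'0 rr; apply: has_series_le hr.
by exists r => // j; apply: H.
Qed.

Lemma analytic_at_comp (I J : finType) (F : (J -> R) -> R) (h : J -> (I -> R) -> R) a :
  analytic_at F (fun j => h j a) -> (forall j, analytic_at (h j) a) ->
  analytic_at (fun z => F (fun j => h j z)) a.
Proof.
move=> /analytic_has_series[C [q Fs]] /analytic_series_family[c [r r0 hs]].
have [r1 r10 H] := has_series_comp0 Fs hs.
exact: has_series_analytic (H r1 r10 (lexx _)).
Qed.

Lemma analytic_quad (I : finType) (f : (I -> R) -> R) a : analytic_at f a ->
  quad f a (fun j => partial f j a).
Proof.
move=> /analytic_has_series[c [r fs]]; have := has_series_quad fs.
by congr quad; apply/funext => j; rewrite (has_series_partial_center j fs).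
Qed.

Lemma analytic_partial (I : finType) (f : (I -> R) -> R) a j :
  analytic_at f a -> analytic_at (partial f j) a.
Proof.
move=> /analytic_has_series[c [r fs]]; have [r0 _ _] := fs.
apply: (@has_series_analytic _ _ _ _ (fD j c) (r / 2)).
by apply: has_series_partial fs _ _; lra.
Qed.

Lemma fDC (I : finType) (i j : I) (c : multi I -> R) : fD i (fD j c) = fD j (fD i c).
Proof.
apply/funext => b; rewrite /fD !ffunE.
have -> : madd (madd b (me i)) (me j) = madd (madd b (me j)) (me i).
  by apply/ffunP => k; rewrite !ffunE addnAC.
rewrite (eq_sym i j); have [->|_] := eqVneq j i; first by [].
by rewrite !addn0 mulrCA.
Qed.

Lemma partialC (I : finType) (f : (I -> R) -> R) a i j : analytic_at f a ->
  partial (partial f i) j a = partial (partial f j) i a.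
Proof.
move=> /analytic_has_series[c [r fs]]; have [r0 _ _] := fs.
have H k : has_series (partial f k) a (fD k c) (r / 2).
  by apply: has_series_partial fs _ _; lra.
rewrite (has_series_partial_center j (H i)) (has_series_partial_center i (H j)).
have /(congr1 (fun h => h (m0 I))) := fDC i j c.
rewrite {1 3}/fD !ffunE !mul1r.
have e k : madd (m0 I) (me k) = me k by apply/ffunP => x; rewrite !ffunE.
by rewrite !e => <-.
Qed.

End SeriesComp.

(** * The weighted norm *)

Section PartialDegree.
Variables (R : realType) (I : finType) (Y : pred I).
Implicit Types (b : multi I) (f g : multi I -> R) (M : R).

Definition ydeg b : nat := (\sum_(i | Y i) b i)%N.

Lemma ydegD b b' : ydeg (madd b b') = (ydeg b + ydeg b')%N.
Proof. by rewrite /ydeg -big_split; apply: eq_bigr => i _; rewrite ffunE. Qed.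

Lemma ydeg_me j : ydeg (me j) = Y j.
Proof.
rewrite /ydeg; case Yj: (Y j).
  rewrite (bigD1 j)//= ffunE eqxx big1// => i /andP[_ ij].
  by rewrite ffunE (negPf ij).
rewrite big1// => i Yi; rewrite ffunE; case: eqP => // ij.
by rewrite ij Yj in Yi.
Qed.

Lemma ydeg_le b : (ydeg b <= mdeg b)%N.
Proof. by rewrite /mdeg (bigID Y)/= leq_addr. Qed.

Lemma ydeg_xle b i : ~~ Y i -> (b i <= mdeg b - ydeg b)%N.
Proof.
by move=> Yi; rewrite /mdeg (bigID Y)/= addKn (bigD1 i)//= leq_addr.
Qed.

Lemma ydeg0 : ydeg (m0 I) = 0%N.
Proof. by rewrite /ydeg big1// => i _; rewrite ffunE. Qed.

Lemma leq_ydeg b j : Y j -> (b j <= ydeg b)%N.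
Proof. by move=> Yj; rewrite /ydeg (bigD1 j)//= leq_addr. Qed.

Definition ybelow n := [pred b : multi I | (ydeg b < n)%N].

Lemma ybelow_down n a b : ybelow n a -> mle b a -> ybelow n b.
Proof.
move=> /= an /forallP ba; apply: leq_ltn_trans an; apply: leq_sum => i _.
exact: ba.
Qed.

(* Right inverse of the Euler operator in the Y-variables, applied to y_j g. *)
Definition Lop (j : I) g : multi I -> R :=
  fun b => if (0 < b j)%N then g (msub b (me j)) / (ydeg b)%:R else 0.

(** Multiplication by [y_j] raises the y-degree, so knowing [g] below degree [n] determines the
    result one degree further. This gain of one makes the iteration stabilise. *)
Lemma Lop_local n j g g' : Y j -> {in ybelow n, g =1 g'} ->
  {in ybelow n.+1, Lop j g =1 Lop j g'}.
Proof.
move=> Yj gg b /= bn; rewrite /Lop; case: ifP => // bj; rewrite gg// inE.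
have := congr1 ydeg (@msubK _ (me j) b _); rewrite mle_me bj => /(_ isT).
by rewrite ydegD ydeg_me Yj add1n => e; move: bn; rewrite inE -e ltnS.
Qed.

Lemma fD_local n i f f' : ~~ Y i -> {in ybelow n, f =1 f'} ->
  {in ybelow n, fD i f =1 fD i f'}.
Proof.
move=> Yi ff b bn; rewrite /fD ff// inE ydegD ydeg_me (negPf Yi) addn0.
by rewrite inE in bn.
Qed.

(* The factor 1 / 'C(|b|, ydeg b) compensates for the derivative in [D_i Lop_j]. *)
Definition ckw (rho eps : R) b : R :=
  rho ^+ mdeg b * eps ^+ ydeg b / 'C(mdeg b, ydeg b)%:R.

Section CKWeight.
Variables rho eps : R.
Hypotheses (rho0 : 0 < rho) (eps0 : 0 < eps).
Local Notation w := (ckw rho eps).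

Let binp b : 0 < 'C(mdeg b, ydeg b)%:R :> R.
Proof. by rewrite ltr0n bin_gt0 ydeg_le. Qed.

Let num0 b : 0 < rho ^+ mdeg b * eps ^+ ydeg b.
Proof. by rewrite mulr_gt0// exprn_gt0. Qed.

(** In Vandermonde's identity for ['C(|a| + |b|, ydeg a + ydeg b)], the product of the two smaller
    binomials is one of the summands. *)
Lemma weight_ckw : weight w.
Proof.
split=> [b||a b]; rewrite /ckw; first by rewrite divr_gt0.
  by rewrite mdeg0 ydeg0 !expr0 bin0 divr1 mulr1.
rewrite mulrACA -invfM mdegD ydegD !exprD [X in _ <= X / _]mulrACA.
rewrite ler_wpM2l//; first by have := mulr_gt0 (num0 a) (num0 b); rewrite mulrACA => /ltW.
rewrite lef_pV2 ?posrE; last 2 first.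
- by have := binp (madd a b); rewrite mdegD ydegD.
- exact: mulr_gt0.
rewrite -natrM ler_nat -binomial.Vandermonde.
have h : (ydeg a < (ydeg a + ydeg b).+1)%N by rewrite ltnS leq_addr.
by rewrite (bigD1 (Ordinal h))//= addKn leq_addr.
Qed.

(** From [b'] to [b = b' + me j] the weight is multiplied by [rho eps 'C(n, p) / 'C(n + 1, p + 1) =
    rho eps (p + 1) / (n + 1)], with [n = mdeg b'] and [p = ydeg b']. Division by the y-degree
    [p + 1] leaves [rho eps / (n + 1)]. *)
Lemma nbd_Lop g M j : Y j -> nbd w g M -> nbd w (Lop j g) (rho * eps * M).
Proof.
move=> Yj gM.
have := sboundedZ (rho * eps) (sbounded_sub (P := fun b : multi I => (0 < b j)%N)
  (phi := fun b => madd (me j) b) (psi := fun b => msub b (me j)) _ gM).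
rewrite (gtr0_norm (mulr_gt0 rho0 eps0)) => H; apply: sbounded_le (H _); last first.
  by move=> b bj; rewrite msubK ?mle_me.
move=> b /=; rewrite /Lop; case: ifP => bj; last by rewrite mul0r mulr0.
have e := @msubK _ (me j) b _; rewrite mle_me bj in e; move: (e isT) => {}e.
set b' := msub b (me j) in e *.
have ed : mdeg b = (mdeg b').+1 by rewrite -e mdegD mdeg_me.
have ey : ydeg b = (ydeg b').+1 by rewrite -e ydegD ydeg_me Yj.
rewrite mulrAC -mulrA [X in _ <= `|X|]mulrCA !(normrM (g b')) ler_wpM2l//.
have wp c : 0 <= w c by apply/ltW/(weight_gt0 weight_ckw).
have h1 : 0 <= w b / (ydeg b)%:R by rewrite divr_ge0.
have h2 : 0 <= rho * eps * w b' by apply: mulr_ge0 => //; apply: mulr_ge0; apply: ltW.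
rewrite (ger0_norm h1) (ger0_norm h2).
rewrite /ckw ed ey !exprS.
have -> : rho * eps * (rho ^+ mdeg b' * eps ^+ ydeg b' / 'C(mdeg b', ydeg b')%:R) =
  rho * rho ^+ mdeg b' * (eps * eps ^+ ydeg b') / 'C(mdeg b', ydeg b')%:R by ring.
rewrite -[leLHS]mulrA ler_wpM2l//.
  by rewrite !mulr_ge0 ?exprn_ge0 ?(ltW rho0) ?(ltW eps0).
rewrite -invfM lef_pV2 ?posrE ?binp//; last first.
  by rewrite mulr_gt0// ltr0n bin_gt0 ltnS ydeg_le.
rewrite -natrM ler_nat mulnC -mul_bin_diag /=.
by rewrite leq_pmull.
Qed.

(** The coefficient at [b] comes from [a = b - me j + me i], of the same total degree [n], with
    factor [(b i + 1) / (p + 1)] where [p = ydeg a]. The weights contribute [eps 'C(n, p) / 'C(n, p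
    + 1) = eps (p + 1) / (n - p)], and [b i + 1 = a i] is at most the free degree [n - p] of [a]. *)
Lemma nbd_DLop g M i j : Y j -> ~~ Y i -> nbd w g M -> nbd w (fD i (Lop j g)) (eps * M).
Proof.
move=> Yj Yi gM.
have ij : (j == i) = false by apply/negP => /eqP ji; rewrite ji (negPf Yi) in Yj.
have := sboundedZ eps (sbounded_sub (P := fun b : multi I => (0 < b j)%N)
  (phi := fun a => madd (me j) (msub a (me i)))
  (psi := fun b => madd (msub b (me j)) (me i)) _ gM).
rewrite (gtr0_norm eps0) => H; apply: sbounded_le (H _); last first.
  by move=> b bj; rewrite maddKr msubK ?mle_me.
move=> b /=; rewrite /fD /Lop !ffunE ij addn0; case: ifP => bj; last by rewrite mulr0 mul0r mulr0.
have e := @msubK _ (me j) b _; rewrite mle_me bj in e; move: (e isT) => {}e.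
have -> : msub (madd b (me i)) (me j) = madd (msub b (me j)) (me i).
  apply/ffunP => x; rewrite !ffunE; have [->|] := eqVneq x j; rewrite ?ij ?subn0 ?addn0//.
set b' := msub b (me j) in e *; set a := madd b' (me i).
have ea : mdeg a = mdeg b by rewrite /a -e !mdegD !mdeg_me addnC.
have ey : ydeg (madd b (me i)) = (ydeg a).+1.
  by rewrite /a -e !ydegD !ydeg_me Yj (negPf Yi) !addn0 add1n.
have eb : ydeg b = (ydeg a).+1 by rewrite -ey ydegD ydeg_me (negPf Yi) addn0.
have ai : a i = (b i).+1.
  by rewrite /a -e !ffunE eqxx (eq_sym i j) ij !addn1.
rewrite ey [X in _ <= `|X|]mulrCA.
have -> : (b i).+1%:R * (g a / (ydeg a).+1%:R) * w b =
  g a * ((b i).+1%:R / (ydeg a).+1%:R * w b) by ring.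
rewrite !(normrM (g a)) ler_wpM2l//.
have wp c : 0 < w c by apply: weight_gt0 weight_ckw c.
have h1 : 0 <= (b i).+1%:R / (ydeg a).+1%:R * w b.
  by apply: mulr_ge0; [rewrite divr_ge0|exact: ltW].
have h2 : 0 <= eps * w a by apply: mulr_ge0; apply: ltW.
rewrite (ger0_norm h1) (ger0_norm h2).
rewrite /ckw eb ea exprS.
have -> : eps * (rho ^+ mdeg b * eps ^+ ydeg a / 'C(mdeg b, ydeg a)%:R) =
  rho ^+ mdeg b * (eps * eps ^+ ydeg a) * 'C(mdeg b, ydeg a)%:R^-1 by ring.
have -> : (b i).+1%:R / (ydeg a).+1%:R *
    (rho ^+ mdeg b * (eps * eps ^+ ydeg a) / 'C(mdeg b, (ydeg a).+1)%:R) =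
  rho ^+ mdeg b * (eps * eps ^+ ydeg a) *
    ((b i).+1%:R / ((ydeg a).+1%:R * 'C(mdeg b, (ydeg a).+1)%:R)).
  by rewrite invfM; ring.
rewrite ler_wpM2l ?mulr_ge0 ?exprn_ge0 ?(ltW rho0) ?(ltW eps0)//.
rewrite -natrM mul_bin_left.
have ba : (0 < 'C(mdeg b, ydeg a))%N by rewrite bin_gt0 -ea ydeg_le.
have la : ((b i).+1 <= mdeg b - ydeg a)%N by rewrite -ai -ea ydeg_xle.
rewrite natrM invfM mulrA -[leRHS]mul1r ler_wpM2r ?invr_ge0 ?ler0n//.
rewrite ler_pdivrMr ?mul1r ?ler_nat// ltr0n.
exact: leq_trans la.
Qed.

Lemma bin_le_exp2 n p : ('C(n, p) <= 2 ^ n)%N.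
Proof.
elim: n p => [|n IH] [|p]; rewrite ?bin0 ?expn_gt0// binS expnS mul2n -addnn.
exact: leq_add.
Qed.

Hypothesis eps1 : eps <= 1.

(** A bound in the weighted norm gives genuine convergence at radius [rho eps / 2], because
    [eps^(ydeg b) >= eps^|b|] and the binomial is at most [2^|b|]. *)
Lemma nbd_ckw_pw f M : nbd w f M -> nbd (pw (rho * eps / 2)) f M.
Proof.
apply: sbounded_le => b; rewrite !(normrM (f b)) ler_wpM2l//.
have wp : 0 < w b by apply: weight_gt0 weight_ckw b.
rewrite (gtr0_norm wp) /pw ger0_norm ?exprn_ge0 ?divr_ge0 ?mulr_ge0 ?(ltW rho0) ?(ltW eps0)//.
rewrite /ckw expr_div_n exprMn; apply: ler_pM.
- by rewrite mulr_ge0 ?exprn_ge0// ltW.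
- by rewrite invr_ge0 exprn_ge0.
- rewrite ler_wpM2l ?exprn_ge0 ?(ltW rho0)//.
  by apply: ler_wiXn2l => //; [exact: ltW|exact: ydeg_le].
- rewrite lef_pV2 ?posrE ?exprn_gt0// -natrX ler_nat.
  exact: bin_le_exp2.
Qed.

Lemma nbd_pw_ckw f M : nbd (pw rho) f M -> nbd w f M.
Proof.
apply: sbounded_le => b; rewrite !(normrM (f b)) ler_wpM2l//.
have wp : 0 < w b by apply: weight_gt0 weight_ckw b.
rewrite (gtr0_norm wp) /pw ger0_norm ?exprn_ge0 ?(ltW rho0)//.
rewrite /ckw -mulrA -[leRHS]mulr1 ler_wpM2l ?exprn_ge0 ?(ltW rho0)//.
rewrite ler_pdivrMr// mul1r (@le_trans _ _ 1)//; first by rewrite exprn_ile1 ?(ltW eps0).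
by rewrite ler1n bin_gt0 ydeg_le.
Qed.

End CKWeight.
End PartialDegree.

(** * The radial equation solved by formal iteration *)

Section FormalCauchyKovalevskaya.
Variables (R : realType) (k l m : nat).
Local Notation I := 'I_(k + l).
Local Notation xf := (@xfree k l).
Local Notation xd := (@xdep k l).

Definition isdep : pred I := fun i => (k <= i)%N.

Lemma isdep_xdep b : isdep (xd b).
Proof. by rewrite /isdep /= leq_addr. Qed.

Lemma isdep_xfree G : ~~ isdep (xf G).
Proof. by rewrite /isdep /= -ltnNge. Qed.

Local Notation low n := (ybelow isdep n).

(** Increment of the jet of [us] from the base point [(x0, p, p')], the inner series to be
    substituted in the expansion of [F] there; hence bare variables for [x] and subtracted constants
    for [p], [p']. *)
Definition jetser (us : 'I_m -> multi I -> R) (p : 'I_m -> R) (p' : 'I_m -> 'I_k -> R)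
    (c : jcoord k l m) : multi I -> R :=
  match c with
  | inl i => fX R i
  | inr (inl A) => fsub (us A) (p A)
  | inr (inr (A, G)) => fsub (fD (xf G) (us A)) (p' A G)
  end.

Lemma jetser_local n us us' p p' c : (forall A, {in low n, us A =1 us' A}) ->
  {in low n, jetser us p p' c =1 jetser us' p p' c}.
Proof.
move=> uu; case: c => [i|[A|[A G]]] b bn //=; rewrite /fsub ?uu//.
by rewrite (fD_local (isdep_xfree G) (uu A)).
Qed.

Definition useries (ca : 'I_m -> multi I -> R) (g : 'I_m -> 'I_l -> multi I -> R)
    (A : 'I_m) : multi I -> R :=
  fun c => ca A c + \sum_(b < l) Lop isdep (xd b) (g A b) c.

Lemma useries_local n ca g g' A : (forall B b, {in low n, g B b =1 g' B b}) ->
  {in low n.+1, useries ca g A =1 useries ca g' A}.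
Proof.
move=> gg c cn; rewrite /useries; congr (_ + _); apply: eq_bigr => b _.
exact: (Lop_local (isdep_xdep b) (gg A b)).
Qed.

Section FixedPoint.
Variables (p : 'I_m -> R) (p' : 'I_m -> 'I_k -> R) (ca : 'I_m -> multi I -> R).
Variable CF : 'I_m -> 'I_l -> multi (jcoord k l m) -> R.
Variables (w : multi I -> R) (q M : R).
Hypothesis wP : weight w.
Hypothesis CM : forall A b, nbd (pw q) (CF A b) M.
(** Right-hand sides of norm at most [M] produce jets inside the polydisc of radius [q], on which
    the series of [F] has norm at most [M]: the [M]-ball is mapped to itself. *)
Hypothesis ball : forall g, (forall A b, nbd w (g A b) M) ->
  forall c, nbd w (jetser (useries ca g) p p' c) q.
Hypothesis M0 : 0 <= M.

Definition ckstep (g : 'I_m -> 'I_l -> multi I -> R) A b : multi I -> R :=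
  fcomp (CF A b) (jetser (useries ca g) p p').

Definition ckiter n := iter n ckstep (fun _ _ _ => 0).

Lemma ckstep_local n g g' : (forall A b, {in low n, g A b =1 g' A b}) ->
  forall A b, {in low n.+1, ckstep g A b =1 ckstep g' A b}.
Proof.
move=> gg A b; apply: fcomp_local; first exact: ybelow_down.
by move=> c; apply: jetser_local => B; apply: useries_local.
Qed.

Lemma ckiter_stable n A b : {in low n, ckiter n A b =1 ckiter n.+1 A b}.
Proof.
elim: n A b => [|n IH] A b; first by move=> c; rewrite inE.
exact: ckstep_local.
Qed.

Lemma ckiter_stable_le n n' A b : (n <= n')%N -> {in low n, ckiter n A b =1 ckiter n' A b}.
Proof.
move=> /subnKC <-; elim: (n' - n)%N => [|d IH] c cn; first by rewrite addn0.
rewrite IH// addnS ckiter_stable// inE; rewrite inE in cn.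
by rewrite (leq_trans cn)// leq_addr.
Qed.

(** Coefficients of y-degree [d] are final from iterate [d + 1] on. *)
Definition cklim A b : multi I -> R := fun c => ckiter (ydeg isdep c).+1 A b c.

Lemma cklim_low n A b : {in low n, cklim A b =1 ckiter n A b}.
Proof.
by move=> c; rewrite inE => cn; rewrite /cklim (ckiter_stable_le A b cn)// inE ltnSn.
Qed.

Lemma nbd_ckiter n A b : nbd w (ckiter n A b) M.
Proof.
elim: n A b => [|n IH] A b; last exact: (nbd_fcomp wP (CM A b) (ball IH)).
by move=> s _; rewrite big1// => i _; rewrite mul0r normr0.
Qed.

(** A finite partial sum meets finitely many y-degrees, so a single iterate computes it. *)
Lemma nbd_cklim A b : nbd w (cklim A b) M.
Proof.
move=> s us; pose n := (\max_(c <- s) ydeg isdep c).+1.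
apply: le_trans (nbd_ckiter n A b us).
rewrite le_eqVlt big_seq [X in _ == X]big_seq; apply/orP; left; apply/eqP.
apply: eq_bigr => c cs; rewrite (@cklim_low n)// inE ltnS.
exact: (@leq_bigmax_seq _ _ xpredT).
Qed.

Lemma cklim_fixed A b : cklim A b = ckstep cklim A b.
Proof.
apply/funext => c; rewrite /cklim.
rewrite (_ : ckiter _ A b c = ckstep (ckiter (ydeg isdep c)) A b c)//.
have cc : c \in low (ydeg isdep c).+1 by rewrite inE ltnSn.
rewrite (@ckstep_local (ydeg isdep c) (ckiter (ydeg isdep c)) cklim)// => B b' c' c'n.
by rewrite (@cklim_low _ B b' c' c'n).
Qed.

End FixedPoint.

Lemma fD_add i (f g : multi I -> R) : fD i (fun c => f c + g c) = fun c => fD i f c + fD i g c.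
Proof. by apply/funext => c; rewrite /fD mulrDr. Qed.

Lemma fD_sum (K : finType) i (f : K -> multi I -> R) :
  fD i (fun c => \sum_j f j c) = fun c => \sum_j fD i (f j) c.
Proof. by apply/funext => c; rewrite /fD mulr_sumr. Qed.

Lemma formal_solution (x0 : I -> R) (f : 'I_m -> (I -> R) -> R) ca (r q M : R)
    (CF : 'I_m -> 'I_l -> multi (jcoord k l m) -> R) :
  0 < q -> 0 <= M -> (forall A b, nbd (pw q) (CF A b) M) ->
  (forall A, has_series (f A) x0 (ca A) r) -> 0 < r ->
  exists g, exists2 r', 0 < r' &
    (forall A b, exists N, nbd (pw r') (Lop isdep (xd b) (g A b)) N) /\
    forall A b, g A b = fcomp (CF A b) (jetser (useries ca g) (fun A => f A x0)
                                        (fun A G => partial (f A) (xf G) x0)).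
Proof.
move=> q0 M0 CM fs r0.
have q2 : 0 < q / 2 by rewrite divr_gt0.
have [r1 r10 H1] := fin_small (fun A => has_series_small (fs A) q2).
have fs' A G : has_series (partial (f A) (xf G)) x0 (fD (xf G) (ca A)) (r / 2).
  by apply: has_series_partial (fs A) _ _; lra.
have [r2 r20 H2] := fin_small (fun AG : 'I_m * 'I_k => has_series_small (fs' AG.1 AG.2) q2).
(* At radius [rho] the datum and its free derivatives, minus their values at [x0], use at most half
   of the allowance [q]; [rho <= q] takes care of the variables [x] themselves. *)
pose rho := Num.min q (Num.min r1 r2).
have rho0 : 0 < rho by rewrite !lt_min q0 r10.
have rhoq : rho <= q by rewrite ge_min lexx.
have rho1 : rho <= r1 by rewrite !ge_min lexx !orbT.
have rho2 : rho <= r2 by rewrite !ge_min lexx !orbT.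
(* [L] dominates both [l rho M] and [l M]; after multiplication by [eps] the sums of the [L_b g_b]
   and of their free derivatives fit into the other half of [q]. *)
pose L := l%:R * M * (rho + 1).
have L0 : 0 <= L by rewrite !mulr_ge0// addr_ge0// ltW.
pose eps := Num.min 1 (q / 2 / (L + 1)).
have eps0 : 0 < eps by rewrite lt_min ltr01 divr_gt0//; lra.
have eps1 : eps <= 1 by rewrite ge_min lexx.
have epsL : eps * L <= q / 2.
  have : eps <= q / 2 / (L + 1) by rewrite ge_min lexx orbT.
  by rewrite ler_pdivlMr; nra.
pose w := @ckw R I isdep rho eps.
have wP : weight w by apply: weight_ckw.
have lM : 0 <= l%:R * M by rewrite mulr_ge0.
have eL : l%:R * (rho * eps * M) <= q / 2.
  by apply: le_trans epsL; rewrite /L; nra.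
have eL' : l%:R * (eps * M) <= q / 2.
  have := mulr_ge0 (mulr_ge0 (ltW eps0) lM) (ltW rho0).
  by move=> h; apply: le_trans epsL; rewrite /L; nra.
pose p A := f A x0; pose p' A G := partial (f A) (xf G) x0.
have ball g : (forall A b, nbd w (g A b) M) -> forall c, nbd w (jetser (useries ca g) p p' c) q.
  move=> gM [i|[A|[A G]]] /=.
  - apply: nbdW (nbd_fX wP i); apply: le_trans rhoq.
    have := nbd_pw_ckw isdep rho0 eps0 eps1 (nbd_fX (weight_pw I rho0) i).
    move=> /(nbd_coef wP (me i)); rewrite /pw mdeg_me expr1 ler_pdivlMr ?(weight_gt0 wP)//.
    by rewrite /fX eqxx normr1 mul1r.
  - have [_ _ h1] := H1 rho rho0 rho1 A.
    have h2 : nbd w (fun c => \sum_(b < l) Lop isdep (xd b) (g A b) c)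
        (#|'I_l|%:R * (rho * eps * M)).
      by apply: nbd_sum => b; apply: nbd_Lop => //; apply: isdep_xdep.
    rewrite card_ord in h2.
    have := nbdD (nbd_pw_ckw isdep rho0 eps0 eps1 h1) h2.
    move=> /(@nbdW _ _ _ _ _ q) H; have -> : fsub (useries ca g A) (p A) =
      fun c => fsub (ca A) (f A x0) c + \sum_(b < l) Lop isdep (xd b) (g A b) c.
      by apply/funext => c; rewrite /fsub /useries /p addrAC.
    apply: H; lra.
  - have [_ _ h1] := H2 rho rho0 rho2 (A, G).
    have h2 : nbd w (fun c => \sum_(b < l) fD (xf G) (Lop isdep (xd b) (g A b)) c)
        (#|'I_l|%:R * (eps * M)).
      by apply: nbd_sum => b; apply: nbd_DLop => //; [exact: isdep_xdep|exact: isdep_xfree].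
    rewrite card_ord in h2.
    have := nbdD (nbd_pw_ckw isdep rho0 eps0 eps1 h1) h2.
    move=> /(@nbdW _ _ _ _ _ q) H; have -> : fsub (fD (xf G) (useries ca g A)) (p' A G) =
      fun c => fsub (fD (xf G) (ca A)) (partial (f A) (xf G) x0) c +
               \sum_(b < l) fD (xf G) (Lop isdep (xd b) (g A b)) c.
      by apply/funext => c; rewrite /fsub /useries /p' fD_add fD_sum addrAC.
    apply: H; rewrite /=; lra.
exists (cklim p p' ca CF), (rho * eps / 2); first by rewrite divr_gt0// mulr_gt0.
split=> A b; last exact: cklim_fixed.
exists (rho * eps * M); apply: (nbd_ckw_pw rho0 eps0 eps1).
by apply: nbd_Lop => //; [exact: isdep_xdep|exact: nbd_cklim wP CM ball M0 A b].
Qed.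

End FormalCauchyKovalevskaya.

(** * Derivatives along jets *)

Section JetChain.
Variables (R : realType) (k l m : nat).
Local Notation I := 'I_(k + l).
Local Notation xf := (@xfree k l).
Local Notation xd := (@xdep k l).
Local Notation J := (jcoord k l m).
Implicit Types (u : 'I_m -> (I -> R) -> R) (x : I -> R).

Lemma quad_coord x i : quad (fun z : I -> R => z i) x (fun i' => (i' == i)%:R).
Proof.
exists 1 => // z _; rewrite (bigD1 i)//= eqxx mulr1n mul1r big1 ?addr0; last first.
  by move=> j /negPf ->; rewrite mul0r.
by rewrite mul1r subrr normr0 exprn_ge0// dist1_ge0.
Qed.

Definition djet u x (c : J) (i : I) : R :=
  match c with
  | inl i' => (i == i')%:R
  | inr (inl A) => partial (u A) i x
  | inr (inr (A, G)) => partial (partial (u A) (xf G)) i x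
  end.

Lemma analytic_jet u x (c : J) : (forall A, analytic_at (u A) x) ->
  analytic_at (fun z => jet_of u z c) x.
Proof.
move=> ua; case: c => [i|[A|[A G]]] /=; [|exact: ua|exact: analytic_partial].
apply: (@has_series_analytic _ _ _ _ (fun b => fcst (x i - 0) b + fX R i b) 1).
have := has_series_coord i 0 x (@ltr01 R).
by apply: has_series_ext => z _; rewrite subr0.
Qed.

Lemma quad_jet u x (c : J) : (forall A, analytic_at (u A) x) ->
  quad (fun z => jet_of u z c) x (djet u x c).
Proof.
move=> ua; case: c => [i|[A|[A G]]] /=.
- exact: quad_coord.
- exact: analytic_quad.
- exact/analytic_quad/analytic_partial.
Qed.

Lemma quad_F_jet (F0 : (J -> R) -> R) u x : analytic_at F0 (jet_of u x) ->
  (forall A, analytic_at (u A) x) ->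
  quad (fun z => F0 (jet_of u z)) x
    (fun i => \sum_c partial F0 c (jet_of u x) * djet u x c i).
Proof.
move=> Fa ua; exact: (@quad_comp _ _ _ F0 (fun c z => jet_of u z c) x _ _
  (analytic_quad Fa) (fun c => quad_jet c ua)).
Qed.

Lemma analytic_F_jet (F0 : (J -> R) -> R) u x : analytic_at F0 (jet_of u x) ->
  (forall A, analytic_at (u A) x) -> analytic_at (fun z => F0 (jet_of u z)) x.
Proof.
move=> Fa ua; exact: (@analytic_at_comp _ _ _ F0 (fun c z => jet_of u z c) x Fa
  (fun c => analytic_jet c ua)).
Qed.

Lemma sum_jcoord (f : J -> R) : \sum_c f c =
  \sum_i f (cX m i) + \sum_B f (cP k l B) + \sum_G \sum_B f (cP' l B G).
Proof.
rewrite big_sumType big_sumType/= addrA; congr (_ + _).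
rewrite exchange_big pair_big/=; apply: eq_bigr => -[B G] _ //.
Qed.

Lemma partial_F_jet (F0 : (J -> R) -> R) u x i : analytic_at F0 (jet_of u x) ->
  (forall A, analytic_at (u A) x) ->
  partial (fun z => F0 (jet_of u z)) i x =
  partial F0 (cX m i) (jet_of u x)
  + \sum_B partial F0 (cP k l B) (jet_of u x) * partial (u B) i x
  + \sum_G \sum_B partial F0 (cP' l B G) (jet_of u x) *
      partial (partial (u B) (xf G)) i x.
Proof.
move=> Fa ua; rewrite (quad_partial i (quad_F_jet Fa ua)) sum_jcoord /=.
congr (_ + _ + _); rewrite (bigD1 i)//= eqxx mulr1 big1 ?addr0// => j ji.
by rewrite eq_sym (negPf ji) mulr0.
Qed.

Variable F : 'I_m -> 'I_l -> (J -> R) -> R.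

Definition residual u A b x : R := partial (u A) (xd b) x - F A b (jet_of u x).

Definition second u x (C : 'I_m) (G L : 'I_k) : R :=
  partial (partial (u C) (xf L)) (xf G) x.

(** The part of [d_c d_b u] that is linear in the free second derivatives [s] of [u]. *)
Definition Qform (A : 'I_m) (b c : 'I_l) (z : J -> R) (s : 'I_m -> 'I_k -> 'I_k -> R) : R :=
  \sum_(G < k) \sum_(B < m) partial (F A b) (cP' l B G) z *
    \sum_(L < k) \sum_(C < m) partial (F B c) (cP' l C L) z * s C G L.

Lemma partial_residual u x A b i : (forall B, analytic_at (u B) x) ->
  analytic_at (F A b) (jet_of u x) ->
  partial (residual u A b) i x = partial (partial (u A) (xd b)) i x -
    partial (fun z => F A b (jet_of u z)) i x.
Proof.
move=> ua Fa; apply: (quad_partial (d := fun i => partial (partial (u A) (xd b)) i x -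
    partial (fun z => F A b (jet_of u z)) i x)).
by apply: quadB; apply: analytic_quad; [exact: analytic_partial|exact: analytic_F_jet].
Qed.

Lemma sum2_split (p q : nat) (a x y v : 'I_p -> 'I_q -> R) :
  \sum_i \sum_j a i j * (x i j + y i j + v i j) =
  \sum_i \sum_j a i j * x i j + \sum_i \sum_j a i j * y i j + \sum_i \sum_j a i j * v i j.
Proof.
rewrite -!big_split; apply: eq_bigr => i _; rewrite -!big_split; apply: eq_bigr => j _ /=.
by rewrite !mulrDr.
Qed.

(** An identity for any analytic [u]: each [d_c u] met in the chain rule, differentiated or not, is
    written as [F] plus residual. In the necessity part all residual terms vanish at [x0]; in the
    sufficiency part the antisymmetrised identity gives the curl of the residual. *)
Lemma mixed_partial_residual u x A b c : (forall B, analytic_at (u B) x) ->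
  (forall B d, analytic_at (F B d) (jet_of u x)) ->
  partial (partial (u A) (xd b)) (xd c) x =
    partial (residual u A b) (xd c) x
    + Phi F A b c (jet_of u x) + Qform A b c (jet_of u x) (second u x)
    + \sum_B partial (F A b) (cP k l B) (jet_of u x) * residual u B c x
    + \sum_G \sum_B partial (F A b) (cP' l B G) (jet_of u x) *
        partial (residual u B c) (xf G) x.
Proof.
move=> ua Fa.
rewrite partial_residual// partial_F_jet//.
have h1 B : partial (u B) (xd c) x = F B c (jet_of u x) + residual u B c x.
  by rewrite /residual addrC subrK.
have h2 B G : partial (partial (u B) (xf G)) (xd c) x =
    partial (F B c) (cX m (xf G)) (jet_of u x)
    + \sum_(C < m) partial (F B c) (cP k l C) (jet_of u x) * jet_of u x (cP' l C G)
    + \sum_(L < k) \sum_(C < m) partial (F B c) (cP' l C L) (jet_of u x) * second u x C G L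
    + partial (residual u B c) (xf G) x.
  (* The dependent derivative is moved inside, so that the relation for [d_c u_B] can be
     differentiated in a free direction. *)
  rewrite partialC// partial_residual// partial_F_jet//.
  by rewrite addrC subrK.
have -> : \sum_B partial (F A b) (cP k l B) (jet_of u x) * partial (u B) (xd c) x =
  \sum_B partial (F A b) (cP k l B) (jet_of u x) * F B c (jet_of u x) +
  \sum_B partial (F A b) (cP k l B) (jet_of u x) * residual u B c x.
  by rewrite -big_split; apply: eq_bigr => B _; rewrite h1 mulrDr.
have -> : \sum_G \sum_B partial (F A b) (cP' l B G) (jet_of u x) *
    partial (partial (u B) (xf G)) (xd c) x =
  \sum_G \sum_B partial (F A b) (cP' l B G) (jet_of u x) *
    (partial (F B c) (cX m (xf G)) (jet_of u x)
    + \sum_(C < m) partial (F B c) (cP k l C) (jet_of u x) * jet_of u x (cP' l C G)) +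
  Qform A b c (jet_of u x) (second u x) +
  \sum_G \sum_B partial (F A b) (cP' l B G) (jet_of u x) * partial (residual u B c) (xf G) x.
  rewrite /Qform -sum2_split; apply: eq_bigr => G _; apply: eq_bigr => B _.
  by rewrite h2.
rewrite /Phi; ring.
Qed.

Section Quadratic.
Variables (z : J -> R).

Definition QQ A b c C G L : R :=
  \sum_(B < m) partial (F A b) (cP' l B G) z * partial (F B c) (cP' l C L) z.

Lemma Psi_QQ A G L b c C : Psi F A G L b c C z = QQ A b c C G L + QQ A b c C L G.
Proof. by rewrite /Psi /QQ -big_split. Qed.

Lemma QformE A b c s : Qform A b c z s =
  \sum_(G < k) \sum_(L < k) \sum_(C < m) s C G L * QQ A b c C G L.
Proof.
apply: eq_bigr => G _.
under eq_bigr do rewrite mulr_sumr.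
rewrite exchange_big; apply: eq_bigr => L _.
under eq_bigr do rewrite mulr_sumr.
rewrite exchange_big; apply: eq_bigr => C _.
rewrite /QQ mulr_sumr; apply: eq_bigr => B _; ring.
Qed.

(** Against a symmetric [s] only the symmetrisation of [QQ] in [G] and [L] counts, and this is
    [Psi], up to the factor 2. *)
Lemma Qform_sym A b c s : (forall C G L, s C G L = s C L G) ->
  (forall C G L, Psi F A G L b c C z = Psi F A G L c b C z) ->
  Qform A b c z s = Qform A c b z s.
Proof.
move=> ss PP.
have H e d : 2 * Qform A e d z s =
    \sum_(G < k) \sum_(L < k) \sum_(C < m) s C G L * Psi F A G L e d C z.
  rewrite mulr_natl mulr2n {1}QformE QformE [X in _ + X]exchange_big -big_split.
  apply: eq_bigr => G _; rewrite -big_split; apply: eq_bigr => L _.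
  rewrite -big_split; apply: eq_bigr => C _ /=.
  by rewrite Psi_QQ (ss C L G) mulrDr.
have : 2 * Qform A b c z s = 2 * Qform A c b z s.
  rewrite !H; apply: eq_bigr => G _; apply: eq_bigr => L _; apply: eq_bigr => C _.
  by rewrite PP.
lra.
Qed.

Lemma Qform0 A b c : Qform A b c z (fun _ _ _ => 0) = 0.
Proof.
rewrite QformE big1// => G _; rewrite big1// => L _; rewrite big1// => C _.
by rewrite mul0r.
Qed.

(** [s] is the elementary symmetric tensor. For [G0 = L0] its only nonzero entry is 2, in agreement
    with the two equal terms of [Psi]. *)
Lemma Qform_delta A b c C0 G0 L0 :
  Qform A b c z (fun C G L => (C == C0)%:R *
     ((G == G0)%:R * (L == L0)%:R + (G == L0)%:R * (L == G0)%:R)) =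
  Psi F A G0 L0 b c C0 z.
Proof.
have H G1 L1 : \sum_(G < k) \sum_(L < k) \sum_(C < m)
    ((C == C0)%:R * ((G == G1)%:R * (L == L1)%:R)) * QQ A b c C G L = QQ A b c C0 G1 L1.
  rewrite (bigD1 G1)//= [X in _ + X]big1 ?addr0; last first.
    move=> G /negPf G1'; rewrite big1// => L _; rewrite big1// => C _.
    by rewrite G1' mul0r mulr0 mul0r.
  rewrite (bigD1 L1)//= [X in _ + X]big1 ?addr0; last first.
    move=> L /negPf L1'; rewrite big1// => C _.
    by rewrite L1' !mulr0 mul0r.
  rewrite (bigD1 C0)//= [X in _ + X]big1 ?addr0; last first.
    by move=> C /negPf ->; rewrite !mul0r.
  by rewrite !eqxx !mul1r.
rewrite QformE Psi_QQ -(H G0 L0) -(H L0 G0) -big_split.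
apply: eq_bigr => G _; rewrite -big_split; apply: eq_bigr => L _.
by rewrite -big_split; apply: eq_bigr => C _ /=; rewrite -mulrDl -mulrDr.
Qed.

End Quadratic.
End JetChain.

(** * Necessity of the compatibility conditions *)

Section Lines.
Variable R : realType.

Lemma eq0_of_linear_bound (y K r : R) : 0 < r ->
  (forall t, 0 < t -> t <= r -> `|y| <= K * t) -> y = 0.
Proof.
move=> r0 H; apply/eqP; rewrite -normr_le0; apply/ler_addgt0Pl => e e0; rewrite addr0.
have K0 : 0 < `|K| + 1 by rewrite ltr_wpDl.
have t0 : 0 < Num.min r (e / (`|K| + 1)) by rewrite lt_min r0 divr_gt0.
apply: le_trans (H _ t0 _) _; first by rewrite ge_min lexx.
apply: (@le_trans _ _ (`|K| * Num.min r (e / (`|K| + 1)))).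
  by rewrite ler_wpM2r ?(ltW t0)// ler_norm.
apply: (@le_trans _ _ (`|K| * (e / (`|K| + 1)))).
  by rewrite ler_wpM2l// ge_min lexx orbT.
rewrite mulrA ler_pdivrMr//; have := normr_ge0 K; nra.
Qed.

Lemma eq0_of_cubic_bound (x y w K r : R) : 0 < r ->
  (forall t, `|t| <= r -> `|x + y * t + w * t ^+ 2| <= K * `|t| ^+ 3) ->
  [/\ x = 0, y = 0 & w = 0].
Proof.
move=> r0 H.
have x0 : x = 0.
  apply/eqP; rewrite -normr_le0; have := H 0.
  by rewrite normr0 !expr0n /= !mulr0 !addr0; apply; apply: ltW.
have y0 : y = 0.
  apply: (@eq0_of_linear_bound _ (`|w| + `|K| * r) r r0) => t t0 tr.
  have := H t; rewrite x0 add0r (gtr0_norm t0) => /(_ tr) h.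
  have h1 : `|y * t| <= `|w| * t ^+ 2 + K * t ^+ 3.
    have -> : y * t = (y * t + w * t ^+ 2) - w * t ^+ 2 by ring.
    apply: le_trans (ler_normB _ _) _; rewrite addrC lerD// normrM.
    by rewrite [X in _ * X]ger0_norm// exprn_ge0// ltW.
  have h2 : K * t ^+ 3 <= `|K| * r * t ^+ 2.
    rewrite exprS mulrA ler_wpM2r ?exprn_ge0 ?(ltW t0)//.
    apply: (@le_trans _ _ (`|K| * t)); first by rewrite ler_wpM2r ?(ltW t0)// ler_norm.
    by rewrite ler_wpM2l.
  rewrite -(ler_pM2r t0) -mulrA -expr2 mulrDl -{1}(gtr0_norm t0) -normrM.
  by apply: le_trans h1 _; rewrite lerD2l.
split=> //; apply: (@eq0_of_linear_bound _ K r r0) => t t0 tr.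
have := H t; rewrite x0 y0 mul0r !add0r (gtr0_norm t0) => /(_ tr).
rewrite normrM [X in _ * X]ger0_norm ?exprn_ge0 ?(ltW t0)// => h.
by rewrite -(ler_pM2r (exprn_gt0 2 t0)) -mulrA -exprS.
Qed.

Lemma sum_unit (f : unit -> R) : \sum_j f j = f tt.
Proof. by rewrite (bigD1 tt)//= big1 ?addr0// => -[]. Qed.

Lemma dist1_unit (s t : R) : dist1 (fun _ : unit => s) (fun=> t) = `|s - t|.
Proof. by rewrite /dist1 sum_unit. Qed.

Lemma mdeg_unit (b : multi unit) : mdeg b = b tt.
Proof. by rewrite /mdeg (bigD1 tt)//= big1 ?addn0// => -[]. Qed.

(** Functions of one variable are taken on [unit -> R], so that the results on series apply. The
    given polynomial and the second Taylor polynomial differ by a cubic error on an interval, hence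
    coincide. *)
Lemma partials_of_cubic (phi : (unit -> R) -> R) (x y w K r : R) :
  analytic_at phi (fun=> 0) -> 0 < r ->
  (forall t, `|t| <= r -> `|phi (fun=> t) - (x + y * t + w * t ^+ 2)| <= K * `|t| ^+ 3) ->
  partial phi tt (fun=> 0) = y /\ partial (partial phi tt) tt (fun=> 0) = 2 * w.
Proof.
move=> /analytic_has_series[c [q fs]] r0 H; have [q0 _ _] := fs.
pose e := @me unit tt; pose e2 := madd e e.
have dd : (mdeg e = 1) /\ (mdeg e2 = 2) by rewrite mdegD mdeg_me.
have us : uniq [:: m0 unit; e; e2].
  rewrite /= !inE !negb_or; apply/and3P; split=> //; rewrite ?andbT;
    do ?[apply/andP; split]; by apply/eqP => /(congr1 (@mdeg unit)); rewrite ?mdeg0 ?dd.1 ?dd.2.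
have [|L L0 HL] := has_series_tail (n := 3) fs us.
  move=> b; rewrite !inE !negb_or => /and3P[b0 b1 b2].
  have nb (b' : multi unit) : b != b' -> mdeg b != mdeg b'.
    apply: contraNneq; rewrite !mdeg_unit => bb.
    by apply/eqP/ffunP => -[].
  move: (nb _ b0) (nb _ b1) (nb _ b2); rewrite mdeg0 dd.1 dd.2.
  by case: (mdeg b) => [|[|[|n]]].
have r1 : 0 < Num.min r L^-1 by rewrite lt_min r0 invr_gt0.
have [] := @eq0_of_cubic_bound (c (m0 unit) - x) (c e - y) (c e2 - w) (K + L) _ r1.
  move=> t; rewrite le_min => /andP[tr tL].
  have h1 := H t tr.
  have := HL (fun=> t); rewrite dist1_unit subr0.
  have -> : L * `|t| <= 1 by rewrite -ler_pdivlMl// mulr1.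
  move=> /(_ isT); rewrite !big_cons big_nil addr0 mon0 mon_me monD mon_me mulr1 => h2.
  have -> : c (m0 unit) - x + (c e - y) * t + (c e2 - w) * t ^+ 2 =
    (phi (fun=> t) - (x + y * t + w * t ^+ 2)) -
    (phi (fun=> t) - (c (m0 unit) + (c e * t + c e2 * (t * t)))) by ring.
  by apply: le_trans (ler_normB _ _) _; rewrite mulrDl lerD.
move=> _ /eqP; rewrite subr_eq0 => /eqP ce /eqP; rewrite subr_eq0 => /eqP ce2.
rewrite (has_series_partial_center tt fs) -ce; split=> //.
have ps : has_series (partial phi tt) (fun=> 0) (fD tt c) (q / 2).
  by apply: has_series_partial fs _ _; lra.
by rewrite (has_series_partial_center tt ps) /fD ffunE eqxx -ce2.
Qed.

Lemma quad_affine (x y : R) (t0 : unit -> R) :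
  quad (fun t : unit -> R => x + t tt * y) t0 (fun=> y).
Proof.
exists 1 => // t _; rewrite sum_unit.
have -> : x + t tt * y - (x + t0 tt * y) - y * (t tt - t0 tt) = 0 by ring.
by rewrite normr0 mul1r exprn_ge0// dist1_ge0.
Qed.

Lemma quad_linear (I : finType) (v y : I -> R) :
  quad (fun z : I -> R => \sum_i v i * z i) y v.
Proof.
exists 1 => // z _; rewrite -!sumrB big1 ?normr0 ?mul1r ?exprn_ge0 ?dist1_ge0// => i _.
by ring.
Qed.

Variables (I : finType) (x0 v : I -> R).
Implicit Types (f : (I -> R) -> R) (t : unit -> R).

Definition line t : I -> R := fun i => x0 i + t tt * v i.

Lemma line0 : line (fun=> 0) = x0.
Proof. by apply/funext => i; rewrite /line mul0r addr0. Qed.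

Lemma quad_line f t : analytic_at f (line t) ->
  quad (fun t => f (line t)) t (fun=> \sum_i partial f i (line t) * v i).
Proof.
move=> fa; exact: (@quad_comp _ _ _ f (fun i t => line t i) t _ _ (analytic_quad fa)
  (fun i => quad_affine (x0 i) (v i) t)).
Qed.

Lemma analytic_line f t : analytic_at f (line t) -> analytic_at (fun t => f (line t)) t.
Proof.
move=> fa; apply: (@analytic_at_comp _ _ _ f (fun i t => line t i) t fa) => i.
apply: (@has_series_analytic _ _ _ _ _ 1).
apply: has_series_ext; last first.
  apply: has_seriesD; first exact: (has_series_cst (x0 i)).
  apply: (has_seriesZ (v i)); exact: (has_series_coord tt 0).
by move=> s _; rewrite /line subr0 mulrC.
Qed.

Lemma near_line (r : R) : 0 < r -> exists2 q : R, 0 < q &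
  forall t, `|t tt| <= q -> forall i, `|line t i - x0 i| < r.
Proof.
move=> r0; pose V := \sum_i `|v i| + 1.
have V0 : 0 < V by rewrite ltr_wpDl// sumr_ge0.
exists (r / V / 2); first by rewrite !divr_gt0.
move=> t ht i; rewrite /line addrC addKr normrM.
have vV : `|v i| <= V by rewrite /V (bigD1 i)//= -addrA lerDl addr_ge0// sumr_ge0.
apply: (@le_lt_trans _ _ (r / V / 2 * V)); first by apply: ler_pM.
have -> : r / V / 2 * V = r / 2 by field; rewrite gt_eqF.
lra.
Qed.

(** The second derivative along a line is the Hessian form on its direction. The formula for the
    first derivative holds only while the line stays where [f] is analytic, which suffices to
    differentiate it at 0. *)
Lemma second_partial_line f : analytic_at f x0 ->
  partial (partial (fun t => f (line t)) tt) tt (fun=> 0) =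
  \sum_i v i * \sum_j partial (partial f i) j x0 * v j.
Proof.
move=> fa; have [c [r fs]] := analytic_has_series fa; have [r0 _ _] := fs.
have H i : quad (fun t => partial f i (line t)) (fun=> 0)
    (fun=> \sum_j partial (partial f i) j x0 * v j).
  by rewrite -[in X in quad _ _ X]line0; apply: quad_line; rewrite line0; apply: analytic_partial.
have := @quad_comp _ _ _ (fun y => \sum_i v i * y i) (fun i t => partial f i (line t))
  (fun=> 0) _ _ (quad_linear v _) H.
have [q q0 Hq] := near_line r0.
have E t : `|t tt| <= q -> \sum_i v i * partial f i (line t) = partial (fun t => f (line t)) tt t.
  move=> /Hq tq; rewrite (quad_partial tt (quad_line (has_series_analytic_near fs tq))).
  by apply: eq_bigr => i _; rewrite mulrC.
move=> Q; apply: (quad_partial tt (quad_ext _ _ Q)).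
  by apply: E; rewrite normr0 ltW.
by exists q => // t /(_ tt); rewrite subr0; apply: E.
Qed.

Lemma partial_line f : analytic_at f x0 ->
  partial (fun t => f (line t)) tt (fun=> 0) = \sum_i partial f i x0 * v i.
Proof. by rewrite -{1}line0 => /quad_line/(quad_partial tt) ->; rewrite line0. Qed.

End Lines.

Section Forms.
Variables (R : realType) (k : nat) (h : 'I_k -> 'I_k -> R).

Let B (w w' : 'I_k -> R) := \sum_G \sum_L w G * w' L * h G L.

Let dlt (G : 'I_k) : 'I_k -> R := fun G' => (G' == G)%:R.

Let B_delta G L : B (dlt G) (dlt L) = h G L.
Proof.
rewrite /B (bigD1 G)//= [X in _ + X]big1 ?addr0; last first.
  move=> G' /negPf e; rewrite big1// => L' _; by rewrite /dlt e !mul0r.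
rewrite (bigD1 L)//= [X in _ + X]big1 ?addr0; last first.
  by move=> L' /negPf e; rewrite /dlt e mulr0 mul0r.
by rewrite /dlt !eqxx !mul1r.
Qed.

(** Polarisation on the sums of two basis vectors. *)
Lemma symmetric_form_eq0 : (forall G L, h G L = h L G) ->
  (forall w : 'I_k -> R, \sum_G \sum_L w G * w L * h G L = 0) -> forall G L, h G L = 0.
Proof.
move=> hs H G L.
have := H (fun i => dlt G i + dlt L i).
have -> : \sum_G0 \sum_L0 (dlt G G0 + dlt L G0) * (dlt G L0 + dlt L L0) * h G0 L0 =
   B (dlt G) (dlt G) + B (dlt G) (dlt L) + B (dlt L) (dlt G) + B (dlt L) (dlt L).
  rewrite /B -!big_split; apply: eq_bigr => i _; rewrite -!big_split; apply: eq_bigr => j _ /=.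
  ring.
have hd G' : h G' G' = 0 by rewrite -B_delta; apply: H.
by rewrite !B_delta !hd (hs L G); lra.
Qed.

Lemma linear_form_eq0 (y : 'I_k -> R) :
  (forall w : 'I_k -> R, \sum_G w G * y G = 0) -> forall G, y G = 0.
Proof.
move=> H G; rewrite -(H (dlt G)) (bigD1 G)//= /dlt eqxx mul1r big1 ?addr0// => G' /negPf ->.
by rewrite mul0r.
Qed.
End Forms.

Section Necessity.
Variables (R : realType) (k l m : nat).
Local Notation I := 'I_(k + l).
Local Notation xf := (@xfree k l).
Local Notation xd := (@xdep k l).
Local Notation J := (jcoord k l m).

Section Datum.
Variables (y0 : 'I_k -> R) (p0 : 'I_m -> R) (p0' : 'I_m -> 'I_k -> R).
Variable s : 'I_m -> 'I_k -> 'I_k -> R.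

(** Polynomial with value [p0], gradient [p0'] and, for symmetric [s], Hessian [s] at [y0]. *)
Definition quad_datum (A : 'I_m) (y : 'I_k -> R) : R :=
  p0 A + \sum_G p0' A G * (y G - y0 G)
  + \sum_G \sum_L s A G L / 2 * ((y G - y0 G) * (y L - y0 L)).

Lemma quad_datum_analytic A y : analytic_at (quad_datum A) y.
Proof.
apply: (@has_series_analytic _ _ _ _ _ 1); apply: has_seriesD.
  apply: has_seriesD; first exact: has_series_cst.
  apply: has_series_sum => // G; apply: has_seriesZ; exact: has_series_coord.
apply: has_series_sum => // G; apply: has_series_sum => // L.
by apply: has_seriesZ; apply: has_seriesM; exact: has_series_coord.
Qed.

Lemma quad_datum_partial A G : partial (quad_datum A) G y0 = p0' A G.
Proof.
apply: (quad_partial (d := p0' A)).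
pose K := \sum_G \sum_L `|s A G L / 2| : R.
have K0 : 0 <= K by apply: sumr_ge0 => ? _; apply: sumr_ge0.
exists (K + 1); first lra.
move=> y _; rewrite /quad_datum.
have -> : \sum_G0 p0' A G0 * (y0 G0 - y0 G0) = 0.
  by rewrite big1// => i _; rewrite subrr mulr0.
have -> : \sum_G0 \sum_L s A G0 L / 2 * ((y0 G0 - y0 G0) * (y0 L - y0 L)) = 0.
  by rewrite big1// => i _; rewrite big1// => j _; rewrite subrr mul0r mulr0.
set S := \sum_G0 p0' A G0 * _; set Q := \sum_G0 \sum_L _.
have -> : p0 A + S + Q - (p0 A + 0 + 0) - S = Q by ring.
apply: (@le_trans _ _ (K * dist1 y y0 ^+ 2)); last first.
  by rewrite ler_wpM2r ?exprn_ge0 ?dist1_ge0//; lra.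
rewrite /Q /K mulr_suml; apply: le_trans (ler_norm_sum _ _ _) _; apply: ler_sum => i _.
rewrite mulr_suml; apply: le_trans (ler_norm_sum _ _ _) _; apply: ler_sum => j _.
by rewrite normrM ler_wpM2l// normrM expr2 ler_pM// le_dist1.
Qed.

Lemma quad_datum_center A : quad_datum A y0 = p0 A.
Proof.
rewrite /quad_datum big1 ?addr0; last by move=> G _; rewrite subrr mulr0.
by rewrite big1 ?addr0// => G _; rewrite big1// => L _; rewrite subrr mul0r mulr0.
Qed.
End Datum.

(** [w] placed in the free directions and zero in the dependent ones, so that lines in this
    direction stay in the initial plane. *)
Definition freedir (w : 'I_k -> R) : I -> R := fun i => \sum_G w G * (i == xf G)%:R.

Lemma freedir_sum w (y : I -> R) : \sum_i y i * freedir w i = \sum_G w G * y (xf G).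
Proof.
rewrite /freedir; under eq_bigr do rewrite mulr_sumr.
rewrite exchange_big; apply: eq_bigr => G _.
rewrite (bigD1 (xf G))//= eqxx mulr1 big1 ?addr0; first by rewrite mulrC.
by move=> i /negPf ->; rewrite !mulr0.
Qed.

Lemma freedir_xf w G : freedir w (xf G) = w G.
Proof.
rewrite /freedir (bigD1 G)//= eqxx mulr1 big1 ?addr0// => G' /negPf e.
by rewrite (inj_eq (@lshift_inj _ _)) eq_sym e mulr0.
Qed.

Lemma freedir_xd w b : freedir w (xd b) = 0.
Proof. by rewrite /freedir big1// => G _; rewrite eq_rlshift mulr0. Qed.

Variables (U : set (J -> R)) (F : 'I_m -> 'I_l -> (J -> R) -> R).
Hypothesis Fan : forall A b, analytic_on U (F A b).

Lemma jet_eta (z : J -> R) : z = jet (fun i => z (cX m i)) (fun A => z (cP k l A))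
  (fun A G => z (cP' l A G)).
Proof. by apply/funext => -[i|[A|[A G]]]. Qed.

Lemma sum_sqr_le (T : finType) (f : T -> R) : (forall i, 0 <= f i) ->
  \sum_i f i ^+ 2 <= (\sum_i f i) ^+ 2.
Proof.
move=> f0; rewrite [leRHS]expr2 mulr_suml; apply: ler_sum => i _.
by rewrite expr2 ler_wpM2l// (bigD1 i)//= lerDl sumr_ge0.
Qed.

(** On each line through [x0] in the initial plane the cubic bound fixes the first two derivatives
    of [u]. Over all directions these determine the gradient, and by polarisation the Hessian, in
    the free variables. *)
Lemma approx_second (x0 : I -> R) p0 p0' s u :
  (forall C G L, s C G L = s C L G) ->
  approx_solution U F x0 (quad_datum (proj_free x0) p0 p0' s) setT u ->
  (forall A, analytic_at (u A) x0) /\ jet_of u x0 = jet x0 p0 p0' /\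
  second u x0 = s.
Proof.
move=> ss [V [C [oV Vx0 ua _ ui]]].
have ua0 A : analytic_at (u A) x0 by case: (ua A) => _; apply.
have u0 A : u A x0 = p0 A.
  have := ui x0 A Vx0 (fun=> erefl) Logic.I; rewrite quad_datum_center.
  rewrite big1 ?mulr0; last by move=> G _; rewrite subrr normr0 expr0n.
  by rewrite normr_le0 subr_eq0 => /eqP.
have [r [r0 Vr]] := oV x0 Vx0.
have D A w : \sum_G w G * partial (u A) (xf G) x0 = \sum_G w G * p0' A G /\
   \sum_G \sum_L w G * w L * second u x0 A G L = \sum_G \sum_L w G * w L * s A G L.
  have [q q0 Hq] := near_line x0 (freedir w) r0.
  have lxf t G : line x0 (freedir w) t (xf G) - x0 (xf G) = t tt * w G.
    by rewrite /line freedir_xf addrC addKr.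
  have la : analytic_at (fun t => u A (line x0 (freedir w) t)) (fun=> 0).
    by apply: analytic_line; rewrite line0.
  have [] := @partials_of_cubic _ _ (p0 A) (\sum_G p0' A G * w G)
     (\sum_G \sum_L s A G L / 2 * (w G * w L)) (C * \sum_G `|w G| ^+ 3) q la q0.
    move=> t tq; have tq' : `|(fun _ : unit => t) tt| <= q by [].
    have dep0 b : line x0 (freedir w) (fun=> t) (xd b) = x0 (xd b).
      by rewrite /line freedir_xd mulr0 addr0.
    have := ui _ A (Vr _ (Hq _ tq')) dep0 Logic.I.
    rewrite /quad_datum /proj_free; congr (_ <= _).
      congr (`|_ - _|); rewrite !mulr_suml; congr (_ + _ + _).
        by apply: eq_bigr => G _; rewrite lxf mulrCA mulrC.
      apply: eq_bigr => G _; rewrite mulr_suml; apply: eq_bigr => L _.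
      by rewrite !lxf expr2; ring.
    rewrite -mulrA; congr (_ * _); rewrite mulr_suml; apply: eq_bigr => G _.
    by rewrite lxf normrM exprMn mulrC.
  rewrite partial_line// second_partial_line// freedir_sum => e1 e2.
  split; first by rewrite e1; apply: eq_bigr => G _; rewrite mulrC.
  transitivity (\sum_i freedir w i * \sum_j partial (partial (u A) i) j x0 * freedir w j).
    under [RHS]eq_bigr do rewrite mulrC.
    rewrite freedir_sum; apply: eq_bigr => G _.
    rewrite freedir_sum mulr_sumr; apply: eq_bigr => L _.
    by rewrite /second mulrA (partialC _ _ (ua0 A)).
  rewrite e2 mulr_sumr; apply: eq_bigr => G _; rewrite mulr_sumr; apply: eq_bigr => L _.
  by field.
have up A G : partial (u A) (xf G) x0 = p0' A G.
  apply/eqP; rewrite -subr_eq0; apply/eqP.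
  apply: (linear_form_eq0 (y := fun G => partial (u A) (xf G) x0 - p0' A G)) => w.
  by under eq_bigr do rewrite mulrBr; rewrite sumrB (D A w).1 subrr.
split=> //; split.
  by apply/funext => -[i|[A|[A G]]] //=; rewrite ?u0 ?up.
apply/funext => A; apply/funext => G; apply/funext => L.
apply/eqP; rewrite -subr_eq0; apply/eqP.
apply: (symmetric_form_eq0 (h := fun G L => second u x0 A G L - s A G L)) => [G' L'|w].
  by rewrite /second (partialC _ _ (ua0 A)) ss.
under eq_bigr do (under eq_bigr do rewrite mulrBr); under eq_bigr do rewrite sumrB.
by rewrite sumrB (D A w).2 subrr.
Qed.

Lemma approx_residual (x0 : I -> R) a W u A b i : (forall A, analytic_at (u A) x0) ->
  analytic_at (F A b) (jet_of u x0) -> approx_solution U F x0 a W u ->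
  residual F u A b x0 = 0 /\ partial (residual F u A b) i x0 = 0.
Proof.
move=> ua0 Fa [V [C [oV Vx0 ua [_ uF] _]]].
have [r [r0 Vr]] := oV x0 Vx0.
have ri : 0 < (r / 2)^-1 by rewrite invr_gt0 divr_gt0.
have H : exists2 K : R, 0 < K & forall z, K * dist1 z x0 <= 1 ->
    `|residual F u A b z - 0| <= K * dist1 z x0 ^+ 2.
  (* [C] carries no sign, hence the absolute value; the second summand keeps [z] inside [V]. *)
  exists (`|C| + (r / 2)^-1); first by rewrite ltr_wpDl.
  move=> z hz; have d0 := dist1_ge0 z x0.
  have zr : dist1 z x0 <= r / 2.
    have : (r / 2)^-1 * dist1 z x0 <= 1.
      by apply: le_trans hz; rewrite ler_wpM2r// lerDr.
    by rewrite ler_pdivrMl ?divr_gt0// mulr1.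
  have Vz : V z by apply: Vr => j; apply: le_lt_trans (le_dist1 z x0 j) _; lra.
  rewrite subr0; apply: le_trans (uF z A b Vz) _.
  apply: (@le_trans _ _ (`|C| * \sum_j `|z j - x0 j| ^+ 2)).
    by rewrite ler_wpM2r ?ler_norm// sumr_ge0// => j _; rewrite exprn_ge0.
  apply: ler_pM => //; first by rewrite sumr_ge0// => j _; rewrite exprn_ge0.
    by rewrite lerDl ltW.
  exact: sum_sqr_le.
have Q0 : quad (fun _ : I -> R => 0 : R) x0 (fun=> 0).
  exists 1 => // z _; rewrite big1 => [|j _]; last by rewrite mul0r.
  by rewrite !subrr normr0 mul1r exprn_ge0// dist1_ge0.
split; last exact: (quad_partial i (quad_addO Q0 H)).
have [K K0 /(_ x0)] := H.
have -> : dist1 x0 x0 = 0 by rewrite /dist1 big1// => j _; rewrite subrr normr0.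
by rewrite mulr0 expr0n mulr0 subr0 normr_le0 => /(_ ler01)/eqP.
Qed.

Lemma approx_symmetric z A b c s : approx_solvable_everywhere U F -> U z ->
  (forall C G L, s C G L = s C L G) ->
  Phi F A b c z + Qform F A b c z s = Phi F A c b z + Qform F A c b z s.
Proof.
move=> H Uz ss; move: (Uz); rewrite (jet_eta z).
set x0 := fun i => _; set p0 := fun A => _; set p0' := fun A G => _ => Uj.
have [|u us] := H x0 p0 p0' Uj (quad_datum (proj_free x0) p0 p0' s) setT.
  have oT : open_set (@setT ('I_k -> R)) by move=> y _; exists 1.
  split=> //.
  - by move=> B; split=> // y _; apply: quad_datum_analytic.
  - by move=> B; apply: quad_datum_center.
  - by move=> B G; apply: quad_datum_partial.
have [ua [uj u2]] := approx_second ss us.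
have Fa B d : analytic_at (F B d) (jet_of u x0) by rewrite uj; case: (Fan B d) => _; apply.
have h B d i := @approx_residual x0 _ _ u B d i ua (Fa B d) us.
have E d e : partial (partial (u A) (xd d)) (xd e) x0 =
    Phi F A d e (jet x0 p0 p0') + Qform F A d e (jet x0 p0 p0') s.
  rewrite (mixed_partial_residual A d e ua Fa) uj u2 (h A d _).2 add0r.
  rewrite [X in _ + X + _]big1 ?addr0; last by move=> B _; rewrite (h B e (xd e)).1 mulr0.
  rewrite big1 ?addr0// => G _; rewrite big1// => B _.
  by rewrite (h B e _).2 mulr0.
by rewrite -!E partialC.
Qed.

Lemma approx_compatibility : approx_solvable_everywhere U F -> compatibility U F.
Proof.
move=> H z Uz; have P A b c : Phi F A b c z = Phi F A c b z.
  have := @approx_symmetric z A b c (fun _ _ _ => 0) H Uz (fun _ _ _ => erefl).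
  by rewrite !Qform0 !addr0.
split=> // A C G L b c; rewrite -!Qform_delta.
set s := fun C' G' L' => _.
have ss C' G' L' : s C' G' L' = s C' L' G'.
  by rewrite /s; congr (_ * _); rewrite addrC; congr (_ + _); rewrite mulrC.
by have := @approx_symmetric z A b c s H Uz ss; rewrite P => /addrI.
Qed.

End Necessity.

(** * Uniqueness *)

Section Uniqueness.
Variables (R : realType) (k l m : nat).
Local Notation I := 'I_(k + l).
Local Notation xf := (@xfree k l).
Local Notation xd := (@xdep k l).
Local Notation J := (jcoord k l m).
Local Notation low n := (ybelow (@isdep k l) n).
Implicit Types (u : 'I_m -> (I -> R) -> R) (x : I -> R).

Definition obox (x0 : I -> R) (r : R) : set (I -> R) := [set z | forall i, `|z i - x0 i| < r].

Lemma open_obox x0 r : open_set (obox x0 r).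
Proof.
move=> z zr; pose s := \big[Num.max/0]_i `|z i - x0 i|.
have [r0|r0] := leP r 0.
  exists 1; split=> // y _ i; have := zr i.
  by rewrite ltNge (le_trans r0).
have sr : s < r by apply/bigmax_ltP.
exists (r - s); split; first by rewrite subr_gt0.
move=> y yz i; have := le_bigmax 0 (fun i => `|z i - x0 i|) i; rewrite -/s => h.
have -> : y i - x0 i = (y i - z i) + (z i - x0 i) by ring.
by apply: le_lt_trans (ler_normD _ _) _; have := yz i; lra.
Qed.

Lemma isdepP (i : I) : isdep i -> exists b, i = xd b.
Proof.
case: (splitP i) => j ij; first by rewrite /isdep ij leqNgt ltn_ord.
by move=> _; exists j; apply: val_inj.
Qed.

Lemma xd_neq_xf (b : 'I_l) (G : 'I_k) : (xd b == xf G) = false.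
Proof. by rewrite eq_rlshift. Qed.

Lemma xf_neq_xd (b : 'I_l) (G : 'I_k) : (xf G == xd b) = false.
Proof. by rewrite eq_lrshift. Qed.

Lemma ydeg_gt0 (c : multi I) : (0 < ydeg (@isdep k l) c)%N -> exists b, (0 < c (xd b))%N.
Proof.
rewrite lt0n sum_nat_eq0 => /forallPn[i]; rewrite negb_imply -lt0n => /andP[/isdepP[b ->]].
by exists b.
Qed.

Lemma ydeg_sum (c : multi I) : ydeg (@isdep k l) c = (\sum_b c (xd b))%N.
Proof.
rewrite /ydeg big_split_ord/= big1 ?add0n.
  by apply: eq_bigl => b; rewrite isdep_xdep.
by move=> G; rewrite -/(xf G) (negPf (isdep_xfree l G)).
Qed.

Lemma fD_pred (i : I) (f : multi I -> R) (c : multi I) : (0 < c i)%N ->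
  fD i f (msub c (me i)) = (c i)%:R * f c.
Proof.
move=> ci; rewrite /fD maddC msubK ?mle_me//.
by rewrite !ffunE eqxx subn1 prednK.
Qed.

Lemma ydeg_pred b (c : multi I) : (0 < c (xd b))%N ->
  ydeg (@isdep k l) c = (ydeg (@isdep k l) (msub c (me (xd b)))).+1.
Proof.
move=> cb; have e := @msubK _ (me (xd b)) c; rewrite mle_me cb in e.
by rewrite -[in LHS](e isT) ydegD ydeg_me isdep_xdep add1n.
Qed.

Lemma has_series_jet (F0 : (J -> R) -> R) u x0 us (r : R) C q :
  (forall A, has_series (u A) x0 (us A) r) -> 0 < r -> has_series F0 (jet_of u x0) C q ->
  exists2 r0, 0 < r0 & forall r', 0 < r' -> r' <= r0 ->
    has_series (fun z => F0 (jet_of u z)) x0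
      (fcomp C (jetser us (fun A => u A x0) (fun A G => partial (u A) (xf G) x0))) r'.
Proof.
move=> us_ r0 Fs.
pose cj (c : J) : multi I -> R := match c with
  | inl i => fun b => fcst (x0 i - 0) b + fX R i b
  | inr (inl A) => us A | inr (inr (A, G)) => fD (xf G) (us A) end.
have cjs c : has_series (fun z => jet_of u z c) x0 (cj c) (r / 2).
  have r2 : 0 < r / 2 by rewrite divr_gt0.
  case: c => [i|[A|[A G]]] /=.
  - have := has_series_coord i 0 x0 r2; apply: has_series_ext => z _.
    by rewrite subr0.
  - by apply: has_series_le (us_ A) => //; lra.
  - by apply: has_series_partial (us_ A) _ _ => //; lra.
have [r1 r10 H] := @has_series_comp0 R I J F0 (fun c z => jet_of u z c) x0 C q cj (r / 2) Fs cjs.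
exists r1 => // r' r'0 r'r; have := H r' r'0 r'r; congr has_series; congr fcomp.
apply/funext => -[i|[A|[A G]]] //=.
by apply/funext => b; rewrite /fsub subr0 addrC addrA addNr add0r.
Qed.

Variables (U : set (J -> R)) (F : 'I_m -> 'I_l -> (J -> R) -> R).
Hypothesis Fan : forall A b, analytic_on U (F A b).

(** Free difference quotients at [x0] evaluate [u] only on the initial plane, where it is the datum;
    the radii of both [V] and [W] therefore enter the constant. *)
Lemma solution_jet x0 p0 p0' a W V u : admissible x0 p0 p0' a W ->
  cauchy_solution U F x0 a W V u -> jet_of u x0 = jet x0 p0 p0'.
Proof.
move=> [oW Wx aan a0 a1] [oV Vx uan _ ui].
have u0 A : u A x0 = a A (proj_free x0) by apply: ui.
suff u1 A G : partial (u A) (xf G) x0 = p0' A G.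
  by apply/funext => -[i|[A|[A G]]] //=; rewrite ?u0 ?a0 ?u1.
have aa : analytic_at (a A) (proj_free x0) by case: (aan A) => _; apply.
have [K K0 HK] := analytic_quad aa.
have [r [r0 Vr]] := oV _ Vx; have [r' [r'0 Wr]] := oW _ Wx.
apply: partial_eq; exists (K + (r / 2)^-1 + (r' / 2)^-1).
  by rewrite !addr_gt0 ?invr_gt0 ?divr_gt0.
move=> t; rewrite !mulrDl => ht.
have i1 : 0 < (r / 2)^-1 by rewrite invr_gt0 divr_gt0.
have i2 : 0 < (r' / 2)^-1 by rewrite invr_gt0 divr_gt0.
have j1 : 0 <= (r / 2)^-1 * `|t| by rewrite mulr_ge0// ltW.
have j2 : 0 <= (r' / 2)^-1 * `|t| by rewrite mulr_ge0// ltW.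
have j3 : 0 <= K * `|t| by rewrite mulr_ge0// ltW.
have tr : `|t| <= r / 2.
  have : (r / 2)^-1 * `|t| <= 1 by lra.
  by rewrite ler_pdivrMl ?divr_gt0// mulr1.
have tr' : `|t| <= r' / 2.
  have : (r' / 2)^-1 * `|t| <= 1 by lra.
  by rewrite ler_pdivrMl ?divr_gt0// mulr1.
set x := upd x0 (xf G) (x0 (xf G) + t).
have px : proj_free x = upd (proj_free x0) G (proj_free x0 G + t).
  apply/funext => G'; rewrite /proj_free /x /upd.
  by rewrite (inj_eq (@lshift_inj _ _)).
have Vx' : V x.
  apply: Vr => i; apply: le_lt_trans (le_dist1 _ _ i) _.
  by rewrite dist1_upd; lra.
have Wx' : W (proj_free x).
  rewrite px; apply: Wr => i; apply: le_lt_trans (le_dist1 _ _ i) _.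
  by rewrite dist1_upd; lra.
have dep b : x (xd b) = x0 (xd b) by rewrite /x /upd xd_neq_xf.
rewrite u0 (ui x A Vx' dep Wx') px.
have := HK (upd (proj_free x0) G (proj_free x0 G + t)); rewrite dist1_upd.
have -> : K * `|t| <= 1 by lra.
move=> /(_ isT); rewrite (bigD1 G)//= big1 ?addr0; last first.
  by move=> i /negPf ij; rewrite /upd ij subrr mulr0.
have -> : upd (proj_free x0) G (proj_free x0 G + t) G = proj_free x0 G + t by rewrite /upd eqxx.
rewrite (addrC (proj_free x0 G) t) addrK a1 => h.
apply: le_trans h _; rewrite -!mulrDl ler_wpM2r ?exprn_ge0//; lra.
Qed.

Lemma solution_series x0 p0 p0' a W V u us (r : R) CF (q : R) :
  admissible x0 p0 p0' a W -> cauchy_solution U F x0 a W V u ->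
  (forall A, has_series (u A) x0 (us A) r) -> 0 < r ->
  (forall A b, has_series (F A b) (jet x0 p0 p0') (CF A b) q) ->
  forall A b, fD (xd b) (us A) = fcomp (CF A b) (jetser us p0 p0').
Proof.
move=> adm sol uss r0 Fs A b.
have uj := solution_jet adm sol; have [oV Vx uan [_ ue] _] := sol.
have Fs' : has_series (F A b) (jet_of u x0) (CF A b) q by rewrite uj.
have [r1 r10 H] := has_series_jet uss r0 Fs'.
have := H r1 r10 (lexx _).
have -> : (fun A => u A x0) = p0.
  by apply/funext => B; have /(congr1 (fun z => z (cP k l B))) := uj.
have -> : (fun A G => partial (u A) (xf G) x0) = p0'.
  by apply/funext => B; apply/funext => G; have /(congr1 (fun z => z (cP' l B G))) := uj.
have ps : has_series (partial (u A) (xd b)) x0 (fD (xd b) (us A)) (r / 2).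
  by apply: has_series_partial (uss A) _ _; lra.
have [r2 [r20 Vr]] := oV _ Vx.
move=> Hs; apply: (has_series_unique ps Hs (r0 := r2 / 2)); first lra.
move=> z zr; apply: ue; apply: Vr => i; apply: le_lt_trans (zr i) _; lra.
Qed.

Lemma solution_unique x0 p0 p0' a W V1 u1 V2 u2 : U (jet x0 p0 p0') ->
  admissible x0 p0 p0' a W ->
  cauchy_solution U F x0 a W V1 u1 -> cauchy_solution U F x0 a W V2 u2 ->
  exists V, [/\ open_set V, V x0 & forall x A, V x -> u1 A x = u2 A x].
Proof.
move=> Uj adm s1 s2.
have [oV1 Vx1 uan1 _ ui1] := s1; have [oV2 Vx2 uan2 _ ui2] := s2.
have [c1 [r1 r10 us1]] : exists c, exists2 r : R, 0 < r & forall A, has_series (u1 A) x0 (c A) r.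
  by apply: analytic_series_family => A; case: (uan1 A) => _; apply.
have [c2 [r2 r20 us2]] : exists c, exists2 r : R, 0 < r & forall A, has_series (u2 A) x0 (c A) r.
  by apply: analytic_series_family => A; case: (uan2 A) => _; apply.
have [CF [q q0 Fs]] : exists c, exists2 q : R, 0 < q &
   forall Ab : 'I_m * 'I_l, has_series (F Ab.1 Ab.2) (jet x0 p0 p0') (c Ab) q.
  by apply: analytic_series_family => Ab; case: (Fan Ab.1 Ab.2) => _; apply.
have Fs' A b : has_series (F A b) (jet x0 p0 p0') (CF (A, b)) q := Fs (A, b).
have e1 := solution_series adm s1 us1 r10 Fs'.
have e2 := solution_series adm s2 us2 r20 Fs'.
pose r := Num.min r1 r2; have r0 : 0 < r by rewrite lt_min r10.
have us1' A : has_series (u1 A) x0 (c1 A) r by apply: has_series_le (us1 A); rewrite ?ge_min ?lexx.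
have us2' A : has_series (u2 A) x0 (c2 A) r.
  by apply: has_series_le (us2 A); rewrite ?ge_min ?lexx ?orbT.
(* Coefficients of y-degree 0 belong to the restriction to the initial plane, where both solutions
   equal the datum. *)
have base A (c : multi I) : ydeg (@isdep k l) c = 0%N -> c1 A c = c2 A c.
  move=> c0; apply/eqP; rewrite -subr_eq0; apply/eqP.
  have [oW Wx _ _ _] := adm.
  have [q1 [q10 H1]] := oV1 _ Vx1; have [q2 [q20 H2]] := oV2 _ Vx2.
  have [q3 [q30 H3]] := oW _ Wx.
  pose q' := Num.min q1 (Num.min q2 q3).
  have q'0 : 0 < q' by rewrite !lt_min q10 q20.
  have q'1 : q' <= q1 by rewrite ge_min lexx.
  have q'2 : q' <= q2 by rewrite !ge_min lexx !orbT.
  have q'3 : q' <= q3 by rewrite !ge_min lexx !orbT.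
  have q2' : 0 < q' / 2 by rewrite divr_gt0.
  apply: (has_series_eq0_on (Y := @isdep k l) (has_seriesB (us1' A) (us2' A)) q2').
    move=> z zr zd; have zdep b : z (xd b) = x0 (xd b) by apply: zd; apply: isdep_xdep.
    have Wz : W (proj_free z) by apply: H3 => G; apply: le_lt_trans (zr (xf G)) _; lra.
    have V2z : V2 z by apply: H2 => i; apply: le_lt_trans (zr i) _; lra.
    have V1z : V1 z by apply: H1 => i; apply: le_lt_trans (zr i) _; lra.
    by rewrite (ui1 z A V1z zdep Wz) (ui2 z A V2z zdep Wz) subrr.
  move=> i Yi; apply/eqP; rewrite -leqn0 -c0; exact: leq_ydeg.
(* A coefficient at [c] is, up to the factor [c (xd b)], the coefficient of the [b]-derivative at
   [c - me (xd b)], one y-degree lower. There [F(ju)] is determined by coefficients of [u] of no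
   larger y-degree, since free derivatives preserve it. *)
have main n A : {in low n, c1 A =1 c2 A}.
  elim: n A => [|n IH] A c; first by rewrite inE.
  rewrite inE ltnS => cn.
  have [c0|] := posnP (ydeg (@isdep k l) c); first exact: base.
  move=> cp; have [b cb] := ydeg_gt0 cp.
  have yb := ydeg_pred cb.
  have c'n : msub c (me (xd b)) \in low n by rewrite inE -yb.
  have : fD (xd b) (c1 A) (msub c (me (xd b))) = fD (xd b) (c2 A) (msub c (me (xd b))).
    have loc : {in low n, fcomp (CF (A, b)) (jetser c1 p0 p0') =1
        fcomp (CF (A, b)) (jetser c2 p0 p0')}.
      by apply: fcomp_local; [exact: ybelow_down|move=> j; exact: jetser_local].
    by rewrite e1 e2 loc.
  rewrite !fD_pred// => /mulfI; apply.
  by rewrite pnatr_eq0 -lt0n.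
have cc A : c1 A = c2 A.
  by apply/funext => c; apply: (main (ydeg (@isdep k l) c).+1); rewrite inE ltnSn.
exists (obox x0 r); split; first exact: open_obox.
- by move=> i; rewrite subrr normr0.
- move=> x A xr; have xb : box x0 r x by move=> i; apply: ltW.
  have [_ _ /(_ x xb) h1] := us1' A; have [_ _ /(_ x xb) h2] := us2' A.
  by rewrite cc in h1; apply: hsum_unique h1 h2.
Qed.

End Uniqueness.

(** * Existence *)

Section SeriesValue.
Variables (R : realType) (I : finType).

Definition series_val (x0 : I -> R) (c : multi I -> R) (x : I -> R) : R :=
  hsum_val (fun b => c b * mon (fun i => x i - x0 i) b).

Lemma has_series_val x0 c (r M : R) : 0 < r -> nbd (pw r) c M ->
  has_series (series_val x0 c) x0 c r.
Proof.
move=> r0 cM; split=> //; first by exists M.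
by move=> z zr; apply: hsum_valP; apply: nbd_mon cM zr.
Qed.

(** Every monomial of [Lop Y j g] contains the variable [j]. Hence adding such terms to the datum
    leaves the initial condition exact. *)
Lemma series_val_Lop (Y : pred I) j x0 g (x : I -> R) : x j = x0 j ->
  series_val x0 (Lop Y j g) x = 0.
Proof.
move=> xj; rewrite /series_val.
have -> : (fun b => Lop Y j g b * mon (fun i => x i - x0 i) b) = (fun=> 0).
  apply/funext => b; rewrite /Lop; case: ifP => bj; last by rewrite mul0r.
  rewrite /mon (bigD1 j)//= xj subrr expr0n.
  by rewrite (gtn_eqF bj) mul0r mulr0.
have H0 : sbounded (fun _ : multi I => 0 : R) 0.
  by move=> s _; rewrite big1// => i _; rewrite normr0.
exact: hsum_unique (hsum_valP H0) (@hsum0 _ _).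
Qed.

Lemma has_series0_val (f : (I -> R) -> R) x0 c (r : R) z : has_series f x0 c r ->
  (forall b, c b = 0) -> box x0 r z -> f z = 0.
Proof.
move=> [_ _ H] c0 zr; apply: (hsum_unique (H z zr)).
by apply: hsum_ext (@hsum0 _ _) => b; rewrite c0 mul0r.
Qed.

End SeriesValue.

(** * Vanishing of the residual as a formal series *)

Section FormalResidual.
Variables (R : realType) (k l m : nat).
Local Notation I := 'I_(k + l).
Local Notation xf := (@xfree k l).
Local Notation xd := (@xdep k l).
Local Notation yd := (ydeg (@isdep k l)).
Local Notation low n := (ybelow (@isdep k l) n).
Variable w : 'I_m -> 'I_l -> multi I -> R.
Variable al : 'I_m -> 'I_l -> 'I_m -> multi I -> R.
Variable be : 'I_m -> 'I_l -> 'I_m -> 'I_k -> multi I -> R.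

(** [al] and [be] stand for the series, along the jet, of the derivatives of [F_d] in [p] and [p'];
    they multiply the residual [W_e] and its free derivatives. *)
Definition linser A d e (c : multi I) : R :=
  \sum_B fmul (al A d B) (w B e) c +
  \sum_G \sum_B fmul (be A d B G) (fD (xf G) (w B e)) c.

Hypothesis euler : forall A (c : multi I),
  \sum_b (if (0 < c (xd b))%N then w A b (msub c (me (xd b))) else 0) = 0.
Hypothesis curl : forall A b b0 c, fD (xd b0) (w A b) c - fD (xd b) (w A b0) c =
  linser A b0 b c - linser A b b0 c.

(** [d_b0] applied to [sum_b y_b W_b = 0]; on coefficients, the identity at [c + me (xd b0)]
    multiplied by [c (xd b0) + 1]. *)
Let euler_derivative A b0 (c : multi I) : w A b0 c +
  \sum_b (if (0 < c (xd b))%N then fD (xd b0) (w A b) (msub c (me (xd b))) else 0) = 0.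
Proof.
have : (c (xd b0)).+1%:R * \sum_b (if (0 < madd c (me (xd b0)) (xd b))%N then
    w A b (msub (madd c (me (xd b0))) (me (xd b))) else 0) = 0.
  by rewrite euler mulr0.
move=> E; rewrite -[RHS]E (bigD1 b0)//= [in RHS](bigD1 b0)//= mulrDr addrA; congr (_ + _).
  rewrite !ffunE eqxx addn1 ltn0Sn maddKr.
  case: ifPn => [cb|]; first by rewrite fD_pred// -natr1 mulrDl mul1r addrC.
  by rewrite -eqn0Ngt => /eqP ->; rewrite addr0 mul1r.
rewrite mulr_sumr; apply: eq_bigr => b bb0.
have ne : (xd b == xd b0) = false by rewrite (inj_eq (@rshift_inj _ _)) (negPf bb0).
rewrite !ffunE ne addn0; case: ifPn => cb; last by rewrite mulr0.
rewrite /fD !ffunE eq_sym ne subn0; congr (_ * w A b _).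
apply/ffunP => i; rewrite !ffunE; have [->|ib] := eqVneq i (xd b).
  by rewrite ne !addn0.
by rewrite !subn0.
Qed.

Lemma residual_series_eq0 A b c : w A b c = 0.
Proof.
suff H n : forall A b, {in low n, w A b =1 (fun=> 0)}.
  by apply: (H (yd c).+1); rewrite inE ltnSn.
elim: n => [|n IH] {}A {}b {}c; first by rewrite inE.
rewrite inE ltnS => cn.
(* Neither products nor free derivatives lower the y-degree, so the induction hypothesis annihilates
   these terms below degree [n]. *)
have lin0 B d e c' : c' \in low n -> linser B d e c' = 0.
  move=> c'n; rewrite /linser.
  have fm0 (f : multi I -> R) : fmul f (fun=> 0) c' = 0.
    by rewrite /fmul big1// => i _; rewrite mulr0.
  have fD0 G : fD (xf G) (fun _ : multi I => 0 : R) = fun=> 0.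
    by apply/funext => x; rewrite /fD mulr0.
  rewrite big1 ?add0r; last first.
    move=> C _; have loc : {in low n, fmul (al B d C) (w C e) =1 fmul (al B d C) (fun=> 0)}.
      by apply: fmul_local => //; exact: ybelow_down.
    by rewrite loc.
  rewrite big1// => G _; rewrite big1// => C _.
  have loc : {in low n, fmul (be B d C G) (fD (xf G) (w C e)) =1 fmul (be B d C G) (fun=> 0)}.
    apply: fmul_local => //; first exact: ybelow_down.
    by move=> x xn; rewrite (fD_local (isdep_xfree l G) (IH C e) xn) fD0.
  by rewrite loc.
have := euler_derivative A b c.
(* At [c - me (xd b0)] the curl relation exchanges the two derivatives, its linear terms being zero
   by [lin0]. The sum becomes the Euler operator on [w A b], and the coefficient ends up multiplied
   by [yd c + 1], which is nonzero. *)
have -> : \sum_b0 (if (0 < c (xd b0))%N then fD (xd b) (w A b0) (msub c (me (xd b0))) else 0) =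
    \sum_b0 ((c (xd b0))%:R * w A b c).
  apply: eq_bigr => b0 _; case: ifPn => cb; last first.
    by move: cb; rewrite -eqn0Ngt => /eqP ->; rewrite mul0r.
  rewrite -fD_pred//; apply/eqP; rewrite -subr_eq0 curl.
  by rewrite !lin0 ?subrr// inE -ltnS -ydeg_pred.
rewrite -mulr_suml -natr_sum -ydeg_sum => /eqP.
rewrite -{1}[w A b c]mul1r -mulrDl mulf_eq0 addrC natr1 pnatr_eq0/=.
by move=> /eqP.
Qed.

End FormalResidual.

(** * From the formal series to an actual solution *)

Section Existence.
Variables (R : realType) (k l m : nat).
Local Notation I := 'I_(k + l).
Local Notation xf := (@xfree k l).
Local Notation xd := (@xdep k l).
Local Notation J := (jcoord k l m).
Local Notation yd := (ydeg (@isdep k l)).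
Variables (U : set (J -> R)) (F : 'I_m -> 'I_l -> (J -> R) -> R).
Implicit Types (u : 'I_m -> (I -> R) -> R).

Definition reslin u A d e x : R :=
  \sum_B partial (F A d) (cP k l B) (jet_of u x) * residual F u B e x +
  \sum_G \sum_B partial (F A d) (cP' l B G) (jet_of u x) *
    partial (residual F u B e) (xf G) x.

Let curl_arith (x y p q a b c d : R) :
  x + p + q + a + b = y + p + q + c + d -> x - y = (c + d) - (a + b).
Proof. lra. Qed.

Lemma residual_curl u x A b b0 : (forall B, analytic_at (u B) x) ->
  (forall B d, analytic_at (F B d) (jet_of u x)) -> U (jet_of u x) -> compatibility U F ->
  partial (residual F u A b) (xd b0) x - partial (residual F u A b0) (xd b) x =
  reslin u A b0 b x - reslin u A b b0 x.
Proof.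
move=> ua Fa Uj comp; have [P Q] := comp _ Uj.
have := partialC (xd b) (xd b0) (ua A).
rewrite (mixed_partial_residual A b b0 ua Fa) (mixed_partial_residual A b0 b ua Fa).
rewrite (P A b b0) (@Qform_sym _ _ _ _ F _ A b b0); last 2 first.
- by move=> C G L; rewrite /second partialC.
- by move=> C G L; apply: Q.
exact: curl_arith.
Qed.

(** The last hypothesis is [E u = sum_b y_b F_b(ju)] on coefficients. The radius keeps the jet in
    [U], so that compatibility applies at every nearby point and not only at [x0]. *)
Lemma residual_eq0_near u x0 us (r1 : R) (g : 'I_m -> 'I_l -> multi I -> R) (q : R) :
  open_set U -> (forall A b, analytic_on U (F A b)) -> compatibility U F ->
  U (jet_of u x0) -> 0 < r1 -> (forall A, has_series (u A) x0 (us A) r1) -> 0 < q ->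
  (forall A b, has_series (fun z => F A b (jet_of u z)) x0 (g A b) q) ->
  (forall A c, (yd c)%:R * us A c =
     \sum_b (if (0 < c (xd b))%N then g A b (msub c (me (xd b))) else 0)) ->
  exists2 r : R, 0 < r & forall z, obox x0 r z ->
    [/\ U (jet_of u z), forall A, analytic_at (u A) z & forall A b, residual F u A b z = 0].
Proof.
move=> oU Fan comp Uj r10 hus q0 hg eul.
have ua A : analytic_at (u A) x0 by apply: has_series_analytic (hus A).
have Fa z A b : U z -> analytic_at (F A b) z by case: (Fan A b) => _; apply.
have [e [e0 He]] := oU _ Uj.
have [r2 r20 H2] : exists2 r : R, 0 < r & forall r', 0 < r' -> r' <= r ->
    forall c : J, forall z, box x0 r' z -> `|jet_of u z c - jet_of u x0 c| < e.
  apply: fin_small => c; have [r r0 H] := quad_cont (quad_jet c ua) e0.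
  by exists r => // r' _ rr z zr; apply: H => i; apply: le_trans (zr i) rr.
pose r3 := Num.min r1 r2; have r30 : 0 < r3 by rewrite lt_min r10.
have near z : obox x0 r3 z -> U (jet_of u z) /\ forall A, analytic_at (u A) z.
  move=> zr; split.
    apply: He => c; apply: (H2 r2) => // i; apply: le_trans (ltW (zr i)) _.
    by rewrite ge_min lexx orbT.
  move=> A; apply: has_series_analytic_near (hus A) _ => i.
  by apply: lt_le_trans (zr i) _; rewrite ge_min lexx.
pose r4 := Num.min (r1 / 2) q; have r40 : 0 < r4 by rewrite lt_min q0 divr_gt0.
pose w A b := fun c => fD (xd b) (us A) c - g A b c.
have hw A b : has_series (residual F u A b) x0 (w A b) r4.
  apply: has_seriesB; last by apply: has_series_le (hg A b); rewrite // ge_min lexx orbT.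
  apply: (@has_series_le _ _ _ _ _ (r1 / 2)) => //; first by rewrite ge_min lexx.
  by apply: has_series_partial (hus A) _ _; lra.
have [al [r5 r50 hal]] : exists c, exists2 r : R, 0 < r &
    forall p : 'I_m * 'I_l * 'I_m, has_series
      (fun z => partial (F p.1.1 p.1.2) (cP k l p.2) (jet_of u z)) x0 (c p) r.
  apply: analytic_series_family => p; apply: (@analytic_F_jet R k l m) => //.
  exact/analytic_partial/Fa.
have [be [r6 r60 hbe]] : exists c, exists2 r : R, 0 < r &
    forall p : 'I_m * 'I_l * ('I_m * 'I_k), has_series
      (fun z => partial (F p.1.1 p.1.2) (cP' l p.2.1 p.2.2) (jet_of u z)) x0 (c p) r.
  apply: analytic_series_family => p; apply: (@analytic_F_jet R k l m) => //.
  exact/analytic_partial/Fa.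
pose al' A b B := al (A, b, B); pose be' A b B G := be (A, b, (B, G)).
pose r7 := Num.min (r4 / 2) (Num.min r5 r6).
have r70 : 0 < r7 by rewrite !lt_min divr_gt0// r50.
have r74 : r7 <= r4 / 2 by rewrite ge_min lexx.
have r75 : r7 <= r5 by rewrite !ge_min lexx !orbT.
have r76 : r7 <= r6 by rewrite !ge_min lexx !orbT.
have hw7 A b : has_series (residual F u A b) x0 (w A b) r7.
  by apply: has_series_le (hw A b) => //; lra.
have hDw7 A b i : has_series (partial (residual F u A b) i) x0 (fD i (w A b)) r7.
  by apply: has_series_partial (hw A b) _ _ => //; lra.
have hlin A d e' : has_series (reslin u A d e') x0 (linser w al' be' A d e') r7.
  apply: has_seriesD.
    apply: has_series_sum => // B; apply: has_seriesM => //.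
    exact: has_series_le (hal (A, d, B)).
  apply: has_series_sum => // G; apply: has_series_sum => // B; apply: has_seriesM => //.
  exact: has_series_le (hbe (A, d, (B, G))).
have euler A (c : multi I) :
    \sum_b (if (0 < c (xd b))%N then w A b (msub c (me (xd b))) else 0) = 0.
  have -> : \sum_b (if (0 < c (xd b))%N then w A b (msub c (me (xd b))) else 0) =
    \sum_b ((c (xd b))%:R * us A c -
            (if (0 < c (xd b))%N then g A b (msub c (me (xd b))) else 0)).
    apply: eq_bigr => b _; case: ifPn => cb; first by rewrite /w fD_pred.
    by move: cb; rewrite -eqn0Ngt => /eqP ->; rewrite mul0r subrr.
  by rewrite sumrB -mulr_suml -natr_sum -ydeg_sum eul subrr.
(* The curl relation holds pointwise near [x0]; uniqueness of expansions carries it over to the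
   coefficients. *)
have curl A b b0 c : fD (xd b0) (w A b) c - fD (xd b) (w A b0) c =
    linser w al' be' A b0 b c - linser w al' be' A b b0 c.
  have h1 := has_seriesB (hDw7 A b (xd b0)) (hDw7 A b0 (xd b)).
  have h2 := has_seriesB (hlin A b0 b) (hlin A b b0).
  have r32 : 0 < r3 / 2 by rewrite divr_gt0.
  have := has_series_unique h1 h2 r32.
  move=> /(_ _)/(congr1 (fun f => f c)); apply=> z zr.
  have [|Uz uz] := near z; first by move=> i; apply: le_lt_trans (zr i) _; lra.
  by apply: residual_curl => // B d; apply: Fa.
have w0 := residual_series_eq0 euler curl.
exists (Num.min r3 r4); first by rewrite lt_min r30.
move=> z zr; have [|Uz uz] := near z.
  by move=> i; apply: lt_le_trans (zr i) _; rewrite ge_min lexx.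
split=> // A b; apply: (has_series0_val (hw A b) (w0 A b)) => i.
by apply: ltW; apply: lt_le_trans (zr i) _; rewrite ge_min lexx orbT.
Qed.

Lemma solution_exists x0 p0 p0' a W : open_set U -> (forall A b, analytic_on U (F A b)) ->
  compatibility U F -> U (jet x0 p0 p0') -> admissible x0 p0 p0' a W ->
  exists V u, cauchy_solution U F x0 a W V u.
Proof.
move=> oU Fan comp Uj [oW Wx aan a0 a1].
(* The datum extended constantly in the dependent variables, so that its series has only terms of
   y-degree 0. *)
pose f A (x : I -> R) := a A (proj_free x).
have fa A : analytic_at (f A) x0.
  apply: (@analytic_at_comp _ _ _ (a A) (fun G x => x (xf G)) x0).
    by case: (aan A) => _; apply.
  move=> G.
  apply: (@has_series_analytic _ _ _ _ (fun b => fcst (x0 (xf G) - 0) b + fX R (xf G) b) 1).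
  by have := has_series_coord (xf G) 0 x0 (@ltr01 R); apply: has_series_ext => z _; rewrite subr0.
have [ca [r r0 hf]] := analytic_series_family fa.
have fp A G : partial (f A) (xf G) x0 = p0' A G.
  rewrite -a1 /partial; congr derive1; apply/funext => t; rewrite /f; congr (a A _).
have fdep A b z : partial (f A) (xd b) z = 0.
  apply: partial_eq; exists 1 => // t _; rewrite mul0r subr0.
  have -> : f A (upd z (xd b) (z (xd b) + t)) = f A z.
    by congr (a A _); apply/funext => G; rewrite /proj_free /upd xf_neq_xd.
  by rewrite subrr normr0 mul1r exprn_ge0.
have cadep A (c : multi I) : (yd c)%:R * ca A c = 0.
  have [->|cp] := posnP (yd c); first by rewrite mul0r.
  have [b cb] := ydeg_gt0 cp.
  have ps : has_series (partial (f A) (xd b)) x0 (fD (xd b) (ca A)) (r / 2).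
    by apply: has_series_partial (hf A) _ _; lra.
  have := has_series_eq0 ps r0 (fun z _ => fdep A b z) (msub c (me (xd b))).
  rewrite fD_pred// => /eqP; rewrite mulf_eq0 pnatr_eq0 -leqn0 leqNgt cb/= => /eqP ->.
  by rewrite mulr0.
have [CF [q q0 hF]] : exists c, exists2 q : R, 0 < q &
   forall Ab : 'I_m * 'I_l, has_series (F Ab.1 Ab.2) (jet x0 p0 p0') (c Ab) q.
  by apply: analytic_series_family => Ab; case: (Fan Ab.1 Ab.2) => _; apply.
have /boolp.choice[MM HMM] : forall Ab, exists M, nbd (pw q) (CF Ab) M.
  by move=> Ab; have [_ H _] := hF Ab.
pose M := \sum_Ab MM Ab.
have MM0 Ab : 0 <= MM Ab by apply: sbounded_ge0 (HMM Ab).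
have HM A b : nbd (pw q) (CF (A, b)) M.
  by apply: nbdW (HMM (A, b)); rewrite /M (bigD1 (A, b))//= lerDl sumr_ge0.
have [g [r' r'0 [gL gfix]]] := @formal_solution R k l m x0 f ca r q M (fun A b => CF (A, b))
  q0 (sumr_ge0 _ (fun i _ => MM0 i)) HM hf r0.
pose u A x := f A x + \sum_b series_val x0 (Lop (@isdep k l) (xd b) (g A b)) x.
pose r1 := Num.min r r'; have r10 : 0 < r1 by rewrite lt_min r0.
have hu A : has_series (u A) x0 (useries ca g A) r1.
  apply: has_seriesD; first by apply: has_series_le (hf A); rewrite // ge_min lexx.
  apply: has_series_sum => // b; apply: (@has_series_le _ _ _ _ _ r') => //.
    by rewrite ge_min lexx orbT.
  by have [N HN] := gL A b; apply: has_series_val HN.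
have f0 A : f A x0 = p0 A by apply: a0.
have u0 A : u A x0 = p0 A.
  rewrite /u f0 big1 ?addr0// => b _; exact: series_val_Lop.
have up A G : partial (u A) (xf G) x0 = p0' A G.
  rewrite (has_series_partial_center (xf G) (hu A)) /useries big1 ?addr0.
    by rewrite -(has_series_partial_center (xf G) (hf A)) fp.
  by move=> b _; rewrite /Lop ffunE xd_neq_xf.
have uj : jet_of u x0 = jet x0 p0 p0'.
  by apply/funext => -[i|[A|[A G]]] //=; rewrite ?u0 ?up.
have ua A : analytic_at (u A) x0 by apply: has_series_analytic (hu A).
have Uju : U (jet_of u x0) by rewrite uj.
have hg Ab : exists2 q', 0 < q' & forall r2, 0 < r2 -> r2 <= q' ->
    has_series (fun z => F Ab.1 Ab.2 (jet_of u z)) x0 (g Ab.1 Ab.2) r2.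
  have := hF Ab; rewrite -uj => hF'.
  have [q' q'0 H] := has_series_jet hu r10 hF'.
  exists q' => // r2 r20 r2q; have := H r2 r20 r2q; congr has_series.
  rewrite gfix; case: Ab {hF' H} => A b /=; congr fcomp; congr jetser.
    by apply/funext => B; rewrite u0 f0.
  by apply/funext => B; apply/funext => G; rewrite up fp.
have [q' q'0 hg'] := fin_small hg.
have [|rr rr0 H] := @residual_eq0_near u x0 (useries ca g) r1 g q' oU Fan comp Uju r10 hu q'0
    (fun A b => hg' q' q'0 (lexx _) (A, b)).
  (* The Euler operator kills the datum and cancels the division by the y-degree in [Lop]. *)
  move=> A c; rewrite /useries mulrDr cadep add0r mulr_sumr; apply: eq_bigr => b _.
  rewrite /Lop; case: ifPn => cb; last by rewrite mulr0.
  by rewrite mulrC mulfVK// pnatr_eq0 (ydeg_pred cb).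
exists (obox x0 rr), u; split.
- exact: open_obox.
- by move=> i; rewrite subrr normr0.
- by move=> A; split; [exact: open_obox|move=> z /H[]].
- split=> [x /H[]//|x A b /H[_ _ /(_ A b)/eqP]].
  by rewrite /residual subr_eq0 => /eqP.
- move=> x A _ xdep _; rewrite /u big1 ?addr0// => b _.
  exact: series_val_Lop.
Qed.

Lemma compatibility_solvable : open_set U -> (forall A b, analytic_on U (F A b)) ->
  compatibility U F -> solvable_everywhere U F.
Proof.
move=> oU Fan comp x0 p0 p0' Uj a W adm; split; first exact: solution_exists adm.
by move=> V1 u1 V2 u2; apply: (solution_unique Fan Uj adm).
Qed.

Lemma solvable_approx : solvable_everywhere U F -> approx_solvable_everywhere U F.
Proof.
move=> H x0 p0 p0' Uj a W adm; have [[V [u [oV Vx ua [uU ue] ui]]] _] := H x0 p0 p0' Uj a W adm.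
exists u, V, 0; split=> //.
  by split=> // x A b Vx'; rewrite ue// subrr normr0 mul0r.
by move=> x A Vx' xdep Wx; rewrite ui// subrr normr0 mul0r.
Qed.

End Existence.

Theorem theorem1p1 (R : realType) (k l m : nat)
    (U : set (jcoord k l m -> R)) (F : 'I_m -> 'I_l -> (jcoord k l m -> R) -> R) :
  (0 < k)%N -> (0 < l)%N -> (0 < m)%N ->
  open_set U ->
  (forall A al, analytic_on U (F A al)) ->
  (solvable_everywhere U F <-> approx_solvable_everywhere U F) /\
  (approx_solvable_everywhere U F <-> compatibility U F).
Proof.
move=> _ _ _ oU Fan.
have H1 := @solvable_approx R k l m U F.
have H2 := approx_compatibility Fan.
have H3 := compatibility_solvable oU Fan.
by split; split; [exact: H1|move=> /H2/H3|exact: H2|move=> /H3/H1].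
Qed.
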